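(* Let $y\in\mathbb{C}$. The $C^*$-algebra $\mathcal{E}(-1,y)$ is non-zero iff $|y|\le 1$. If $y\neq 0$ and $|y|\le1$, then any irreducible representation of $\mathcal{E}(-1,y)$ is unitarily equivalent to one of the following (given by the images of the generators $a_1,a_2$). (a) If $|y|=1$: $$a_1=\begin{pmatrix}0&0\\1&0\end{pmatrix},\qquad a_2=\begin{pmatrix}0&y\\0&0\end{pmatrix}.$$ (b) If $|y|<1$: (b1) if $x_1=\frac{1-|y|}{2}$, with $\phi_1\in[0,2\pi)$, $$a_1=\begin{pmatrix}0&e^{i\phi_1}\sqrt{\frac{1-|y|}{2}}\\ \sqrt{\frac{1+|y|}{2}}&0\end{pmatrix},\qquad a_2=\begin{pmatrix}0&\frac{y}{|y|}\sqrt{\frac{1+|y|}{2}}\\ -\frac{e^{-i\phi_1}y}{|y|}\sqrt{\frac{1-|y|}{2}}&0\end{pmatrix};$$ (b2.1) if $0\le x_1<\frac{1-|y|}{2}$ and $0\le x_2<\frac12$, with $\phi_1,\phi_2\in[0,2\pi)$, $$a_1=\begin{pmatrix}0&e^{i\phi_1}\sqrt{x_1}\\ \sqrt{1-x_1}&0\end{pmatrix}\otimes\begin{pmatrix}1&0\\0&1\end{pmatrix},$$ $$a_2=\sqrt{1-\tfrac{|y|^2}{(1-2x_1)^2}}\begin{pmatrix}1&0\\0&-1\end{pmatrix}\otimes\begin{pmatrix}0&e^{i\phi_2}\sqrt{x_2}\\ \sqrt{1-x_2}&0\end{pmatrix}+\frac{y}{1-2x_1}\begin{pmatrix}0&\sqrt{1-x_1}\\-e^{-i\phi_1}\sqrt{x_1}&0\end{pmatrix}\otimes\begin{pmatrix}1&0\\0&1\end{pmatrix};$$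 (b2.2) if $0\le x_1<\frac{1-|y|}{2}$ and $x_2=\frac12$, with $\phi_1,\phi_2\in[0,2\pi)$, $$a_1=\begin{pmatrix}0&e^{i\phi_1}\sqrt{x_1}\\ \sqrt{1-x_1}&0\end{pmatrix},\qquad a_2=\begin{pmatrix}\frac{e^{i\phi_2}}{\sqrt2}\sqrt{1-\frac{|y|^2}{(1-2x_1)^2}}&\frac{y\sqrt{1-x_1}}{1-2x_1}\\ -e^{-i\phi_1}\frac{y\sqrt{x_1}}{1-2x_1}&-\frac{e^{i\phi_2}}{\sqrt2}\sqrt{1-\frac{|y|^2}{(1-2x_1)^2}}\end{pmatrix}.$$ Moreover, when $y\ne0$, $|y|<1$, is fixed, the representations in (b) corresponding to non-equivalent (with respect to $\sim$) tuples $(x_1,x_2,e^{i\phi_1},e^{i\phi_2})\in D_y\times\mathbf{T}^2$ are not unitarily equivalent.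
   Context: For $y\in\mathbb{C}$, $\mathcal{E}(-1,y)$ is the universal (enveloping) $C^*$-algebra generated by $a_1,a_2$ with relations $a_i^*a_i+a_ia_i^*=1$ ($i=1,2$), $a_1^*a_2=-a_2a_1^*$, $a_1a_2+a_2a_1=y1$; i.e. $\mathcal{E}(-1,y)=\mathcal{E}(-1)/\langle a_1a_2+a_2a_1-y\rangle$, where $\mathcal{E}(-1)$ is the enveloping $C^*$-algebra of the first two families of relations. $\mathbf{T}=\{z\in\mathbb{C}:|z|=1\}$ and $D_y=\{(x_1,x_2): 0\le x_1\le\frac{1-|y|}{2},\ 0\le x_2\le\frac12\}$. The relation $\sim$ on $D_y\times\mathbf{T}^2$ is the equivalence relation generated by: $(x_1,x_2,e^{i\phi_1},e^{i\phi_2})\sim(y_1,y_2,e^{i\psi_1},e^{i\psi_2})$ if either $x_1=y_1=0$, $x_2=y_2$, $e^{i\phi_2}=e^{i\psi_2}$; or $x_2=y_2=0$, $x_1=y_1$, $e^{i\phi_1}=e^{i\psi_1}$; or $x_1=y_1=\frac{1-|y|}{2}$, $e^{i\phi_1}=e^{i\psi_1}$. The representation corresponding to a tuple is the one in (b1), (b2.1) or (b2.2) according to its values of $x_1,x_2$ (in case (b1) it does not depend on $x_2,\phi_2$). The tensor product of matrices is identified with the Kronecker product $A\otimes B=(a_{ij}B)$. *)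

(* Defs.v *)
From HB Require Import structures.
From mathcomp Require Import all_boot all_order all_algebra.
From mathcomp Require Import complex mxtens.
From mathcomp Require Import all_classical all_reals all_analysis.
From Stdlib Require Import Relations.

Set Implicit Arguments.
Unset Strict Implicit.
Unset Printing Implicit Defensive.

Import Order.TTheory GRing.Theory Num.Theory.
Import numFieldNormedType.Exports.

Local Open Scope classical_set_scope.
Local Open Scope ring_scope.

(* Unital complex C*-algebras. The product is not inherited from the ring
   structures of MathComp: those joined with a norm are nontrivial, whereas the
   zero algebra (1 = 0) must be allowed here. *)
HB.mixin Record NormedModule_isCStarAlgebra (R : realType) A
    & CompleteNormedModule R[i] A := {
  cone : A ;
  cmul : A -> A -> A ;
  star : A -> A ;
  cmulA : associative cmul ;
  cmul1 : left_id cone cmul ;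
  cmulr1 : right_id cone cmul ;
  cmulDl : left_distributive cmul +%R ;
  cmulDr : right_distributive cmul +%R ;
  cmulZl : forall (k : R[i]) (x y : A), cmul (k *: x) y = k *: cmul x y ;
  cmulZr : forall (k : R[i]) (x y : A), cmul x (k *: y) = k *: cmul x y ;
  starD : {morph star : x y / x + y} ;
  starZ : forall (k : R[i]) (x : A), star (k *: x) = k^* *: star x ;
  starM : forall x y : A, star (cmul x y) = cmul (star y) (star x) ;
  starK : involutive star ;
  cmul_norm : forall x y : A, `|cmul x y| <= `|x| * `|y| ;
  cstar_identity : forall x : A, `|cmul (star x) x| = `|x| ^+ 2
}.

#[short(type="cstarAlgType")]
HB.structure Definition CStarAlgebra (R : realType) :=
  {A of CompleteNormedModule R[i] A & NormedModule_isCStarAlgebra R A}.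

(* [hdot] is linear in its first argument and conjugate-linear in the second. *)
HB.mixin Record NormedModule_isHilbert (R : realType) H
    & CompleteNormedModule R[i] H := {
  hdot : {dot H for Num.conj} ;
  hdot_norm : forall x : H, hdot x x = `|x| ^+ 2
}.

#[short(type="hilbertType")]
HB.structure Definition Hilbert (R : realType) :=
  {H of CompleteNormedModule R[i] H & NormedModule_isHilbert R H}.

(* The Hilbert space C^n, as an alias of ['cV_n]: the norm that the library puts
   on matrices is the sup norm. *)
Section CnHilbert.
Variables (R : realType) (n : nat).

Definition Cn := 'cV[R[i]]_n.

HB.instance Definition _ := GRing.Lmodule.on Cn.
HB.instance Definition _ := Vector.on Cn.

Definition Cn_dot (u v : Cn) : R[i] := \sum_i u i 0 * (v i 0)^*.

Fact Cn_dot_linear_l v : linear_for *%R (Cn_dot ^~ v).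
Proof.
move=> k u w; rewrite /Cn_dot mulr_sumr -big_split /=; apply: eq_bigr => i _.
by rewrite !mxE mulrDl mulrA.
Qed.
Fact Cn_dot_linear_r u : GRing.linear_for (Num.conj \; *%R) (Cn_dot u).
Proof.
move=> k v w; rewrite /Cn_dot /= mulr_sumr -big_split /=; apply: eq_bigr => i _.
by rewrite !mxE rmorphD rmorphM mulrDr mulrCA.
Qed.
HB.instance Definition _ := bilinear_isBilinear.Build R[i] Cn Cn R[i]
  *%R (Num.conj \; *%R) Cn_dot (Cn_dot_linear_l, Cn_dot_linear_r).
Fact Cn_dot_herm (u v : Cn) : Cn_dot u v = (-1) ^+ false * (Cn_dot v u)^*.
Proof.
rewrite expr0 mul1r /Cn_dot rmorph_sum; apply: eq_bigr => i _.
by rewrite rmorphM /= conjCK mulrC.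
Qed.
HB.instance Definition _ :=
  isHermitianSesquilinear.Build R[i] Cn false Num.conj Cn_dot Cn_dot_herm.
Fact Cn_dot_pos (u : Cn) : u != 0 -> 0 < Cn_dot u u.
Proof.
move=> u0; rewrite lt_def; apply/andP; split; last first.
  by apply: sumr_ge0 => i _; rewrite -normCK exprn_ge0.
apply: contraNneq u0 => uu0; apply/eqP/matrixP => i j; rewrite mxE ord1.
apply/eqP; rewrite -normr_eq0 -sqrf_eq0 normCK; apply/eqP.
move: uu0 => /eqP; rewrite psumr_eq0 => [/allP/(_ i)|k _]; last first.
  by rewrite -normCK exprn_ge0.
by rewrite mem_index_enum => /(_ isT)/eqP.
Qed.
HB.instance Definition _ := isDotProduct.Build _ _ Cn_dot Cn_dot_pos.

Definition Cn_norm (u : Cn) : R[i] := sqrtC (Cn_dot u u).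

Fact Cn_normD (u v : Cn) : Cn_norm (u + v) <= Cn_norm u + Cn_norm v.
Proof. exact: (triangle_lerif (Cn_dot : {dot Cn for Num.conj})). Qed.

Fact Cn_normZ (k : R[i]) (u : Cn) : Cn_norm (k *: u) = `|k| * Cn_norm u.
Proof.
rewrite /Cn_norm linearZl_LR linearZr_LR /= mulrA -normCK rootCMl ?exprn_ge0//.
by rewrite sqrCK.
Qed.

Fact Cn_norm0_eq0 (u : Cn) : Cn_norm u = 0 -> u = 0.
Proof.
move=> /eqP; rewrite sqrtC_eq0 => /eqP uu0; apply/eqP/negPn/negP => /Cn_dot_pos.
by rewrite uu0 ltxx.
Qed.

HB.instance Definition _ :=
  Lmodule_isNormed.Build R[i] Cn Cn_normD Cn_normZ Cn_norm0_eq0.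

Fact Cn_dot_norm (u : Cn) : Cn_dot u u = `|u| ^+ 2.
Proof. by rewrite sqrtCK. Qed.

Let Cn_norm_coord (u : Cn) i : `|u i 0| <= `|u|.
Proof.
rewrite -(@ler_pXn2r _ 2)// ?nnegrE// -Cn_dot_norm /Cn_dot (bigD1 i)//= -normCK.
by rewrite lerDl sumr_ge0// => j _; rewrite -normCK exprn_ge0.
Qed.

Let Cn_norm_sum (u : Cn) : `|u| <= \sum_i `|u i 0|.
Proof.
rewrite -(@ler_pXn2r _ 2)// ?nnegrE// ?sumr_ge0// -Cn_dot_norm /Cn_dot.
rewrite [leRHS]expr2 mulr_suml ler_sum// => i _; rewrite -normCK expr2.
by rewrite ler_wpM2l// (bigD1 i)//= lerDl sumr_ge0.
Qed.

Let complex_norm_le (z : R[i]) :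
  `|z| <= (`|complex.Re z| + `|complex.Im z|)%:C%C.
Proof.
case: z => a b; rewrite normc_def /= lecR -(@ler_pXn2r _ 2)// ?nnegrE ?addr_ge0//.
  rewrite sqr_sqrtr ?addr_ge0 ?sqr_ge0// sqrrD !real_normK ?num_real//.
  by rewrite addrAC lerDl mulrn_wge0// mulr_ge0.
Qed.

Fact Cn_complete (F : set_system Cn) : ProperFilter F -> cauchy F -> cvg F.
Proof.
move=> FF Fc.
pose part (b : bool) i (u : Cn) : R :=
  if b then complex.Re (u i 0) else complex.Im (u i 0).
have part_le b i u v : (`|part b i u - part b i v|)%:C%C <= `|u - v|.
  apply: le_trans (Cn_norm_coord (u - v) i); rewrite !mxE /part.
  case: (u i 0) (v i 0) => [p q] [r s]; rewrite normc_def /= lecR.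
  case: b; rewrite -sqrtr_sqr ler_wsqrtr// ?lerDl ?lerDr ?sqr_ge0//.
have cvgpart b i : cvg (part b i @ F).
  apply: cauchy_cvg; apply: cauchy_exP => e e0.
  have ec0 : 0 < e%:C%C :> R[i] by rewrite ltcR.
  have [v Fv] := (cauchyP F).1 Fc _ ec0.
  exists (part b i v).
  suff: F (part b i @^-1` ball (part b i v) e) by [].
  apply: filterS Fv => u.
  rewrite -!ball_normE /= => uv.
  by rewrite -ltcR (le_lt_trans (part_le b i v u)).
pose L : Cn := \col_i (lim (part true i @ F) +i* lim (part false i @ F))%C.
have distL u : `|L - u| <=
    (\sum_i \sum_b `|lim (part b i @ F) - part b i u|)%:C%C.
  apply: le_trans (Cn_norm_sum _) _; rewrite rmorph_sum ler_sum //= => i _.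
  apply: le_trans (complex_norm_le _) _; rewrite lecR big_bool /part !mxE.
  by case: (u i 0) => p q /=; rewrite lerD.
apply/cvg_ex; exists L; apply/cvgrPdist_lt => /= e e0.
have eE : e = (complex.Re e)%:C%C.
  by case: e e0 => a b; rewrite ltcE /= => /andP[/eqP ->].
have r0 : 0 < complex.Re e by rewrite -ltcR -eE.
pose d := complex.Re e / (n.*2.+1)%:R.
have d0 : 0 < d by rewrite divr_gt0.
have nearL : \forall u \near F, forall b i,
    `|lim (part b i @ F) - part b i u| < d.
  apply: filter_forall => b; apply: filter_forall => i.
  have /cvgrPdist_lt := cvgpart b i; exact.
apply: filterS nearL => u uL; apply: le_lt_trans (distL u) _.
rewrite eE ltcR; apply: (@le_lt_trans _ _ (\sum_(i < n) \sum_(b : bool) d)).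
  by apply: ler_sum => i _; apply: ler_sum => b _; exact/ltW/uL.
rewrite big_const_ord iter_addr_0 big_bool /= -mulr2n -mulrnA mul2n -mulr_natr /d.
by rewrite mulrAC ltr_pdivrMr// ltr_pM2l// ltr_nat.
Qed.

HB.instance Definition _ := Uniform_isComplete.Build Cn Cn_complete.
HB.instance Definition _ := NormedModule_isHilbert.Build R Cn Cn_dot_norm.
End CnHilbert.

Section Representations.
Variable R : realType.

Definition star_hom (A B : cstarAlgType R) (f : A -> B) : Prop :=
  [/\ linear f, f cone = cone,
      forall x z, f (cmul x z) = cmul (f x) (f z)
    & forall x, f (star x) = star (f x)].

Definition E_relations (y : R[i]) (A : cstarAlgType R) (a1 a2 : A) : Prop :=
  [/\ cmul (star a1) a1 + cmul a1 (star a1) = cone,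
      cmul (star a2) a2 + cmul a2 (star a2) = cone,
      cmul (star a1) a2 = - cmul a2 (star a1)
    & cmul a1 a2 + cmul a2 a1 = y *: cone].

(* [A], with generators [a1] and [a2], is the universal C*-algebra E(-1,y). *)
Definition universal_E (y : R[i]) (A : cstarAlgType R) (a1 a2 : A) : Prop :=
  E_relations y a1 a2 /\
  forall (B : cstarAlgType R) (b1 b2 : B), E_relations y b1 b2 ->
    exists! f : A -> B, [/\ star_hom f, f a1 = b1 & f a2 = b2].

(* Representations are unital *-homomorphisms into bounded operators. *)
Definition representation (A : cstarAlgType R) (H : hilbertType R)
    (pi : A -> H -> H) : Prop :=
  [/\ forall a, linear (pi a) /\ continuous (pi a),
      forall k a b v, pi (k *: a + b) v = k *: pi a v + pi b v,
      forall v, pi cone v = v,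
      forall a b v, pi (cmul a b) v = pi a (pi b v)
    & forall a v w, hdot (pi (star a) v) w = hdot v (pi a w)].

Definition irreducible (A : cstarAlgType R) (H : hilbertType R)
    (pi : A -> H -> H) : Prop :=
  (exists v : H, v != 0) /\
  forall W : set H, closed W -> W 0 ->
    (forall k v w, W v -> W w -> W (k *: v + w)) ->
    (forall a v, W v -> W (pi a v)) ->
    W = [set 0] \/ W = setT.

Definition unitarily_equivalent (A : cstarAlgType R) (H K : hilbertType R)
    (pi : A -> H -> H) (rho : A -> K -> K) : Prop :=
  exists U : H -> K,
    [/\ linear U, bijective U,
        forall v w, hdot (U v) (U w) = hdot v w
      & forall a v, U (pi a v) = rho a (U v)].

Definition given_by_matrices (A : cstarAlgType R) (a1 a2 : A) (n : nat)
    (M1 M2 : 'M[R[i]]_n) (rho : A -> Cn R n -> Cn R n) : Prop :=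
  [/\ representation rho,
      forall v, rho a1 v = M1 *m v
    & forall v, rho a2 v = M2 *m v].

End Representations.

Section Models.
Variable R : realType.
Implicit Types (y w : R[i]) (x : R).

(* [`|z|] is a (real) element of R[i]; [cmod z] is the same number in R. *)
Definition cmod (z : R[i]) : R := complex.Re `|z|.

Definition cis (phi : R) : R[i] := (cos phi +i* sin phi)%C.

Definition mx2 (a b c d : R[i]) : 'M[R[i]]_2 :=
  \matrix_(i, j) (if i == 0 then (if j == 0 then a else b)
                  else (if j == 0 then c else d)).

Definition csqrt x : R[i] := (Num.sqrt x)%:C%C.

(* In the models below w1 and w2 stand for e^{i phi1} and e^{i phi2}, so that
   the conjugate of w1 is e^{- i phi1}. *)

Definition a_mx1 : 'M[R[i]]_2 := mx2 0 0 1 0.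
Definition a_mx2 y : 'M[R[i]]_2 := mx2 0 y 0 0.

Definition b1_mx1 y w1 : 'M[R[i]]_2 :=
  mx2 0 (w1 * csqrt ((1 - cmod y) / 2))
      (csqrt ((1 + cmod y) / 2)) 0.
Definition b1_mx2 y w1 : 'M[R[i]]_2 :=
  mx2 0 (y / `|y| * csqrt ((1 + cmod y) / 2))
      (- (w1^* * y / `|y| * csqrt ((1 - cmod y) / 2))) 0.

Definition weight_mx x w : 'M[R[i]]_2 :=
  mx2 0 (w * csqrt x) (csqrt (1 - x)) 0.

Definition b_coef y x1 : R[i] := csqrt (1 - cmod y ^+ 2 / (1 - 2 * x1) ^+ 2).

Definition b21_mx1 x1 w1 : 'M[R[i]]_(2 * 2) := weight_mx x1 w1 *t 1%:M.
Definition b21_mx2 y x1 x2 w1 w2 : 'M[R[i]]_(2 * 2) :=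
  b_coef y x1 *: (mx2 1 0 0 (-1) *t weight_mx x2 w2)
  + (y / (1 - 2 * x1)%:C%C)
    *: (mx2 0 (csqrt (1 - x1)) (- (w1^* * csqrt x1)) 0 *t 1%:M).

Definition b22_mx1 x1 w1 : 'M[R[i]]_2 := weight_mx x1 w1.
Definition b22_mx2 y x1 w1 w2 : 'M[R[i]]_2 :=
  mx2 (w2 / csqrt 2 * b_coef y x1)
      (y * csqrt (1 - x1) / (1 - 2 * x1)%:C%C)
      (- (w1^* * (y * csqrt x1 / (1 - 2 * x1)%:C%C)))
      (- (w2 / csqrt 2 * b_coef y x1)).

Record params := Params { px1 : R; px2 : R; pw1 : R[i]; pw2 : R[i] }.

Definition in_DyT2 y (p : params) : Prop :=
  [/\ 0 <= px1 p <= (1 - cmod y) / 2, 0 <= px2 p <= 1 / 2,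
      `|pw1 p| = 1 & `|pw2 p| = 1].

(* [*t] is the Kronecker product. [b_model y p M1 M2] says that (M1, M2) are the
   images of (a1, a2) in the representation attached to the tuple [p]. *)
Inductive b_model y (p : params) :
    forall n : nat, 'M[R[i]]_n -> 'M[R[i]]_n -> Prop :=
  | B_model1 : px1 p = (1 - cmod y) / 2 ->
      b_model y p (b1_mx1 y (pw1 p)) (b1_mx2 y (pw1 p))
  | B_model21 : 0 <= px1 p < (1 - cmod y) / 2 -> 0 <= px2 p < 1 / 2 ->
      b_model y p (b21_mx1 (px1 p) (pw1 p))
                  (b21_mx2 y (px1 p) (px2 p) (pw1 p) (pw2 p))
  | B_model22 : 0 <= px1 p < (1 - cmod y) / 2 -> px2 p = 1 / 2 ->
      b_model y p (b22_mx1 (px1 p) (pw1 p))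
                  (b22_mx2 y (px1 p) (pw1 p) (pw2 p)).

Definition basic_equiv y (p q : params) : Prop :=
  [/\ in_DyT2 y p, in_DyT2 y q &
      [\/ [/\ px1 p = 0, px1 q = 0, px2 p = px2 q & pw2 p = pw2 q],
          [/\ px2 p = 0, px2 q = 0, px1 p = px1 q & pw1 p = pw1 q]
        | [/\ px1 p = (1 - cmod y) / 2, px1 q = (1 - cmod y) / 2
            & pw1 p = pw1 q]]].

Definition params_equiv y : params -> params -> Prop :=
  clos_refl_sym_trans params (basic_equiv y).

End Models.

(* Main.v *)
(* Both [a1 ^ 2] and [a2 ^ 2] are central and normal, so they are scalars alpha
   and beta in an irreducible representation. Schur's lemma is obtained without
   spectral theory: [m - h] and its absolute value are elements of the algebra,
   the latter by an iterative square root. Square roots also give unitaries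
   [h + i sqrt (1 - h ^ 2)]; conjugating by them and using the uniqueness in the
   universal property, whatever commutes with the generators commutes with the
   whole algebra. This is applied in E itself and in B(H), which is therefore
   made into a C*-algebra.

   With alpha scalar, [K = a1^* a1 - a1 a1^*] anticommutes with [a1] and
   [K ^ 2 = (1 - 4 |alpha|^2)]; for an eigenvector e of K the span of e and
   [a1 e] carries the 2x2 model of [a1]. Put [d = 1 - 2 x1], so that
   [K ^ 2 = d ^ 2]. The part
   [C = a2 - (y / d ^ 2) (a1^* - 2 conj(alpha) a1)] of [a2] anticommutes with
   [a1] and [a1^*], and [C^* C + C C^* = 1 - |y|^2 / d ^ 2], whence the bound on
   x1. If this scalar vanishes, C = 0 (case b1 or a). Otherwise the normalised C
   satisfies the relation of a single generator, and x2, w2 come from it in the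
   same way; its own K operator vanishes exactly when x2 = 1/2. The parameters
   are recovered from alpha, beta and, when x2 = 1/2, from the ratio C / K. *)

From HB Require Import structures.
Require Import Defs.
From mathcomp Require Import all_boot all_order all_algebra.
From mathcomp Require Import complex mxtens ring lra.
From mathcomp Require Import all_classical all_reals all_analysis.
From Stdlib Require Import Relations.

Set Implicit Arguments.
Unset Strict Implicit.
Unset Printing Implicit Defensive.

Import Order.TTheory GRing.Theory Num.Theory.
Import numFieldNormedType.Exports.

Local Open Scope ring_scope.

Local Notation "x ** y" := (cmul x y) (at level 40, left associativity).

(** Universality only supplies maps out of the algebra; that [a1] and [a2] generate a dense
    subalgebra is not part of its statement. Every passage from the generators to all elements
    therefore goes through uniqueness, which compares maps into a C*-algebra. The classification is
    a Clifford-type computation. Once both squares are scalars, the anticommutator is a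
    scalar-valued bilinear form on the span of [a1], [a2] and their adjoints, and [C] is obtained by
    Gram-Schmidt: the component of [a2] along [a1] and [star a1] is removed. On that plane the Gram
    determinant is [4 |alpha|^2 - 1 = - d ^ 2], so the projection needs d nonzero, which y nonzero
    guarantees. What remains is a second single generator, independent of the first up to signs;
    [K / d] records these signs, whence the tensor products and the factor diag(1, -1). Identities
    in the algebra are proved by rewriting words to a normal order and comparing coefficients, the
    remaining words being treated as atoms. *)

Section SquareZero.
Variables (K : comNzRingType) (V : lmodType K).

(** The trivial extension of [K] by [V]; for [V = K] these are the dual numbers. *)
Definition sqz : Type := (K * V)%type.
HB.instance Definition _ := GRing.Zmodule.on sqz.

Let one : sqz := (1, 0).
Let mul (p q : sqz) : sqz := (p.1 * q.1, p.1 *: q.2 + q.1 *: p.2).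

Let mulA : associative mul.
Proof.
move=> [a u] [b v] [c w]; rewrite /mul /= mulrA; congr pair.
by rewrite !scalerDr !scalerA addrA (mulrC c a) (mulrC c b).
Qed.
Let mulC : commutative mul.
Proof. by move=> [a u] [b v]; rewrite /mul /= mulrC addrC. Qed.
Let mul1 : left_id one mul.
Proof. by move=> [a u]; rewrite /mul /= mul1r scaler0 addr0 scale1r. Qed.
Let mulDl : left_distributive mul +%R.
Proof.
move=> [a u] [b v] [c w]; rewrite /mul /= mulrDl; congr pair.
by rewrite /= scalerDl scalerDr addrACA.
Qed.
Let nz : one != 0 :> sqz.
Proof. by apply/eqP => -[/eqP]; rewrite oner_eq0. Qed.
HB.instance Definition _ :=
  GRing.Zmodule_isComNzRing.Build sqz mulA mulC mul1 mulDl nz.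

Definition sqz_scal (k : K) : sqz := (k, 0).
Definition sqz_vec (v : V) : sqz := (0, v).

Let scalD : zmod_morphism sqz_scal.
Proof. by move=> a b; rewrite /sqz_scal; congr pair; rewrite subr0. Qed.
HB.instance Definition _ := GRing.isZmodMorphism.Build K sqz sqz_scal scalD.
Let scalM : monoid_morphism sqz_scal.
Proof. by split => // a b; congr pair; rewrite !scaler0 addr0. Qed.
HB.instance Definition _ := GRing.isMonoidMorphism.Build K sqz sqz_scal scalM.
Let vecD : zmod_morphism sqz_vec.
Proof. by move=> a b; rewrite /sqz_vec; congr pair; rewrite subr0. Qed.
HB.instance Definition _ := GRing.isZmodMorphism.Build V sqz sqz_vec vecD.

Lemma sqz_vecZ k v : sqz_vec (k *: v) = sqz_scal k * sqz_vec v.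
Proof. by congr pair; rewrite ?mulr0 // scale0r addr0. Qed.
Lemma sqz_vecD u v : sqz_vec (u + v) = sqz_vec u + sqz_vec v.
Proof. exact: raddfD. Qed.
Lemma sqz_vecN u : sqz_vec (- u) = - sqz_vec u.
Proof. exact: raddfN. Qed.
Lemma sqz_vec0 : sqz_vec 0 = 0.
Proof. exact: raddf0. Qed.
Lemma sqz_vecMn u n : sqz_vec (u *+ n) = sqz_vec u *+ n.
Proof. exact: raddfMn. Qed.
Lemma sqz_vec_inj : injective sqz_vec.
Proof. by move=> u v []. Qed.
End SquareZero.

(* Equality of linear combinations holds in [V] if it holds in the commutative
   ring [K (+) V] in which [V] has square zero. *)
Ltac modring :=
  apply: sqz_vec_inj; rewrite ?(sqz_vecD, sqz_vecN, sqz_vecMn, sqz_vec0, sqz_vecZ) /=; ring.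

(** * Norm estimates and convergence by a real majorant *)

Section RealMajorant.
Variable R : realType.

(** Norms take values in [R[i]]; together with [lecR] this moves estimates to [R]. *)
Lemma norm_complexE (V : normedZmodType R[i]) (x : V) :
  `|x| = (complex.Re `|x|)%:C%C.
Proof. by rewrite RRe_real // normr_real. Qed.

Lemma Re_norm_ge0 (V : normedZmodType R[i]) (x : V) : 0 <= complex.Re `|x|.
Proof. by have := normr_ge0 x; rewrite norm_complexE ler0c. Qed.

Lemma rCM (a b : R) : (a * b)%:C%C = a%:C%C * b%:C%C.
Proof. exact: rmorphM. Qed.
Lemma rCD (a b : R) : (a + b)%:C%C = a%:C%C + b%:C%C.
Proof. exact: rmorphD. Qed.
Lemma rCB (a b : R) : (a - b)%:C%C = a%:C%C - b%:C%C.
Proof. exact: rmorphB. Qed.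
Lemma rCV (a : R) : (a^-1)%:C%C = a%:C%C^-1.
Proof. exact: fmorphV. Qed.
Lemma rCX (a : R) n : (a ^+ n)%:C%C = a%:C%C ^+ n.
Proof. exact: rmorphXn. Qed.
Lemma rCn n : (n%:R : R)%:C%C = n%:R :> R[i].
Proof. exact: rmorph_nat. Qed.

Lemma rC_sum I (r : seq I) (P : pred I) (F : I -> R) :
  (\sum_(i <- r | P i) F i)%:C%C = \sum_(i <- r | P i) (F i)%:C%C.
Proof. exact: rmorph_sum. Qed.

(** The bound is used at [e / (|k| + 1)], so a caller may take any sum of norms for [k] without
    checking that it is positive. *)
Lemma norm_small_eq0 (V : normedZmodType R[i]) (x : V) (k : R) :
  (forall e : R, 0 < e -> `|x| <= (k * e)%:C%C) -> x = 0.
Proof.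
move=> small; apply/eqP; rewrite -normr_le0 norm_complexE lecR.
apply/ler_addgt0Pr => e e0; rewrite add0r.
have k1 : 0 < `|k| + 1 by rewrite ltr_wpDl.
have := small _ (divr_gt0 e0 k1); rewrite norm_complexE lecR => /le_trans; apply.
rewrite mulrA ler_pdivrMr // mulrC ler_pM2l //.
by rewrite (le_trans (ler_norm k)) // lerDl.
Qed.

(** The majorant [t] is nondecreasing and bounded, hence convergent, and its increments control
    those of [u]. The conclusion is stated with real [e] and without filters, the form in which
    limits are estimated afterwards. *)
Lemma cvg_majorant (V : completeNormedModType R[i]) (u : nat -> V)
    (t : nat -> R) :
  (forall n m, (n <= m)%N -> `|u m - u n| <= (t m - t n)%:C%C) ->
  (exists M, forall n, t n <= M) ->
  exists l, forall e : R, 0 < e ->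
    exists N, forall n, (N <= n)%N -> `|l - u n| <= e%:C%C.
Proof.
move=> ut [M tM].
have t_nd : nondecreasing_seq t.
  by move=> n m nm; rewrite -subr_ge0 -lecR (le_trans _ (ut _ _ nm)).
have t_cvg : cvgn t.
  by apply: nondecreasing_is_cvgn => //; exists M => _ [n _ <-].
have tN (e : R) : 0 < e -> exists N, forall n m, (N <= n)%N -> (n <= m)%N ->
    `|u m - u n| <= e%:C%C.
  move=> e0; have /cvgrPdist_le/(_ _ e0)[N _ tl] := t_cvg.
  exists N => n m Nn nm; apply: le_trans (ut _ _ nm) _; rewrite lecR.
  have tml := nondecreasing_cvgn_le t_nd t_cvg m.
  have := tl n Nn; rewrite ler_norml => /andP[_].
  by apply: le_trans; rewrite lerD2r.
have u_cvg : cvgn u.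
  apply: cauchy_cvg; apply/cauchyP => e e0.
  have eE : e = (complex.Re e)%:C%C.
    by case: e e0 => a b; rewrite ltcE /= => /andP[/eqP ->].
  have r0 : 0 < complex.Re e by rewrite -ltcR -eE.
  (* Halving turns the weak inequality of [tN] into membership in an open ball. *)
  have [N uN] := tN _ (divr_gt0 r0 (ltr0Sn _ 1)).
  exists (u N); exists N => // m /= Nm.
  rewrite -ball_normE /= distrC (le_lt_trans (uN N m _ Nm)) //.
  by rewrite eE ltcR gtr_pMr // invf_lt1 // ltr1n.
exists (lim (u @ \oo)%classic) => e e0.
have [N uN] := tN _ (divr_gt0 e0 (ltr0Sn _ 1)).
exists N => n Nn.
have e2 : 0 < (e / 2)%:C%C :> R[i] by rewrite ltcR divr_gt0.
have /cvgrPdist_le/(_ _ e2)[N' _ ul] := u_cvg.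
have := ul (maxn n N') (leq_maxr _ _).
move=> /= ul'; rewrite [e]splitr rmorphD /=.
have -> : lim (u @ \oo)%classic - u n
    = (lim (u @ \oo)%classic - u (maxn n N')) + (u (maxn n N') - u n).
  by rewrite addrA subrK.
by rewrite (le_trans (ler_normD _ _)) // lerD // uN // leq_maxl.
Qed.
End RealMajorant.

(** * Elementary theory of C*-algebras *)

Section CStarTheory.
Variables (R : realType) (A : cstarAlgType R).
Implicit Types x y z b h : A.

Lemma cmul0l x : 0 ** x = 0.
Proof. by apply: (addIr (0 ** x)); rewrite -cmulDl !add0r. Qed.
Lemma cmul0r x : x ** 0 = 0.
Proof. by apply: (addIr (x ** 0)); rewrite -cmulDr !add0r. Qed.
Lemma cmulNl x y : (- x) ** y = - (x ** y).
Proof. by apply: (addIr (x ** y)); rewrite -cmulDl !addNr cmul0l. Qed.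
Lemma cmulNr x y : x ** (- y) = - (x ** y).
Proof. by apply: (addIr (x ** y)); rewrite -cmulDr !addNr cmul0r. Qed.
Lemma star0 : star 0 = 0 :> A.
Proof. by apply: (addIr (star 0)); rewrite -starD !add0r. Qed.
Lemma starN x : star (- x) = - star x.
Proof. by apply: (addIr (star x)); rewrite -starD !addNr star0. Qed.
Lemma star1 : star cone = cone :> A.
Proof. by rewrite -[LHS]cmulr1 -{2}[cone]starK -starM cmulr1 starK. Qed.

Definition cmul_lin :=
  (@cmulDl R A, @cmulDr R A, cmulNl, cmulNr, @cmulZl R A, @cmulZr R A,
   cmul0l, cmul0r, @cmulA R A, @cmul1 R A, @cmulr1 R A).
Definition star_lin := (@starD R A, starN, @starZ R A, @starM R A, star0, star1, @starK R A).

Lemma norm_star x : `|star x| = `|x|.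
Proof.
suff le z : `|z| <= `|star z| by apply/le_anti; rewrite le -{2}[x]starK le.
have [->|z0] := eqVneq z 0; first by rewrite normr0.
rewrite -(@ler_pM2r _ `|z|) ?normr_gt0 // -expr2 -cstar_identity.
exact: cmul_norm.
Qed.

Lemma cone_eq0 : cone = 0 :> A -> forall x, x = 0.
Proof. by move=> c0 x; rewrite -[x]cmul1 c0 cmul0l. Qed.

(** The element [x] certifies that the algebra is not the zero algebra, in which [cone] has norm
    0. *)
Lemma norm_cone x : x != 0 -> `|cone : A| = 1.
Proof.
move=> x0; have c0 : `|cone : A| != 0.
  by rewrite normr_eq0; apply: contraNneq x0 => /cone_eq0/(_ x) ->.
apply: (mulIf c0); rewrite mul1r -expr2 -cstar_identity star1.
by rewrite cmul1.
Qed.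

Lemma norm_cone_le1 : `|cone : A| <= 1.
Proof.
have [->|/norm_cone ->//] := eqVneq (cone : A) 0.
by rewrite normr0 ler01.
Qed.

(* With [y = 1 - sqrt (1 - b)]: the iterates of [y |-> (b + y^2)/2] from [0] are
   dominated by those of [t |-> (1 + t^2)/2], which increase and are bounded. *)
Lemma half_sqrt b : `|b| <= 1 ->
  exists y, [/\ y = 2^-1 *: (b + y ** y), `|y| <= 1,
    forall x, x ** b = b ** x -> x ** y = y ** x
    & star b = b -> star y = y].
Proof.
move=> b1.
pose Y := fix Y n := if n is n'.+1 then 2^-1 *: (b + Y n' ** Y n') else 0.
pose t := fix t n := if n is n'.+1 then (1 + t n' ^+ 2) / 2 else 0 : R.
have Y0 : Y 0%N = 0 by [].
have YS n : Y n.+1 = 2^-1 *: (b + Y n ** Y n) by [].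
have t0 : t 0%N = 0 by [].
have tS n : t n.+1 = (1 + t n ^+ 2) / 2 by [].
clearbody Y t.
have t01 n : 0 <= t n <= 1.
  elim: n => [|n /andP[tn0 tn1]]; first by rewrite t0 lexx ler01.
  rewrite tS; nra.
have Yt n : `|Y n| <= (t n)%:C%C.
  elim: n => [|n IHn]; first by rewrite Y0 t0 normr0.
  rewrite YS tS normrZ mulrC rCM ger0_norm ?invr_ge0 ?ler0n //.
  rewrite rCV rCD rCX (rCn _ 1) rCn.
  rewrite ler_pM2r ?invr_gt0 ?ltr0n // (le_trans (ler_normD _ _)) // lerD //.
  rewrite (le_trans (cmul_norm _ _)) // expr2.
  by apply: ler_pM.
have Ycomm n x : x ** b = b ** x -> x ** Y n = Y n ** x.
  move=> xb; elim: n => [|n IHn]; first by rewrite Y0 cmul0l cmul0r.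
  rewrite YS.
  by rewrite !cmul_lin xb IHn -cmulA IHn cmulA.
(* [Ycomm] twice: [b] commutes with itself, hence with [Y n], hence [Y n] commutes with [Y m]. *)
have YC n m : Y n ** Y m = Y m ** Y n.
  by apply: (Ycomm); symmetry; apply: (Ycomm).
have dY n : `|Y n.+1 - Y n| <= (t n.+1 - t n)%:C%C.
  elim: n => [|n IHn].
    rewrite YS tS Y0 t0 subr0 cmul0l addr0 normrZ expr0n /= addr0 subr0 mul1r.
    rewrite ger0_norm ?invr_ge0 ?ler0n // rCV rCn.
    by rewrite ler_piMr // invr_ge0 ler0n.
  have -> : Y n.+2 - Y n.+1 = 2^-1 *: ((Y n.+1 + Y n) ** (Y n.+1 - Y n)).
    rewrite [Y n.+2]YS {3}[Y n.+1]YS -scalerBr; congr (_ *: _).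
    rewrite !(cmulDl, cmulDr, cmulNl, cmulNr) (YC n n.+1).
    by modring.
  have -> : t n.+2 - t n.+1 = 2^-1 * ((t n.+1 + t n) * (t n.+1 - t n)).
    by rewrite [t n.+2]tS {2}[t n.+1]tS; field.
  rewrite normrZ rmorphM /= ger0_norm ?invr_ge0 ?ler0n // fmorphV (rmorph_nat _ 2).
  rewrite ler_pM2l ?invr_gt0 ?ltr0n // (le_trans (cmul_norm _ _)) // rmorphM /=.
  by rewrite ler_pM // (le_trans (ler_normD _ _)) // rmorphD lerD.
have dYm n m : (n <= m)%N -> `|Y m - Y n| <= (t m - t n)%:C%C.
  move=> /subnKC <-; elim: (m - n)%N => [|k IHk].
    by rewrite addn0 !subrr normr0.
  rewrite addnS (_ : Y _ - Y n = (Y (n + k).+1 - Y (n + k)%N) + (Y (n + k)%N - Y n));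
    last by rewrite addrA subrK.
  rewrite (_ : t _ - t n = (t (n + k).+1 - t (n + k)%N) + (t (n + k)%N - t n));
    last by rewrite addrA subrK.
  by rewrite rCD (le_trans (ler_normD _ _)) // lerD.
have [|y yY] := cvg_majorant dYm.
  by exists 1 => n; have /andP[] := t01 n.
have Y1 n : `|Y n| <= 1.
  by rewrite (le_trans (Yt n)) // lecR; have /andP[] := t01 n.
have y1 : `|y| <= 1.
  rewrite norm_complexE lecR; apply/ler_addgt0Pr => e e0.
  have [N /(_ N (leqnn _)) yN] := yY _ e0.
  rewrite -lecR -norm_complexE -[y](subrK (Y N)) addrC.
  by rewrite rCD (le_trans (ler_normD _ _)) // lerD.
have two0 : 0 <= 2^-1 :> R[i] by rewrite invr_ge0 ler0n.
exists y; split => //.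
- apply/eqP; rewrite -subr_eq0; apply/eqP.
  apply: (@norm_small_eq0 _ _ _ 2) => e e0.
  have [N yN] := yY _ e0.
  (* Adding and subtracting the recursion for [Y N.+1] cancels [b]. The difference of squares is
     split into two products whose other factors have norm at most 1; this accounts for the constant
     2. *)
  have -> : y - 2^-1 *: (b + y ** y) = (y - Y N.+1)
      + 2^-1 *: ((Y N - y) ** Y N + y ** (Y N - y)).
    by rewrite YS !(cmulDl, cmulDr, cmulNl, cmulNr); modring.
  rewrite mulrDl mul1r rCD (le_trans (ler_normD _ _)) // lerD ?yN //.
  rewrite normrZ ger0_norm // ler_pdivrMl ?ltr0n // (le_trans (ler_normD _ _)) //.
  rewrite mulr_natl mulr2n lerD // (le_trans (cmul_norm _ _)) // distrC.
    by rewrite -[leRHS]mulr1 ler_pM // yN.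
  by rewrite -[leRHS]mul1r ler_pM // yN.
- move=> x xb; apply/eqP; rewrite -subr_eq0; apply/eqP.
  apply: (@norm_small_eq0 _ _ _ (2 * complex.Re `|x|)) => e e0.
  have [N /(_ N (leqnn _)) yN] := yY _ e0.
  have -> : x ** y - y ** x = x ** (y - Y N) - (y - Y N) ** x.
    rewrite !(cmulDl, cmulDr, cmulNl, cmulNr) (Ycomm N x xb); by modring.
  rewrite mulrAC -mulrA mulrDl mul1r [X in X + X]mulrC rCD rCM -norm_complexE.
  rewrite (le_trans (ler_normB _ _)) // lerD // (le_trans (cmul_norm _ _)) //.
    by rewrite ler_wpM2l.
  by rewrite mulrC ler_wpM2l.
- move=> b_sa; apply/eqP; rewrite -subr_eq0; apply/eqP.
  apply: (@norm_small_eq0 _ _ _ 2) => e e0.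
  have [N /(_ N (leqnn _)) yN] := yY _ e0.
  have Ys : star (Y N) = Y N.
    elim: (N) => [|n IHn]; first by rewrite Y0 star0.
    by rewrite YS !star_lin b_sa IHn geC0_conj.
  have -> : star y - y = star (y - Y N) - (y - Y N).
    rewrite starD starN Ys; by modring.
  rewrite mulrDl mul1r rCD (le_trans (ler_normB _ _)) // norm_star.
  by rewrite lerD.
Qed.
End CStarTheory.

(** * Square roots in C*-algebras *)

Section CStarSquareRoots.
Variables (R : realType) (A : cstarAlgType R).
Implicit Types x y z b h : A.

(** [half_sqrt] is applied to [b], and again to the resulting [y], whose norm is also at most 1. The
    second root [r] stands in for positivity of [s]: it exhibits [s] as the square of a self-adjoint
    element. *)
Lemma sqrt_1B b : `|b| <= 1 -> star b = b ->
  exists s r, [/\ s ** s = cone - b, r ** r = s, star s = s, star r = r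
    & forall x, x ** b = b ** x -> x ** s = s ** x /\ x ** r = r ** x].
Proof.
have sq c y : y = 2^-1 *: (c + y ** y) -> (cone - y) ** (cone - y) = cone - c.
  move=> yE; have y2 : y ** y = 2 *: y - c.
    by rewrite {3}yE scalerA mulfV ?pnatr_eq0 // scale1r addrAC subrr add0r.
  by rewrite !cmul_lin y2; modring.
move=> b1 b_sa; have [y [yE y1 yC ysa]] := half_sqrt b1.
have [z [zE _ zC zsa]] := half_sqrt y1.
exists (cone - y), (cone - z); split; first exact: sq.
- exact: sq.
- by rewrite !star_lin ysa.
- by rewrite !star_lin zsa // ysa.
- move=> x xb; rewrite !cmul_lin.
  by rewrite (yC _ xb) (zC x (yC _ xb)).
Qed.

(** Here [s] is the square root of [1 - h ^ 2]. Its norm is bounded because it is the imaginary part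
    of [u = h + i s], and [star u ** u = cone] makes the norm of [u] at most 1. *)
Lemma unitary_completion h : `|h| <= 1 -> star h = h ->
  exists s, [/\ h ** h + s ** s = cone, star s = s, `|s| <= 1
    & forall x, x ** h = h ** x -> x ** s = s ** x].
Proof.
move=> h1 h_sa.
have [||s [r [ss _ s_sa _ sC]]] := @sqrt_1B (h ** h).
- by rewrite (le_trans (cmul_norm _ _)) // -[leRHS]mulr1 ler_pM.
- by rewrite starM h_sa.
have {}sC x : x ** h = h ** x -> x ** s = s ** x.
  by move=> xh; apply: (sC _ _).1; rewrite cmulA xh -cmulA xh cmulA.
exists s; split => //; first by rewrite ss addrC subrK.
pose u := h + 'i *: s.
have us : star u = h - 'i *: s by rewrite !star_lin h_sa s_sa conjCi scaleNr.
have u1 : `|u| <= 1.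
  rewrite -(@ler_pXn2r _ 2) ?nnegrE // -cstar_identity us expr1n.
  rewrite (_ : _ ** _ = cone) ?norm_cone_le1 //.
  rewrite /u !cmul_lin ss (sC h) // -[RHS](subrK (h ** h)).
  rewrite scalerA -expr2 sqrCi; by modring.
have -> : s = (2 * 'i)^-1 *: (u - star u).
  rewrite us (_ : u - _ = (2 * 'i) *: s); last by rewrite /u; modring.
  by rewrite scalerA mulVf ?scale1r // mulf_neq0 ?pnatr_eq0 ?neq0Ci.
rewrite normrZ normfV normrM normCi mulr1 ger0_norm ?ler0n //.
rewrite ler_pdivrMl ?ltr0n // (le_trans (ler_normB _ _)) // norm_star.
by rewrite mulr_natl lerD.
Qed.

(** The element equals [s ** s] for the completion [s] of [h]. *)
Lemma norm_1Bsqr h : `|h| <= 1 -> star h = h -> `|cone - h ** h| <= 1.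
Proof.
move=> h1 h_sa; have [s [hs _ s1 _]] := unitary_completion h1 h_sa.
rewrite -hs addrAC subrr add0r (le_trans (cmul_norm _ _)) //.
by rewrite -[leRHS]mulr1 ler_pM.
Qed.

(** After scaling [h] to [g] of norm at most 1, [sqrt_1B] is applied to [b = 1 - g ^ 2], which
    [norm_1Bsqr] permits; then [1 - b = g ^ 2]. The scaling constant is the norm plus 1 so as to be
    positive for [h = 0] as well. *)
Lemma absolute_value h : star h = h ->
  exists p r, [/\ p ** p = h ** h, r ** r = p, star p = p, star r = r
    & forall x, x ** h = h ** x -> x ** p = p ** x].
Proof.
move=> h_sa; pose k : R := complex.Re `|h| + 1.
have hE := norm_complexE h.
have k0 : 0 < k by rewrite ltr_wpDl // Re_norm_ge0.
have ksqr : (Num.sqrt k)%:C%C * (Num.sqrt k)%:C%C = k%:C%C :> R[i].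
  by rewrite -rCM -expr2 sqr_sqrtr // ltW.
have kC0 : k%:C%C != 0 :> R[i] by rewrite gt_eqF // ltcR.
have kiC : (k^-1)%:C%C * k%:C%C = 1 :> R[i] by rewrite rCV mulVf.
have conjr (c : R) : (c%:C%C)^* = c%:C%C :> R[i] by exact: conjc_real.
pose g := (k^-1)%:C%C *: h.
have g_sa : star g = g by rewrite starZ h_sa conjr.
have g1 : `|g| <= 1.
  rewrite normrZ hE normc_def /= expr0n addr0 sqrtr_sqr -rCM lecR.
  rewrite gtr0_norm ?invr_gt0 // mulrC ler_pdivrMr // mul1r.
  by rewrite lerDl ler01.
have gh : h = k%:C%C *: g by rewrite scalerA mulrC kiC scale1r.
have gC x : x ** h = h ** x -> x ** g = g ** x by rewrite !cmul_lin => ->.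
clearbody g.
have b_sa : star (cone - g ** g) = cone - g ** g by rewrite starD starN starM star1 g_sa.
have [p [r [pp rr p_sa r_sa pC]]] := sqrt_1B (norm_1Bsqr g1 g_sa) b_sa.
have {}pp : p ** p = g ** g by rewrite pp opprB addrC subrK.
exists (k%:C%C *: p), ((Num.sqrt k)%:C%C *: r); split.
- by rewrite gh !cmul_lin pp.
- by rewrite !cmul_lin scalerA ksqr rr.
- by rewrite starZ p_sa conjr.
- by rewrite starZ r_sa conjr.
- move=> x xh; rewrite !cmul_lin (pC x _).1 //.
  have xg := gC _ xh.
  by rewrite !cmul_lin xg -cmulA xg cmulA.
Qed.
End CStarSquareRoots.

(** * Consequences of universality and of the defining relations *)

Section Relations.
Variables (R : realType) (y : R[i]).

Lemma star_hom_relations (A B : cstarAlgType R) (f : A -> B) a1 a2 :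
  star_hom f -> E_relations y a1 a2 -> E_relations y (f a1) (f a2).
Proof.
move=> [flin f1 fM fS] [r1 r2 r3 r4].
have fD x z : f (x + z) = f x + f z by rewrite -[x]scale1r flin !scale1r.
have fZ k x : f (k *: x) = k *: f x.
  by rewrite -[k *: x]addr0 flin (addIr (f x) (_ : f 0 + _ = 0 + _)) ?addr0 // -fD !add0r.
split; rewrite -?fS -!fM -?fD.
- by rewrite r1.
- by rewrite r2.
- by rewrite r3 -scaleN1r fZ scaleN1r.
- by rewrite r4 fZ f1.
Qed.

(* The unitary [t + i s] conjugates [f] to a homomorphism that agrees with [f]
   on the generators, hence everywhere. *)
Lemma commutant_generators (E B : cstarAlgType R) (a1 a2 : E) (f : E -> B)
    (t : B) : universal_E y a1 a2 -> star_hom f -> star t = t ->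
  t ** f a1 = f a1 ** t -> t ** f a2 = f a2 ** t ->
  forall x, t ** f x = f x ** t.
Proof.
move=> [hE univ] fH.
wlog t1 : t / `|t| <= 1 => [wlog1|].
  move=> t_sa ta1 ta2 x; pose k : R := complex.Re `|t| + 1.
  have tE := norm_complexE t.
  have k0 : 0 < k by rewrite ltr_wpDl // Re_norm_ge0.
  pose c : R[i] := (k^-1)%:C%C.
  have c0 : c != 0 by rewrite gt_eqF // ltcR invr_gt0.
  have := wlog1 (c *: t); rewrite starZ t_sa [c^*]conjc_real.
  rewrite !(cmulZl, cmulZr) ta1 ta2 => /(_ _ erefl erefl erefl x).
  rewrite !(cmulZl, cmulZr) => wc; apply: (scalerI c0); apply: wc.
  rewrite normrZ tE normc_def /= expr0n addr0 sqrtr_sqr -rCM lecR.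
  rewrite gtr0_norm ?invr_gt0 // mulrC ler_pdivrMr // mul1r.
  by rewrite lerDl ler01.
move=> t_sa ta1 ta2.
have [s [ts s_sa _ sC]] := unitary_completion t1 t_sa.
pose u := t + 'i *: s.
have us : star u = t - 'i *: s by rewrite !star_lin t_sa s_sa conjCi scaleNr.
have st := sC t erefl.
have uu : u ** star u = cone.
  by rewrite us /u !cmul_lin -ts st scalerA -expr2 sqrCi; modring.
have u'u : star u ** u = cone.
  by rewrite us /u !cmul_lin -ts st scalerA -expr2 sqrCi; modring.
have ua z : t ** z = z ** t -> u ** z = z ** u.
  by move=> tz; rewrite /u !cmul_lin tz (sC z).
(* [t] is the real part of [u], so commuting with [u] and [star u] suffices. *)
have tE : t = 2^-1 *: (u + star u).
  rewrite us (_ : u + _ = 2 *: t); last by rewrite /u; modring.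
  by rewrite scalerA mulVf ?scale1r ?pnatr_eq0.
clearbody u.
have [flin f1 fM fS] := fH.
pose g x := u ** f x ** star u.
have gH : star_hom g.
  split.
  - by move=> k x z; rewrite /g flin !cmul_lin.
  - by rewrite /g f1 cmulr1 uu.
  - move=> x z; rewrite /g fM -!cmulA; congr (_ ** (_ ** _)).
    by rewrite [star u ** (u ** _)]cmulA u'u cmul1.
  - by move=> x; rewrite /g fS !starM starK cmulA.
have [h [_ h_uniq]] := univ _ _ _ (star_hom_relations fH hE).
have fg : f = g.
  rewrite -(h_uniq f) //; apply: h_uniq; split => //.
  - by rewrite /g ua // -cmulA uu cmulr1.
  - by rewrite /g ua // -cmulA uu cmulr1.
move=> x; have uf : u ** f x = f x ** u.
  by rewrite [in RHS]fg /g -!cmulA u'u cmulr1.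
have u'f : star u ** f x = f x ** star u.
  by rewrite [in LHS]fg /g !cmulA u'u cmul1.
by rewrite tE !cmul_lin uf u'f.
Qed.

Section NormalOrder.
Variables (A : cstarAlgType R) (a b : A).
Hypothesis rel : E_relations y a b.

Lemma star_mulE1 : star a ** a = cone - a ** star a.
Proof. by case: rel => <- _ _ _; rewrite addrK. Qed.
Lemma star_mulE2 : star b ** b = cone - b ** star b.
Proof. by case: rel => _ <- _ _; rewrite addrK. Qed.
Lemma star_mulE12 : star a ** b = - (b ** star a).
Proof. by case: rel. Qed.
Lemma star_mulE21 : star b ** a = - (a ** star b).
Proof.
case: rel => _ _ r3 _; have := congr1 star r3.
by rewrite !star_lin => ->.
Qed.
Lemma mulE21 : b ** a = y *: cone - a ** b.
Proof. by case: rel => _ _ _ <-; rewrite addrC addKr. Qed.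
Lemma star_star_mulE21 : star b ** star a = y^* *: cone - star a ** star b.
Proof.
case: rel => _ _ _ r4; have := congr1 star r4.
by rewrite !star_lin => <-; rewrite addrK.
Qed.
(** The normal order is [a], [b], [star a], [star b]: each rule exchanges two adjacent factors that
    stand in the wrong order, at the cost of a sign and a scalar. *)
Definition normal_orderE :=
  (star_mulE1, star_mulE2, star_mulE12, star_mulE21, mulE21, star_star_mulE21).

(** Two distinct elements among the generators and their adjoints always anticommute to a scalar, so
    only the pure squares survive besides a multiple of [cone]. *)
Lemma sqr_generator_sum (c c' d d' : R[i]) :
  let w := c *: a + c' *: star a + d *: b + d' *: star b in
  w ** w = (c * c' + d * d' + c * d * y + c' * d' * y^*) *: cone
    + (c ^+ 2 *: (a ** a) + c' ^+ 2 *: (star a ** star a)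
       + d ^+ 2 *: (b ** b) + d' ^+ 2 *: (star b ** star b)).
Proof. by rewrite /= !cmul_lin !normal_orderE; modring. Qed.

(* [w1 ^ 2 + w2 ^ 2 = 4 (1 - |y|)] with [w1], [w2] self-adjoint, and a sum of two
   squares is not a negative scalar. *)
Lemma norm_le1_of_relations : (exists x : A, x != 0) -> `|y| <= 1.
Proof.
case=> x0 /norm_cone c1; rewrite norm_complexE lecR leNgt; apply/negP => y1.
have yR := norm_complexE y.
have y0 : `|y| != 0 by rewrite gt_eqF // yR ltcR (lt_trans ltr01).
(* The phase that turns [y] into [-|y|]. *)
pose d := - y^* / `|y|.
have dy : d * y = - `|y|.
  by rewrite /d mulrAC mulNr -normCKC expr2 mulNr mulfK.
have dy' : d^* * y^* = - `|y|.
  by rewrite -rmorphM dy rmorphN /= geC0_conj.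
have dd : d * d^* = 1.
  rewrite -normCK /d normrM normrN normfV normr_id norm_conjC mulfV //.
  by rewrite expr1n.
clearbody d.
pose w1 := 1 *: a + 1 *: star a + d *: b + d^* *: star b.
(* The factors ['i] and [- 'i] negate the four pure squares of [w1 ** w1] and leave its scalar part
   unchanged, so the pure squares cancel in the sum. *)
pose w2 := 'i *: a + - 'i *: star a + (- 'i * d) *: b + ('i * d^*) *: star b.
have ww : w1 ** w1 + w2 ** w2 = (4 * (1 - `|y|)) *: cone.
  rewrite !sqr_generator_sum !exprMn !sqrrN !sqrCi !expr1n.
  have e1 : 1 * 1 + d * d^* + 1 * d * y + 1 * d^* * y^* = 2 - 2 * `|y|.
    by rewrite dd !mul1r dy dy'; ring.
  have e2 : 'i * - 'i + - 'i * d * ('i * d^*) + 'i * (- 'i * d) * y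
     + - 'i * ('i * d^*) * y^* = 2 - 2 * `|y|.
    have -> : 'i * - 'i + - 'i * d * ('i * d^*) + 'i * (- 'i * d) * y
     + - 'i * ('i * d^*) * y^* = - 'i ^+ 2 * (1 + d * d^* + d * y + d^* * y^*).
      by ring.
    by rewrite sqrCi dd dy dy'; ring.
  by rewrite e1 e2; modring.
have w1_sa : star w1 = w1 by rewrite /w1 !star_lin rmorph1 conjCK; modring.
have w2_sa : star w2 = w2.
  rewrite /w2 !star_lin !rmorphM !rmorphN /= conjCK conjCi opprK; modring.
pose k : R := complex.Re `|w1| + complex.Re `|w2| + 1.
have n1 := norm_complexE w1; have n2 := norm_complexE w2.
have n1_ge0 : 0 <= complex.Re `|w1| by exact: Re_norm_ge0.
have n2_ge0 : 0 <= complex.Re `|w2| by exact: Re_norm_ge0.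
have k0 : 0 < k by rewrite ltr_wpDl // addr_ge0.
pose c : R[i] := (k^-1)%:C%C.
have cc : c^* = c by exact: conjc_real.
have cn : `|c| = c by rewrite ger0_norm // lecR invr_ge0 ltW.
have cw1 : `|c *: w1| <= 1.
  rewrite normrZ cn n1 -rCM lecR mulrC ler_pdivrMr // mul1r /k.
  by rewrite -addrA lerDl addr_ge0.
have cw2 : `|c *: w2| <= 1.
  rewrite normrZ cn n2 -rCM lecR mulrC ler_pdivrMr // mul1r /k.
  by rewrite addrAC lerDr addr_ge0.
have b1 := norm_1Bsqr cw1 (_ : star (c *: w1) = c *: w1).
have b2 := norm_1Bsqr cw2 (_ : star (c *: w2) = c *: w2).
(* The scaling by [c] brings [w1] and [w2] into the unit ball, where [1 - w ^ 2] has norm at most 1.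
   The two such terms add up to a scalar that exceeds 2 if [|y| > 1]. *)
have : `|(2 + 4 * c ^+ 2 * (`|y| - 1)) *: (cone : A)| <= 2.
  have -> : (2 + 4 * c ^+ 2 * (`|y| - 1)) *: (cone : A)
     = (cone - (c *: w1) ** (c *: w1)) + (cone - (c *: w2) ** (c *: w2)).
    rewrite !(cmulZl, cmulZr) !scalerA -expr2 addrACA -opprD -scalerDr ww.
    by modring.
  rewrite (le_trans (ler_normD _ _)) // [leRHS](_ : 2 = 1 + 1) //.
  by rewrite lerD ?b1 ?b2 // starZ cc ?w1_sa ?w2_sa.
rewrite normrZ c1 mulr1 yR -(rCn R 2) -(rCn R 4) (_ : 1 = 1%:C%C) //.
rewrite -rCB -rCX -!rCM -rCD.
have pos : 0 < 4 * (k^-1) ^+ 2 * (complex.Re `|y| - 1).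
  by rewrite !mulr_gt0 ?exprn_gt0 ?invr_gt0 ?ltr0n // subr_gt0.
rewrite ger0_norm ?lecR; last by rewrite addr_ge0 // ltW.
by apply/negP; rewrite -ltNge ltrDl.
Qed.
End NormalOrder.
End Relations.

(** * Bounded operators on a Hilbert space *)

Section HilbertTheory.
Variables (R : realType) (H : hilbertType R).
Implicit Types u v w : H.

Lemma hdotDl u v w : hdot (u + v) w = hdot u w + hdot v w.
Proof. by rewrite linearDl. Qed.
Lemma hdotDr u v w : hdot u (v + w) = hdot u v + hdot u w.
Proof. by rewrite linearDr. Qed.
Lemma hdotNl u w : hdot (- u) w = - hdot u w.
Proof. by rewrite linearNl. Qed.
Lemma hdotNr u w : hdot u (- w) = - hdot u w.
Proof. by rewrite linearNr. Qed.
Lemma hdotZl k u w : hdot (k *: u) w = k * hdot u w.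
Proof. by rewrite linearZl_LR. Qed.
Lemma hdotZr k u w : hdot u (k *: w) = k^* * hdot u w.
Proof. by rewrite linearZr_LR. Qed.
Lemma hdot0l w : hdot (0 : H) w = 0.
Proof. by rewrite linear0l. Qed.
Lemma hdot0r w : hdot w (0 : H) = 0.
Proof. by rewrite linear0r. Qed.
Lemma hdotC u w : hdot u w = (hdot w u)^*.
Proof. by rewrite (hermC (hdot : {dot H for Num.conj})) expr0 mul1r. Qed.
Lemma hdot_suml I (r : seq I) (P : pred I) (F : I -> H) w :
  hdot (\sum_(i <- r | P i) F i) w = \sum_(i <- r | P i) hdot (F i) w.
Proof.
by elim/big_rec2: _ => [|i a b _ <-]; rewrite ?hdot0l ?hdotDl.
Qed.
Lemma hdot_sumr I (r : seq I) (P : pred I) (F : I -> H) w :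
  hdot w (\sum_(i <- r | P i) F i) = \sum_(i <- r | P i) hdot w (F i).
Proof.
by elim/big_rec2: _ => [|i a b _ <-]; rewrite ?hdot0r ?hdotDr.
Qed.

Definition hdot_lin := (hdotDl, hdotDr, hdotNl, hdotNr, hdotZl, hdotZr).

Lemma hdot_eq0 u : hdot u u = 0 -> u = 0.
Proof. by rewrite hdot_norm => /eqP; rewrite expf_eq0 /= normr_eq0 => /eqP. Qed.

Lemma hdot_inj u v : (forall w, hdot u w = hdot v w) -> u = v.
Proof.
move=> uv; apply/eqP; rewrite -subr_eq0; apply/eqP/hdot_eq0.
by rewrite hdotDl hdotNl uv subrr.
Qed.

Lemma norm_hdot u v : `|hdot u v| <= `|u| * `|v|.
Proof.
have [->|v0] := eqVneq v 0; first by rewrite hdot0r !normr0 mulr0.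
pose N := hdot v v; pose a := hdot u v; have vuE : hdot v u = a^* by exact: hdotC.
have N_gt0 : 0 < N by rewrite /N hdot_norm exprn_gt0 // normr_gt0.
have NC : N^* = N by rewrite geC0_conj // ltW.
have ww : hdot (N *: u - a *: v) (N *: u - a *: v)
    = N * (N * hdot u u - a * a^*).
  by rewrite !hdot_lin vuE -/N -/a NC; ring.
have : 0 <= N * (N * hdot u u - a * a^*) by rewrite -ww hdot_norm exprn_ge0.
rewrite pmulr_rge0 // subr_ge0 -normCK /N !hdot_norm mulrC -exprMn.
by rewrite ler_pXn2r // ?nnegrE // mulr_ge0.
Qed.
End HilbertTheory.

Section BoundedOperators.
Variables (R : realType) (H : hilbertType R).
Implicit Types v w : H.

(* A pair of mutually adjoint maps is automatically linear. *)
Record bop := Bop {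
  bop_fun :> H -> H;
  bop_adj : H -> H;
  bop_adjP : forall v w, hdot (bop_fun v) w = hdot v (bop_adj w);
  bop_bounded : exists M : R, forall v, `|bop_fun v| <= M%:C%C * `|v| }.
Implicit Types S T : bop.

(** A map determines its adjoint, and the remaining fields are propositions. *)
Lemma bop_ext S T : S =1 T -> S = T.
Proof.
case: S T => [f f' ff' fb] [g g' gg' gb] /= /funext fg.
rewrite -{}fg in gg' gb *.
have f'g' : f' = g'.
  apply/funext => w; apply: hdot_inj => v.
  by rewrite hdotC -ff' gg' -hdotC.
rewrite -{}f'g' in gg' *.
by rewrite (Prop_irrelevance ff' gg') (Prop_irrelevance fb gb).
Qed.

Lemma bopP T : linear T.
Proof.
by move=> k u v; apply: hdot_inj => w; rewrite !hdot_lin !bop_adjP !hdot_lin.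
Qed.
Lemma bopD T u v : T (u + v) = T u + T v.
Proof. by rewrite -[u]scale1r bopP !scale1r. Qed.
Lemma bop0 T : T 0 = 0.
Proof. by apply: (addIr (T 0)); rewrite -bopD !add0r. Qed.
Lemma bopZ T k u : T (k *: u) = k *: T u.
Proof. by rewrite -[k *: u]addr0 bopP bop0 addr0. Qed.
Lemma bopN T u : T (- u) = - T u.
Proof. by rewrite -scaleN1r bopZ scaleN1r. Qed.

Lemma bop_adjC T v w : hdot (bop_adj T v) w = hdot v (T w).
Proof. by rewrite hdotC -bop_adjP -hdotC. Qed.

(** The condition [0 <= M] matters when [H] is zero: every real number would be a bound there, and
    the infimum would be meaningless. *)
Let bounds T := [set M : R | 0 <= M /\ forall v, `|T v| <= M%:C%C * `|v|]%classic.
Let opnorm T : R := inf (bounds T).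

Let bounds_inf T : has_inf (bounds T).
Proof.
split; last by exists 0 => M [].
have [M TM] := bop_bounded T; exists `|M|; split => // v.
by rewrite (le_trans (TM v)) // ler_wpM2r // lecR ler_norm.
Qed.

Let opnorm_ge0 T : 0 <= opnorm T.
Proof. by apply: lb_le_inf; [case: (bounds_inf T)|move=> M []]. Qed.

Let opnorm_le T M : 0 <= M -> (forall v, `|T v| <= M%:C%C * `|v|) -> opnorm T <= M.
Proof. by move=> M0 TM; apply: ge_inf; [case: (bounds_inf T)|]. Qed.

Let opnormP T v : `|T v| <= (opnorm T)%:C%C * `|v|.
Proof.
have [->|v0] := eqVneq v 0; first by rewrite bop0 !normr0 mulr0.
have vR := norm_complexE v; have TvR := norm_complexE (T v).
have v0' : 0 < complex.Re `|v| by rewrite -ltcR -vR normr_gt0.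
rewrite vR TvR -rCM lecR -ler_pdivrMr //; apply: lb_le_inf.
  by case: (bounds_inf T).
by move=> M [M0 /(_ v)]; rewrite vR TvR -rCM lecR ler_pdivrMr.
Qed.

Let adj_bounded T v : `|bop_adj T v| <= (opnorm T)%:C%C * `|v|.
Proof.
have [->|v0] := eqVneq (bop_adj T v) 0.
  by rewrite normr0 mulr_ge0 // ler0c.
have n0 : 0 < `|bop_adj T v| by rewrite normr_gt0.
rewrite -(ler_pM2l n0) -expr2 -hdot_norm -[leLHS]ger0_norm ?hdot_norm ?exprn_ge0 //.
rewrite -hdot_norm bop_adjC (le_trans (norm_hdot _ _)) // mulrC mulrCA.
by rewrite [in leRHS]mulrA ler_wpM2r.
Qed.

Let add_adjP S T v w :
  hdot (S v + T v) w = hdot v (bop_adj S w + bop_adj T w).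
Proof. by rewrite !hdot_lin !bop_adjP. Qed.
Let add_bounded S T :
  exists M : R, forall v, `|S v + T v| <= M%:C%C * `|v|.
Proof.
exists (opnorm S + opnorm T) => v.
by rewrite (le_trans (ler_normD _ _)) // rCD mulrDl lerD.
Qed.
Definition bop_add S T : bop := Bop (add_adjP S T) (add_bounded S T).

Let scale_adjP k T v w : hdot (k *: T v) w = hdot v (k^* *: bop_adj T w).
Proof. by rewrite !hdot_lin conjCK bop_adjP. Qed.
Let scale_bounded k T : exists M : R, forall v, `|k *: T v| <= M%:C%C * `|v|.
Proof.
exists (complex.Re `|k| * opnorm T) => v.
by rewrite normrZ rCM -norm_complexE -mulrA ler_wpM2l.
Qed.
Definition bop_scale k T : bop := Bop (scale_adjP k T) (scale_bounded k T).

Let zero_adjP v w : hdot (0 : H) w = hdot v (0 : H).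
Proof. by rewrite hdot0l hdot0r. Qed.
Let zero_bounded : exists M : R, forall v, `|0 : H| <= M%:C%C * `|v|.
Proof. by exists 0 => v; rewrite normr0 mul0r. Qed.
Definition bop_zero : bop := Bop zero_adjP zero_bounded.

Let one_bounded : exists M : R, forall v, `|v| <= M%:C%C * `|v|.
Proof. by exists 1 => v; rewrite mul1r. Qed.
Definition bop_one : bop := Bop (fun v w => erefl (hdot v w)) one_bounded.

Let mul_adjP S T v w : hdot (S (T v)) w = hdot v (bop_adj T (bop_adj S w)).
Proof. by rewrite !bop_adjP. Qed.
Let mul_bounded S T : exists M : R, forall v, `|S (T v)| <= M%:C%C * `|v|.
Proof.
exists (opnorm S * opnorm T) => v; rewrite (le_trans (opnormP _ _)) //.
by rewrite rCM -mulrA ler_wpM2l // ler0c.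
Qed.
Definition bop_mul S T : bop := Bop (mul_adjP S T) (mul_bounded S T).

Definition bop_star T : bop :=
  Bop (bop_adjC T) (ex_intro (fun M : R => _) (opnorm T) (adj_bounded T)).

HB.instance Definition _ := gen_eqMixin bop.
HB.instance Definition _ := gen_choiceMixin bop.

Let addA : associative bop_add.
Proof. by move=> S T U; apply: bop_ext => v /=; rewrite addrA. Qed.
Let addC : commutative bop_add.
Proof. by move=> S T; apply: bop_ext => v /=; rewrite addrC. Qed.
Let add0 : left_id bop_zero bop_add.
Proof. by move=> S; apply: bop_ext => v /=; rewrite add0r. Qed.
Let addN : left_inverse bop_zero (bop_scale (-1)) bop_add.
Proof. by move=> S; apply: bop_ext => v /=; rewrite scaleN1r addNr. Qed.
HB.instance Definition _ := GRing.isZmodule.Build bop addA addC add0 addN.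

Let scaleA k l T : bop_scale k (bop_scale l T) = bop_scale (k * l) T.
Proof. by apply: bop_ext => v /=; rewrite scalerA. Qed.
Let scale1 : left_id 1 bop_scale.
Proof. by move=> T; apply: bop_ext => v /=; rewrite scale1r. Qed.
Let scaleDr : right_distributive bop_scale +%R.
Proof. by move=> k S T; apply: bop_ext => v /=; rewrite scalerDr. Qed.
Let scaleDl T : {morph bop_scale^~ T : k l / k + l}.
Proof. by move=> k l; apply: bop_ext => v /=; rewrite scalerDl. Qed.
HB.instance Definition _ :=
  GRing.Zmodule_isLmodule.Build R[i] bop scaleA scale1 scaleDr scaleDl.

Lemma bop_addE S T v : (S + T) v = S v + T v. Proof. by []. Qed.
Lemma bop_scaleE k T v : (k *: T) v = k *: T v. Proof. by []. Qed.
Lemma bop_oppE T v : (- T) v = - T v.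
Proof. by rewrite -scaleN1r bop_scaleE scaleN1r. Qed.
Lemma bop_zeroE v : (0 : bop) v = 0. Proof. by []. Qed.

Let norm T : R[i] := (opnorm T)%:C%C.

Let normD S T : norm (S + T) <= norm S + norm T.
Proof.
rewrite -rCD lecR opnorm_le ?addr_ge0 // => v.
by rewrite rCD mulrDl (le_trans (ler_normD _ _)) // lerD.
Qed.
Let normZ_le k T : norm (k *: T) <= `|k| * norm T.
Proof.
rewrite (norm_complexE k) -rCM lecR opnorm_le ?mulr_ge0 ?Re_norm_ge0 // => v.
by rewrite rCM -norm_complexE -mulrA bop_scaleE normrZ ler_wpM2l.
Qed.
Let norm0_eq0 T : norm T = 0 -> T = 0.
Proof.
move=> [T0]; apply: bop_ext => v; apply/eqP; rewrite -normr_le0.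
by rewrite (le_trans (opnormP _ _)) // T0 mul0r.
Qed.
Let normZ k T : norm (k *: T) = `|k| * norm T.
Proof.
apply/le_anti; rewrite normZ_le /=; have [->|k0] := eqVneq k 0.
  by rewrite normr0 mul0r ler0c.
rewrite -ler_pdivlMl ?normr_gt0 // -normfV.
by rewrite -{1}[T]scale1r -(mulVf k0) -scalerA normZ_le.
Qed.
HB.instance Definition _ :=
  Lmodule_isNormed.Build R[i] bop normD normZ norm0_eq0.

Lemma bop_norm T v : `|T v| <= `|T| * `|v|.
Proof. exact: opnormP. Qed.

Lemma bop_continuous T : continuous T.
Proof.
move=> v; apply/cvgrPdist_lt => /= e e0.
have c0 : 0 < `|T| + 1 by rewrite ltr_wpDl.
have := nbhsx_ballx v _ (divr_gt0 e0 c0).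
apply: filterS => w; rewrite -ball_normE /= => vw.
rewrite -bopN -bopD (le_lt_trans (bop_norm _ _)) //.
rewrite (@le_lt_trans _ _ ((`|T| + 1) * `|v - w|)) //.
  by rewrite ler_wpM2r // lerDl.
by rewrite mulrC -ltr_pdivlMr.
Qed.

Lemma bop_norm_le T (M : R) :
  0 <= M -> (forall v, `|T v| <= M%:C%C * `|v|) -> `|T| <= M%:C%C.
Proof. by move=> M0 TM; rewrite lecR; apply: opnorm_le. Qed.

Let norm_adj T v : `|bop_adj T v| <= `|T| * `|v|.
Proof. exact: adj_bounded. Qed.

Let adjB S T v : bop_adj (S - T) v = bop_adj S v - bop_adj T v.
Proof.
apply: hdot_inj => w; rewrite !hdot_lin !bop_adjC.
by rewrite rmorphN1 mulN1r.
Qed.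

(** Meant for [e] evaluating either the operator or its adjoint at a fixed vector of norm [c]. *)
Let eval_cvg (F : set_system bop) (e : bop -> H) (c : R[i]) :
  ProperFilter F -> cauchy F -> 0 <= c ->
  (forall S T, `|e S - e T| <= `|S - T| * c) ->
  exists l, forall d : R, 0 < d -> \forall T \near F, `|l - e T| <= d%:C%C.
Proof.
move=> FF Fc c0 ec.
have e_cvg : cvg (e @ F)%classic.
  apply: cauchy_cvg; apply/cauchyP => d d0.
  have c1 : 0 < c + 1 by rewrite ltr_wpDl.
  have [T0 FT0] := (cauchyP F).1 Fc _ (divr_gt0 d0 c1).
  exists (e T0); suff: F (e @^-1` ball (e T0) d)%classic by [].
  apply: filterS FT0 => T; rewrite -!ball_normE /= => T0T.
  rewrite (le_lt_trans (ec _ _)) // (@le_lt_trans _ _ (`|T0 - T| * (c + 1))) //.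
    by rewrite ler_wpM2l // lerDl.
  by rewrite -ltr_pdivlMr.
exists (lim (e @ F)%classic) => d d0.
by have /cvgrPdist_le := e_cvg; apply; rewrite ltcR.
Qed.

(** Operators and adjoints converge pointwise, and the adjoint relation passes to the two limits;
    linearity of the limit then comes with it. *)
Let bop_complete (F : set_system bop) : ProperFilter F -> cauchy F -> cvg F.
Proof.
move=> FF Fc.
have evalP v := eval_cvg (e := fun T => T v) FF Fc (normr_ge0 v).
have adjP v := eval_cvg (e := fun T => bop_adj T v) FF Fc (normr_ge0 v).
have /choice[L LF] : forall v, exists l, forall d : R, 0 < d ->
    \forall T \near F, `|l - bop_fun T v| <= d%:C%C.
  by move=> v; apply: evalP => S T; rewrite -bop_oppE -bop_addE opnormP.
have /choice[L' L'F] : forall v, exists l, forall d : R, 0 < d ->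
    \forall T \near F, `|l - bop_adj T v| <= d%:C%C.
  by move=> v; apply: adjP => S T; rewrite -adjB norm_adj.
have LL' v w : hdot (L v) w = hdot v (L' w).
  apply/eqP; rewrite -subr_eq0; apply/eqP.
  apply: (@norm_small_eq0 _ _ _ (complex.Re `|w| + complex.Re `|v|)) => e e0.
  have [T [Tv Tw]] := filter_ex (filterI (LF v e e0) (L'F w e e0)).
  have -> : hdot (L v) w - hdot v (L' w)
      = hdot (L v - T v) w - hdot v (L' w - bop_adj T w).
    by rewrite !hdot_lin bop_adjP; ring.
  rewrite (le_trans (ler_normB _ _)) // mulrDl rCD !rCM -!norm_complexE lerD //.
    by rewrite (le_trans (norm_hdot _ _)) // mulrC ler_wpM2l.
  by rewrite (le_trans (norm_hdot _ _)) // ler_wpM2l.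
(* A uniform bound survives the pointwise limit. With [e = 1] it shows that the limit is bounded,
   with small [e] that convergence is in norm. *)
have LB (T0 : bop) (e : R) : (\forall T \near F, `|T0 - (T : bop)| <= e%:C%C) ->
    forall v, `|L v - T0 v| <= e%:C%C * `|v|.
  move=> T0e v; rewrite norm_complexE (norm_complexE v) -rCM lecR.
  apply/ler_addgt0Pr => d d0.
  have [T [Tv Tw]] := filter_ex (filterI (LF v d d0) T0e).
  rewrite -lecR rCD rCM -!norm_complexE.
  rewrite -(subrK (T v) (L v)) -addrA addrC (le_trans (ler_normD _ _)) // lerD //.
  rewrite -bop_oppE -bop_addE (le_trans (bop_norm _ _)) //.
  by rewrite ler_wpM2r // distrC.
have near_center (e : R) : 0 < e -> exists T0, \forall T \near F, `|T0 - (T : bop)| <= e%:C%C.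
  move=> e0; have eC0 : 0 < e%:C%C :> R[i] by rewrite ltcR.
  have [T0 FT0] := (cauchyP F).1 Fc _ eC0; exists T0.
  by apply: filterS FT0 => T; rewrite -ball_normE /= => /ltW.
have L_bounded : exists M : R, forall v, `|L v| <= M%:C%C * `|v|.
  have [T0 T0e] := near_center _ ltr01.
  exists (1 + opnorm T0) => v; rewrite rCD mulrDl -[L v](subrK (T0 v)).
  by rewrite (le_trans (ler_normD _ _)) // lerD // LB.
apply/cvg_ex; exists (Bop LL' L_bounded); apply/cvgrPdist_le => /= e e0.
have eE : e = (complex.Re e)%:C%C.
  by case: e e0 => a b; rewrite ltcE /= => /andP[/eqP ->].
have r0 : 0 < complex.Re e by rewrite -ltcR -eE.
have [T0 T0e] := near_center _ (divr_gt0 r0 (ltr0Sn _ 1)).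
have := T0e; apply: filterS => T T0T.
have -> : Bop LL' L_bounded - T = (Bop LL' L_bounded - T0) + (T0 - T).
  by rewrite addrA subrK.
rewrite eE [complex.Re e]splitr rCD (le_trans (ler_normD _ _)) // lerD //.
apply: bop_norm_le; first by rewrite divr_ge0 // ltW.
by move=> v; rewrite bop_addE bop_oppE /=; apply: LB.
Qed.
HB.instance Definition _ := Uniform_isComplete.Build bop bop_complete.

Let starM S T : bop_star (bop_mul S T) = bop_mul (bop_star T) (bop_star S).
Proof. by apply: bop_ext. Qed.
Let mulDl : left_distributive bop_mul +%R.
Proof. by move=> S T U; apply: bop_ext. Qed.
Let mulDr : right_distributive bop_mul +%R.
Proof. by move=> S T U; apply: bop_ext => v /=; rewrite bopD. Qed.
Let mulZl k S T : bop_mul (k *: S) T = k *: bop_mul S T.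
Proof. exact: bop_ext. Qed.
Let mulZr k S T : bop_mul S (k *: T) = k *: bop_mul S T.
Proof. by apply: bop_ext => v /=; rewrite bopZ. Qed.
Let norm_mul S T : `|bop_mul S T| <= `|S| * `|T|.
Proof.
rewrite (norm_complexE S) (norm_complexE T) -rCM.
apply: bop_norm_le => [|v]; first by rewrite mulr_ge0 ?Re_norm_ge0.
rewrite rCM -!norm_complexE -mulrA; apply: le_trans (bop_norm S (T v)) _.
by rewrite ler_wpM2l // bop_norm.
Qed.
Let star_identity T : `|bop_mul (bop_star T) T| = `|T| ^+ 2.
Proof.
apply/le_anti/andP; split.
  rewrite (le_trans (norm_mul _ _)) // expr2 ler_wpM2r //.
  rewrite (norm_complexE T) bop_norm_le ?Re_norm_ge0 // => v.
  by rewrite -norm_complexE; apply: norm_adj.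
set N := complex.Re `|bop_mul (bop_star T) T|.
have N0 : 0 <= N by rewrite Re_norm_ge0.
have sN : 0 <= Num.sqrt N by rewrite sqrtr_ge0.
have TN : `|T| <= (Num.sqrt N)%:C%C.
  apply: bop_norm_le => // v.
  rewrite -(@ler_pXn2r _ 2) ?nnegrE ?mulr_ge0 ?ler0c // exprMn -rCX sqr_sqrtr //.
  rewrite -hdot_norm -[leLHS]ger0_norm; last by rewrite hdot_norm exprn_ge0.
  rewrite bop_adjP (le_trans (norm_hdot _ _)) // [`|v| ^+ 2]expr2 mulrA mulrC.
  by rewrite ler_wpM2r // -norm_complexE; apply: (bop_norm (bop_mul (bop_star T) T)).
rewrite (norm_complexE (bop_mul _ _)) -/N -(sqr_sqrtr N0) rCX.
by rewrite ler_pXn2r // nnegrE ?ler0c.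
Qed.
Let starD : {morph bop_star : S T / S + T}.
Proof.
by move=> S T; apply: bop_ext.
Qed.
Let starZ k T : bop_star (k *: T) = k^* *: bop_star T.
Proof. exact: bop_ext. Qed.
Let mulA : associative bop_mul.
Proof. by move=> S T U; apply: bop_ext. Qed.
Let mul1 : left_id bop_one bop_mul.
Proof. by move=> S; apply: bop_ext. Qed.
Let mulr1 : right_id bop_one bop_mul.
Proof. by move=> S; apply: bop_ext. Qed.
Let starK : involutive bop_star.
Proof. by move=> S; apply: bop_ext. Qed.
HB.instance Definition _ := NormedModule_isCStarAlgebra.Build R bop
  mulA mul1 mulr1 mulDl mulDr mulZl mulZr starD starZ starM starK
  norm_mul star_identity.

Lemma bop_mulE S T v : (S ** T) v = S (T v). Proof. by []. Qed.
Lemma bop_oneE v : (cone : bop) v = v. Proof. by []. Qed.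
Lemma bop_starP T v w : hdot (star T v) w = hdot v (T w).
Proof. exact: bop_adjC. Qed.
End BoundedOperators.

(** * Representations as homomorphisms into the bounded operators *)

Section RepresentationsAsHoms.
Variables (R : realType) (E : cstarAlgType R) (H : hilbertType R).

Lemma representation_of_hom (f : E -> bop H) :
  star_hom f -> representation (fun a v => f a v).
Proof.
case=> flin f1 fM fS; split.
- move=> a; split; first exact: bopP.
  exact: bop_continuous.
- by move=> k a b v; rewrite flin.
- by move=> v; rewrite f1.
- by move=> a b v; rewrite fM.
- by move=> a v w; rewrite fS bop_starP.
Qed.

Variable pi : E -> H -> H.
Hypothesis piP : representation pi.

Lemma rep_lin a k u v : pi a (k *: u + v) = k *: pi a u + pi a v.
Proof. by case: piP => /(_ a)[-> _] *. Qed.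
Lemma repD a u v : pi a (u + v) = pi a u + pi a v.
Proof. by rewrite -[u]scale1r rep_lin !scale1r. Qed.
Lemma rep0 a : pi a 0 = 0.
Proof. by apply: (addIr (pi a 0)); rewrite -repD !add0r. Qed.
Lemma repZ a k u : pi a (k *: u) = k *: pi a u.
Proof. by rewrite -[k *: u]addr0 rep_lin rep0 addr0. Qed.
Lemma repN a u : pi a (- u) = - pi a u.
Proof. by rewrite -scaleN1r repZ scaleN1r. Qed.
Lemma rep_addE a b v : pi (a + b) v = pi a v + pi b v.
Proof. by case: piP => _ h _ _ _; rewrite -[a]scale1r h !scale1r. Qed.
Lemma rep_zeroE v : pi 0 v = 0.
Proof. by apply: (addIr (pi 0 v)); rewrite -rep_addE !add0r. Qed.
Lemma rep_scaleE k a v : pi (k *: a) v = k *: pi a v.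
Proof. by case: piP => _ h _ _ _; rewrite -[k *: a]addr0 h rep_zeroE addr0. Qed.
Lemma rep_oppE a v : pi (- a) v = - pi a v.
Proof. by rewrite -scaleN1r rep_scaleE scaleN1r. Qed.
Lemma rep_oneE v : pi cone v = v.
Proof. by case: piP. Qed.
Lemma rep_mulE a b v : pi (a ** b) v = pi a (pi b v).
Proof. by case: piP. Qed.
Lemma rep_starP a v w : hdot (pi (star a) v) w = hdot v (pi a w).
Proof. by case: piP. Qed.
Lemma rep_starPr a v w : hdot (pi a v) w = hdot v (pi (star a) w).
Proof. by rewrite -[in LHS](starK a) rep_starP. Qed.
Lemma rep_continuous a : continuous (pi a).
Proof. by case: piP => /(_ a)[]. Qed.

Definition rep_linE := (repD, repN, repZ, rep0, rep_addE, rep_oppE, rep_scaleE,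
  rep_zeroE, rep_oneE, rep_mulE).

Let rep_adjP a v w : hdot (pi a v) w = hdot v (pi (star a) w).
Proof. exact: rep_starPr. Qed.
Let rep_bounded a : exists M : R, forall v, `|pi a v| <= M%:C%C * `|v|.
Proof.
have /cvgrPdist_lt/(_ 1 ltr01) := @rep_continuous a 0.
rewrite rep0 nearE => /nbhs_ballP[e /= e0 ae].
have eE : e = (complex.Re e)%:C%C.
  by case: e e0 {ae} => p q; rewrite ltcE /= => /andP[/eqP ->].
have r0 : 0 < complex.Re e by rewrite -ltcR -eE.
exists (2 / complex.Re e) => v; have [->|v0] := eqVneq v 0.
  by rewrite rep0 !normr0 mulr0.
have n0 : 0 < `|v| by rewrite normr_gt0.
(* [v] is rescaled to length [e / 2], inside the ball that continuity at 0 sends into the unit ball;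
   hence the bound [2 / e]. *)
pose k := e / (2 * `|v|).
have k0 : 0 < k by rewrite divr_gt0 // mulr_gt0 ?ltr0n.
have /ae : ball 0 e (k *: v).
  rewrite -ball_normE /= sub0r normrN normrZ gtr0_norm // /k invfM mulrA mulfVK ?gt_eqF //.
  by rewrite ltr_pdivrMr ?ltr0n // ltr_pMr // ltr1n.
rewrite /= sub0r normrN repZ normrZ gtr0_norm // mulrC -ltr_pdivlMr // => /ltW.
by rewrite /k div1r invf_div rCM rCV rCn -eE mulrAC.
Qed.

Definition rep_bop a : bop H := Bop (rep_adjP a) (rep_bounded a).

Lemma rep_bop_hom : star_hom rep_bop.
Proof.
split.
- by move=> k a b; apply: bop_ext => v; rewrite bop_addE bop_scaleE /= !rep_linE.
- by apply: bop_ext => v; rewrite bop_oneE /= rep_oneE.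
- by move=> a b; apply: bop_ext => v; rewrite bop_mulE /= rep_mulE.
- by move=> a; apply: bop_ext => v.
Qed.
End RepresentationsAsHoms.

(** * Schur's lemma and reduction to matrices *)

Section IrreducibleRepresentations.
Variables (R : realType) (E : cstarAlgType R) (H : hilbertType R).
Variable pi : E -> H -> H.
Hypotheses (piP : representation pi) (pi_irr : irreducible pi).

(** The kernel of an operator in the commutant is a closed invariant subspace. The absence of such
    subspaces is exploited only through this dichotomy. *)
Lemma irreducible_kernel (T : bop H) :
  (forall x, T ** rep_bop piP x = rep_bop piP x ** T) ->
  (forall v, T v = 0 -> v = 0) \/ (forall v, T v = 0).
Proof.
move=> TC; have [_ irr] := pi_irr.
have [|||| W0|WT] := irr [set v | T v = 0]%classic.
- apply: ((continuous_closedP T).1 (@bop_continuous _ _ T) [set 0]%classic).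
  exact/accessible_closed_set1/hausdorff_accessible/norm_hausdorff.
- exact: bop0.
- by move=> k v w /= Tv Tw; rewrite bopP Tv Tw scaler0 addr0.
- move=> a v /= Tv; rewrite -[pi a v]/(rep_bop piP a v) -bop_mulE TC bop_mulE Tv.
  by rewrite bop0.
- by left=> v Tv; have : [set v | T v = 0]%classic v by []; rewrite W0.
- by right=> v; have : [set v | T v = 0]%classic v by rewrite WT.
Qed.

(* For each real [m] one of [p -+ (h - m)], with [p = |h - m|], vanishes because
   their product does; hence [pi h >= m] or [pi h <= m]. *)
Lemma schur_selfadjoint (h : E) : star h = h ->
  (forall x, h ** x = x ** h) -> exists m : R, forall v, pi h v = m%:C%C *: v.
Proof.
move=> h_sa hC; have [[v0 v0N] _] := pi_irr.
have hdot_ge0 (v : H) : 0 <= hdot v v by rewrite hdot_norm exprn_ge0.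
have alt (m : R) : (forall v, 0 <= hdot (pi (h - m%:C%C *: cone) v) v) \/
    (forall v, hdot (pi (h - m%:C%C *: cone) v) v <= 0).
  set t := h - _.
  have t_sa : star t = t.
    by rewrite /t !star_lin h_sa (_ : m%:C%C^* = m%:C%C) //; exact: conjc_real.
  have tC x : x ** t = t ** x by rewrite /t !cmul_lin hC.
  have [p [r [pp rr p_sa r_sa pC]]] := absolute_value t_sa.
  have {}pC x : x ** p = p ** x by exact: pC.
  have p_ge0 v : 0 <= hdot (pi p v) v.
    by rewrite -rr (rep_mulE piP) -{1}r_sa (rep_starP piP).
  clearbody t.
  have [|ker0|ker1] := @irreducible_kernel (rep_bop piP (p - t)).
  - move=> x; have [_ _ repM _] := rep_bop_hom piP.
    by rewrite -!repM !cmul_lin pC tC.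
  - right=> v; have : pi (p + t) v = 0.
      apply: ker0; rewrite /= -(rep_mulE piP) !cmul_lin pp (tC p).
      rewrite (_ : _ + _ = 0) ?(rep_zeroE piP) //; modring.
    rewrite (rep_addE piP) => /eqP; rewrite addrC addr_eq0 => /eqP ->.
    by rewrite hdotNl oppr_le0.
  - left=> v; have := ker1 v; rewrite /= (rep_addE piP) (rep_oppE piP).
    by move=> /eqP; rewrite subr_eq0 => /eqP <-.
pose g v : R := complex.Re (hdot (pi h v) v); pose n (v : H) : R := complex.Re (hdot v v).
have gE v : hdot (pi h v) v = (g v)%:C%C.
  rewrite /g RRe_real // CrealE; apply/eqP.
  by rewrite -hdotC -{2}h_sa (rep_starP piP).
have nE (v : H) : hdot v v = (n v)%:C%C by rewrite /n RRe_real // ger0_real.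
have altR (m : R) : (forall v, m * n v <= g v) \/ (forall v, g v <= m * n v).
  have tE v : hdot (pi (h - m%:C%C *: cone) v) v = (g v - m * n v)%:C%C.
    by rewrite !(rep_linE piP) !hdot_lin gE nE rCB rCM.
  case: (alt m) => altm; [left|right] => v; have := altm v; rewrite tE.
    by rewrite ler0c subr_ge0.
  by rewrite [leRHS](_ : 0 = (0 : R)%:C%C) // lecR subr_le0.
have n_gt0 (v : H) : v != 0 -> 0 < n v.
  by move=> v_neq0; rewrite -ltcR -nE hdot_norm exprn_gt0 // normr_gt0.
pose M := g v0 / n v0.
have gM v : g v = M * n v.
  have [->|v_neq0] := eqVneq v 0.
    by rewrite /g /n (rep0 piP) hdot0l /= mulr0.
  have nv := n_gt0 _ v_neq0; have nv0 := n_gt0 _ v0N.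
  have gv : g v = (g v / n v) * n v by rewrite divfK // gt_eqF.
  have gv0 : g v0 = M * n v0 by rewrite divfK // gt_eqF.
  rewrite gv; congr (_ * _); set m' := g v / n v in gv *.
  (* If the quotients at [v] and [v0] differed, their midpoint would lie strictly between them, and
     each side of [altR] would fail at one of the two vectors. *)
  apply/eqP; rewrite eq_le; apply/andP; split; rewrite leNgt; apply/negP => ltm.
    have [/(_ v0)|/(_ v)] := altR ((m' + M) / 2); rewrite ?gv0 ?gv ler_pM2r //; lra.
  have [/(_ v)|/(_ v0)] := altR ((m' + M) / 2); rewrite ?gv0 ?gv ler_pM2r //; lra.
exists M => v; pose T u := pi (h - M%:C%C *: cone) u.
have TT u : hdot (T u) u = 0.
  by rewrite /T !(rep_linE piP) !hdot_lin gE nE gM rCM subrr.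
have TD u w : T (u + w) = T u + T w by rewrite /T (repD piP).
have T_sa u w : hdot (T u) w = hdot u (T w).
  rewrite /T -(rep_starP piP) !star_lin h_sa (_ : M%:C%C^* = M%:C%C) //; exact: conjc_real.
have : T v = 0.
  (* Polarization of the vanishing quadratic form at [v + T v]: since [T] is self-adjoint, both
     cross terms equal the squared norm of [T v]. *)
  apply: hdot_eq0; have := TT (v + T v); rewrite TD !hdotDl !hdotDr !TT.
  rewrite add0r addr0 (T_sa (T v)) => /eqP; rewrite -mulr2n mulrn_eq0 /=.
  by move=> /eqP.
by rewrite /T !(rep_linE piP) => /eqP; rewrite subr_eq0 => /eqP.
Qed.

Lemma schur_normal (z : E) : (forall x, z ** x = x ** z) ->
  (forall x, star z ** x = x ** star z) ->
  exists k : R[i], forall v, pi z v = k *: v.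
Proof.
move=> zC z'C.
have [||m1 hm1] := @schur_selfadjoint (z + star z).
- by rewrite !star_lin addrC.
- by move=> x; rewrite !cmul_lin zC z'C.
have [||m2 hm2] := @schur_selfadjoint ('i *: (star z - z)).
- by rewrite !star_lin conjCi; modring.
- by move=> x; rewrite !cmul_lin zC z'C.
exists (2^-1 * (m1%:C%C + 'i * m2%:C%C)) => v.
rewrite -scalerA scalerDl -scalerA -hm1 -hm2 -!(rep_scaleE piP) -(rep_addE piP).
rewrite -(rep_scaleE piP); congr (pi _ v).
rewrite scalerA -expr2 sqrCi (_ : _ + _ = 2 *: z); last by modring.
by rewrite scalerA mulVf ?scale1r ?pnatr_eq0.
Qed.

Variables (y : R[i]) (a1 a2 : E).
Hypothesis hE : universal_E y a1 a2.

(* [V c = \sum_k c_k w_k] is an isometry; its range projection commutes with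
   the generators, hence with [pi], so it is the identity. *)
Lemma equivalent_to_matrices n (w : 'I_n -> H) (M1 M2 : 'M[R[i]]_n) :
  (0 < n)%N -> (forall i j, hdot (w i) (w j) = (i == j)%:R) ->
  (forall j, pi a1 (w j) = \sum_k M1 k j *: w k) ->
  (forall j, pi (star a1) (w j) = \sum_k (M1 j k)^* *: w k) ->
  (forall j, pi a2 (w j) = \sum_k M2 k j *: w k) ->
  (forall j, pi (star a2) (w j) = \sum_k (M2 j k)^* *: w k) ->
  exists rho, given_by_matrices a1 a2 M1 M2 rho /\ unitarily_equivalent pi rho.
Proof.
move=> n0 wON w1 w1' w2 w2'.
pose V (c : Cn R n) : H := \sum_k c k 0 *: w k.
pose V' (u : H) : Cn R n := \col_k hdot u (w k).
have Vlin k (c d : Cn R n) : V (k *: c + d) = k *: V c + V d.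
  rewrite /V scaler_sumr -big_split; apply: eq_bigr => i _ /=.
  by rewrite !mxE scalerDl scalerA.
have V'lin k u v : V' (k *: u + v) = k *: V' u + V' v.
  by apply/matrixP => i j; rewrite !mxE !hdot_lin.
have VV' c u : hdot (V c) u = hdot c (V' u).
  rewrite [RHS]/(Cn_dot _ _) /V hdot_suml; apply: eq_bigr => k _.
  by rewrite mxE hdotZl -hdotC.
have V'V c : V' (V c) = c.
  apply/matrixP => k j; rewrite mxE ord1 /V hdot_suml (bigD1 k) //= hdotZl wON.
  rewrite eqxx mulr1 big1 ?addr0 // => i ik.
  by rewrite hdotZl wON (negPf ik) mulr0.
have PE u : V (V' u) = \sum_k hdot u (w k) *: w k.
  by apply: eq_bigr => k _; rewrite mxE.
have P_adj u v : hdot (V (V' u)) v = hdot u (V (V' v)).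
  by rewrite VV' hdotC -VV' -hdotC.
have P_bounded : exists M : R, forall u, `|V (V' u)| <= M%:C%C * `|u|.
  exists (\sum_k complex.Re `|w k| * complex.Re `|w k|) => u.
  rewrite PE (le_trans (ler_norm_sum _ _ _)) // rC_sum mulr_suml ler_sum // => k _.
  rewrite normrZ rCM -norm_complexE mulrAC ler_wpM2r //.
  by rewrite mulrC norm_hdot.
pose P : bop H := Bop P_adj P_bounded.
have P_sa : star P = P by apply: bop_ext.
(* Commutation with the projection needs the span to be stable under the generator and under its
   adjoint, which is why both actions are assumed. *)
have P_gen (a : E) (M : 'M[R[i]]_n) : (forall j, pi a (w j) = \sum_k M k j *: w k) ->
    (forall j, pi (star a) (w j) = \sum_k (M j k)^* *: w k) ->
    P ** rep_bop piP a = rep_bop piP a ** P.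
  move=> wM wM'; apply: bop_ext => u; rewrite !bop_mulE /= !PE.
  rewrite (_ : pi a (\sum_j hdot u (w j) *: w j) =
    \sum_j \sum_k (hdot u (w j) * M k j) *: w k); last first.
    rewrite (big_morph (pi a) (repD piP a) (rep0 piP a)).
    apply: eq_bigr => j _; rewrite (repZ piP) wM scaler_sumr.
    by apply: eq_bigr => k _; rewrite scalerA.
  rewrite exchange_big; apply: eq_bigr => k _ /=.
  rewrite (rep_starPr piP) wM' hdot_sumr scaler_suml; apply: eq_bigr => j _.
  by rewrite hdotZr conjCK mulrC.
have P_comm x : P ** rep_bop piP x = rep_bop piP x ** P.
  apply: (commutant_generators hE (rep_bop_hom piP) P_sa); exact: P_gen.
have P1 u : V (V' u) = u.
  have [|ker0|ker1] := @irreducible_kernel (P - cone).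
  - by move=> x; rewrite !cmul_lin P_comm.
  (* If [P - 1] were injective, [P V = V] would give [V = 0], but [V] is injective and [0 < n]. *)
  - pose c : Cn R n := const_mx 1.
    have Vc0 : V c = 0.
      by apply: ker0; rewrite bop_addE bop_oppE bop_oneE /= V'V subrr.
    have := V'V c; rewrite Vc0 => /matrixP/(_ (Ordinal n0) 0).
    by rewrite !mxE hdot0l => /eqP; rewrite eq_sym oner_eq0.
  - by have /eqP := ker1 u; rewrite bop_addE bop_oppE bop_oneE subr_eq0 => /eqP.
have normV c : `|V c| = `|c|.
  by apply/eqP; rewrite -(@eqrXn2 _ 2) // -!hdot_norm VV' V'V.
have normV' u : `|V' u| = `|u|.
  by apply/eqP; rewrite -(@eqrXn2 _ 2) // -!hdot_norm -VV' P1.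
pose g x c := V' (pi x (V c)).
have g_adj x c d : hdot (g x c) d = hdot c (g (star x) d).
  by rewrite /g hdotC -VV' -hdotC (rep_starPr piP) VV'.
have g_bounded x : exists M : R, forall c, `|g x c| <= M%:C%C * `|c|.
  exists (complex.Re `|rep_bop piP x|) => c.
  by rewrite /g normV' -(normV c) -norm_complexE (bop_norm (rep_bop piP x)).
pose G x : bop (Cn R n) := Bop (g_adj x) (g_bounded x).
have V'D u v : V' (u + v) = V' u + V' v by rewrite -[u]scale1r V'lin !scale1r.
have V'Z k u : V' (k *: u) = k *: V' u.
  by apply/matrixP => i j; rewrite !mxE hdotZl.
have G_hom : star_hom G.
  split.
  - move=> k x z; apply: bop_ext => c; rewrite bop_addE bop_scaleE /= /g.
    by rewrite !(rep_linE piP) V'lin.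
  - by apply: bop_ext => c; rewrite bop_oneE /= /g (rep_oneE piP) V'V.
  - by move=> x z; apply: bop_ext => c; rewrite bop_mulE /= /g (rep_mulE piP) P1.
  - by move=> x; apply: bop_ext.
have gM a (M : 'M[R[i]]_n) : (forall j, pi a (w j) = \sum_k M k j *: w k) ->
    forall c, g a c = M *m c.
  move=> wM c; rewrite /g -[RHS]V'V; congr V'.
  rewrite [in LHS]/V (big_morph (pi a) (repD piP a) (rep0 piP a)) /V.
  rewrite (eq_bigr (fun j => \sum_k (M k j * c j 0) *: w k)) => [|j _]; last first.
    rewrite (repZ piP) wM scaler_sumr; apply: eq_bigr => k _.
    by rewrite scalerA mulrC.
  rewrite exchange_big; apply: eq_bigr => k _ /=.
  by rewrite mxE scaler_suml.
exists (fun x c => G x c); split.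
  by split; [exact: representation_of_hom | exact: gM | exact: gM].
exists V'; split.
- by move=> k u v; apply: V'lin.
- by exists V.
- by move=> u v; rewrite -VV' P1.
- by move=> a v; rewrite /= /g P1.
Qed.
End IrreducibleRepresentations.

(** * Anticommutation relations *)

Section SingleGenerator.
Variables (R : realType) (B : cstarAlgType R) (t : B) (tau : R[i]).
Hypotheses (rel : star t ** t + t ** star t = cone) (sq : t ** t = tau *: cone).

(** Products are kept associated to the left, so a rule for [p ** q] needs this second form to apply
    behind a prefix. *)
Lemma mulE_ctx (p q r : B) : p ** q = r -> forall x, x ** p ** q = x ** r.
Proof. by move=> <- x; rewrite cmulA. Qed.

Lemma star_sqE : star t ** star t = tau^* *: cone.
Proof. by have := congr1 star sq; rewrite !star_lin. Qed.

Let relE : star t ** t = cone - t ** star t.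
Proof. by rewrite -rel addrK. Qed.
Let norm1E := (relE, mulE_ctx relE, sq, mulE_ctx sq, star_sqE, mulE_ctx star_sqE).

(** In the two-dimensional block this is [(1 - 2 x)] times diag(1, -1), with [x] the weight of the
    block. *)
Definition sgn_op : B := star t ** t - t ** star t.

Lemma sgn_op_sa : star sgn_op = sgn_op.
Proof. by rewrite /sgn_op !star_lin. Qed.
Lemma sgn_op_sqr : sgn_op ** sgn_op = (1 - 4 * (tau * tau^*)) *: cone.
Proof. by rewrite /sgn_op !relE !cmul_lin !(norm1E, cmul_lin); modring. Qed.
Lemma sgn_op_anti : t ** sgn_op = - (sgn_op ** t).
Proof. by rewrite /sgn_op !relE !cmul_lin !(norm1E, cmul_lin); modring. Qed.
Lemma sgn_op_anti_star : star t ** sgn_op = - (sgn_op ** star t).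
Proof.
have := congr1 star sgn_op_anti; rewrite starN !starM sgn_op_sa => ->.
by rewrite opprK.
Qed.
(** Each term of [sgn_op] has two factors that anticommute with [x], and the two signs cancel. *)
Lemma sgn_op_comm x : t ** x = - (x ** t) -> star t ** x = - (x ** star t) ->
  sgn_op ** x = x ** sgn_op.
Proof.
move=> tx t'x; rewrite /sgn_op !cmul_lin -[_ ** t ** x]cmulA tx.
rewrite -[_ ** star t ** x]cmulA t'x !cmulNr !cmulA tx t'x.
by rewrite !cmulNl !opprK.
Qed.
End SingleGenerator.

Section TwoGenerators.
Variables (R : realType) (B : cstarAlgType R) (a b : B) (y k alpha beta : R[i]).
Hypotheses (rel : E_relations y a b) (asq : a ** a = alpha *: cone)
  (bsq : b ** b = beta *: cone) (yk : y = k * (1 - 4 * (alpha * alpha^*))).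

Let normE := (star_mulE1 rel, star_mulE2 rel, star_mulE12 rel, star_mulE21 rel,
  mulE21 rel, star_star_mulE21 rel, asq, bsq, star_sqE asq, star_sqE bsq).
Let y'k : y^* = k^* * (1 - 4 * (alpha * alpha^*)).
Proof.
by rewrite yk rmorphM rmorphB rmorph1 !rmorphM /= conjCK conjC_nat; ring.
Qed.

(* The component of [b] orthogonal to [a] and [star a] for the anticommutator. *)
Definition ortho_part : B := b - k *: (star a - (2 * alpha^*) *: a).

Lemma ortho_part_star :
  star ortho_part = star b - k^* *: (a - (2 * alpha) *: star a).
Proof. by rewrite /ortho_part !star_lin rmorphM /= conjCK conjC_nat. Qed.

(** The subtracted vector [star a - 2 conj(alpha) a] has anticommutator [1 - 4 |alpha|^2] with [a]
    and 0 with [star a]; the factor [k] matches these values to [y] and 0, those of [b]. *)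
Lemma ortho_part_anti1 : a ** ortho_part = - (ortho_part ** a).
Proof.
by rewrite /ortho_part !cmul_lin !normE ?cmul_lin yk; modring.
Qed.
Lemma ortho_part_anti2 : star a ** ortho_part = - (ortho_part ** star a).
Proof.
by rewrite /ortho_part !cmul_lin !normE ?cmul_lin; modring.
Qed.
Lemma ortho_part_sqr : ortho_part ** ortho_part =
  (beta + k ^+ 2 * (1 - 4 * (alpha * alpha^*)) * alpha^*) *: cone.
Proof.
by rewrite /ortho_part !cmul_lin !normE ?cmul_lin yk; modring.
Qed.
Lemma ortho_part_rel :
  star ortho_part ** ortho_part + ortho_part ** star ortho_part =
  (1 - k * k^* * (1 - 4 * (alpha * alpha^*))) *: cone.
Proof.
by rewrite ortho_part_star /ortho_part !cmul_lin !normE ?cmul_lin y'k yk; modring.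
Qed.
End TwoGenerators.

Section DegenerateAnticommutator.
Variables (R : realType) (B : cstarAlgType R) (a b : B) (y alpha : R[i]).
Hypotheses (rel : E_relations y a b) (asq : a ** a = alpha *: cone).
Let normE := (star_mulE1 rel, star_mulE12 rel, star_mulE21 rel,
  mulE21 rel, star_star_mulE21 rel, asq, star_sqE asq).

(** This and [degenerate_anti] exclude [4 |alpha|^2 = 1] for nonzero [y]: then [D] vanishes,
    although the anticommutator of [b] with [star D] is [y]. *)
Lemma degenerate_rel (D := star a - (2 * alpha^*) *: a) :
  star D ** D + D ** star D = (1 - 4 * (alpha * alpha^*)) *: cone.
Proof.
have -> : star D = a - (2 * alpha) *: star a.
  by rewrite /D !star_lin rmorphM /= conjCK conjC_nat.
by rewrite /D !cmul_lin !normE ?cmul_lin; modring.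
Qed.
Lemma degenerate_anti (D := star a - (2 * alpha^*) *: a) :
  b ** star D + star D ** b = y *: cone.
Proof.
have -> : star D = a - (2 * alpha) *: star a.
  by rewrite /D !star_lin rmorphM /= conjCK conjC_nat.
by rewrite !cmul_lin !normE; modring.
Qed.
End DegenerateAnticommutator.

Section OperatorsAnticommutator.
Variables (R : realType) (H : hilbertType R).
Implicit Types (S T : bop H) (v : H).

Lemma bop_relE T (l : R[i]) v : star T ** T + T ** star T = l *: cone ->
  l * hdot v v = hdot (T v) (T v) + hdot (star T v) (star T v).
Proof.
move=> rel; have := congr1 (fun S : bop H => hdot (S v) v) rel.
rewrite bop_scaleE bop_oneE bop_addE !bop_mulE hdotDl bop_starP hdotZl => <-.
by congr (_ + _); apply: bop_adjP.
Qed.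

Lemma bop_rel_ge0 T (l : R[i]) v : v != 0 ->
  star T ** T + T ** star T = l *: cone -> 0 <= l.
Proof.
move=> v0 /(bop_relE v) lE.
have vv : 0 < hdot v v by rewrite hdot_norm exprn_gt0 // normr_gt0.
rewrite -(pmulr_lge0 _ vv) lE !hdot_norm addr_ge0 // exprn_ge0 //.
Qed.

Lemma bop_rel_eq0 T : star T ** T + T ** star T = 0 -> T = 0.
Proof.
move=> rel; apply: bop_ext => v; apply: hdot_eq0.
have := @bop_relE T 0 v; rewrite scale0r => /(_ rel)/esym/eqP.
rewrite mul0r !hdot_norm paddr_eq0 ?exprn_ge0 // => /andP[/eqP + _].
by rewrite -hdot_norm.
Qed.

(** The scalar is the square of the self-adjoint operator [sgn_op T]. *)
Lemma sgn_op_ge0 T tau v : v != 0 -> star T ** T + T ** star T = cone ->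
  T ** T = tau *: cone -> 0 <= 1 - 4 * (tau * tau^*).
Proof.
move=> v0 rel sq.
have vv : 0 < hdot v v by rewrite hdot_norm exprn_gt0 // normr_gt0.
rewrite -(pmulr_lge0 _ vv) -hdotZl -[X in hdot X](bop_scaleE _ cone) -(sgn_op_sqr rel sq).
by rewrite bop_mulE -{1}(sgn_op_sa T) bop_starP hdot_norm exprn_ge0.
Qed.

(** As [K ^ 2 = d ^ 2], the vector [K e0 + d e0] works unless it is 0. In that case [e0] has
    eigenvalue [- d], and [T] or [star T] flips the sign; they cannot both kill [e0]. The new vector
    is obtained from [e0] by [T] and [star T] alone, so eigenvalues of operators commuting with both
    persist; this yields joint eigenvectors later. *)
Lemma sgn_op_eigenvector T tau (d : R[i]) (e0 : H) :
  star T ** T + T ** star T = cone -> T ** T = tau *: cone ->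
  1 - 4 * (tau * tau^*) = d ^+ 2 -> e0 != 0 ->
  exists e, [/\ e != 0, sgn_op T e = d *: e
    & forall (P : bop H) p, P ** T = T ** P -> P ** star T = star T ** P ->
        P e0 = p *: e0 -> P e = p *: e].
Proof.
move=> rel sq dE e0_neq0; set K := sgn_op T.
have KK v : K (K v) = d ^+ 2 *: v by rewrite -bop_mulE (sgn_op_sqr rel sq) bop_scaleE dE.
have KT v : K (T v) = - T (K v).
  by rewrite -!bop_mulE (sgn_op_anti rel sq) bop_oppE opprK.
have KT' v : K (star T v) = - star T (K v).
  by rewrite -!bop_mulE (sgn_op_anti_star rel sq) bop_oppE opprK.
have [Ke0|Ke0] := eqVneq (K e0 + d *: e0) 0; last first.
  exists (K e0 + d *: e0); split => //.
    by rewrite bopD bopZ KK; modring.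
  move=> P p PT PT' Pe.
  have PK : P ** K = K ** P.
    rewrite /K /sgn_op !cmul_lin PT PT' -[in LHS]cmulA PT -[in LHS]cmulA PT'.
    by rewrite !cmulA.
  by rewrite bopD bopZ -bop_mulE PK bop_mulE Pe bopZ; modring.
have {}Ke0 : K e0 = - (d *: e0) by apply/eqP; rewrite -addr_eq0 Ke0.
have [Te0|Te0] := eqVneq (T e0) 0; last first.
  exists (T e0); split => //; first by rewrite KT Ke0 bopN bopZ opprK.
  by move=> P p PT _ Pe; rewrite -bop_mulE PT bop_mulE Pe bopZ.
exists (star T e0); split.
- apply: contraNneq e0_neq0 => T'e0; rewrite -[e0](bop_oneE) -rel bop_addE.
  by rewrite !bop_mulE Te0 T'e0 !bop0 addr0.
- by rewrite KT' Ke0 bopN bopZ opprK.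
- by move=> P p _ PT' Pe; rewrite -bop_mulE PT' bop_mulE Pe bopZ.
Qed.

Lemma sgn_op_block T tau (rho sigma w : R[i]) (e : H) :
  star T ** T + T ** star T = cone -> T ** T = tau *: cone ->
  sgn_op T e = (sigma ^+ 2 - rho ^+ 2) *: e -> rho ^+ 2 + sigma ^+ 2 = 1 ->
  tau = w * rho * sigma -> w * w^* = 1 -> rho^* = rho -> sigma^* = sigma ->
  sigma != 0 ->
  let f := sigma^-1 *: T e in
  [/\ T e = sigma *: f, T f = (w * rho) *: e, star T e = (w^* * rho) *: f,
      star T f = sigma *: e & hdot f f = hdot e e].
Proof.
move=> rel sq eK rs tauE ww rhoC sigmaC s0 f.
(* Twice [star T ** T] is the sum of the identity and [sgn_op T]. *)
have T'T : star T (T e) = sigma ^+ 2 *: e.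
  have e1 : star T (T e) + T (star T e) = e.
    by rewrite -!bop_mulE -bop_addE rel.
  have e2 : star T (T e) - T (star T e) = (sigma ^+ 2 - rho ^+ 2) *: e.
    by rewrite -eK /sgn_op bop_addE bop_oppE !bop_mulE.
  have two0 : 2 != 0 :> R[i] by rewrite pnatr_eq0.
  apply: (scalerI two0).
  have -> : 2 *: star T (T e) = (star T (T e) + T (star T e))
      + (star T (T e) - T (star T e)) by modring.
  by rewrite e1 e2 -[X in X + _]scale1r -{1}rs; modring.
have Te : T e = sigma *: f by rewrite scalerA mulfV // scale1r.
have T'f : star T f = sigma *: e.
  by rewrite bopZ T'T scalerA expr2 mulKf.
have T'e : star T e = (w^* * rho) *: f.
  have s20 : sigma ^+ 2 != 0 by rewrite expf_neq0.
  (* [star T] is applied to [star T (T e) = sigma ^ 2 e], and its square is the scalar conj(tau). *)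
  apply: (scalerI s20); rewrite -bopZ -T'T -bop_mulE (star_sqE sq).
  rewrite bop_scaleE bop_oneE Te tauE !rmorphM /= rhoC sigmaC; modring.
split=> //.
- rewrite bopZ -bop_mulE sq bop_scaleE bop_oneE scalerA tauE mulrC mulfK //.
- have sVC : (sigma^-1)^* = sigma^-1 by rewrite fmorphV /= sigmaC.
  by rewrite hdotZr hdotZl -bop_starP T'T hdotZl sVC expr2 -!mulrA !mulKf.
Qed.
End OperatorsAnticommutator.

(** * Phases and weights of complex scalars *)

Section PolarForm.
Variable R : realType.

Lemma csqrtC (x : R) : (csqrt x)^* = csqrt x.
Proof. exact: conjc_real. Qed.
Lemma csqrt_sqr (x : R) : 0 <= x -> csqrt x ^+ 2 = x%:C%C.
Proof. by move=> x0; rewrite -rCX sqr_sqrtr. Qed.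
Lemma csqrt_eq0 (x : R) : 0 <= x -> (csqrt x == 0) = (x == 0).
Proof. by move=> x0; rewrite (inj_eq (@complexI R) _ 0) sqrtr_eq0 eq_le x0 andbT. Qed.

Lemma cis_surj (w : R[i]) : `|w| = 1 ->
  exists2 phi, 0 <= phi < 2 * trigo.pi & w = cis phi.
Proof.
case: w => a b w1.
have ab : a ^+ 2 + b ^+ 2 = 1.
  move: w1; rewrite normc_def /= => -[s1].
  by rewrite -[LHS]sqr_sqrtr ?s1 ?expr1n // addr_ge0 // sqr_ge0.
have a1 : -1 <= a <= 1.
  rewrite -ler_norml -(@ler_pXn2r _ 2) ?nnegrE // expr1n.
  by rewrite real_normK ?num_real // -ab lerDl sqr_ge0.
have b2 : Num.sqrt (1 - a ^+ 2) = `|b|.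
  by rewrite -ab addrAC subrr add0r sqrtr_sqr.
have pi0 := pi_gt0 R.
have acos0 := acos_ge0 a1; have acosp := acos_lepi a1.
case: (lerP 0 b) => b0.
  exists (acos a); first by rewrite acos0 /=; lra.
  by rewrite /cis acosK // sin_acos // b2 ger0_norm.
exists (2 * trigo.pi - acos a).
  have acos_neq0 : acos a != 0.
    apply: contraTneq b0 => acosa0; rewrite -leNgt.
    have := acosK a1; rewrite acosa0 cos0 => a1'.
    have : b ^+ 2 = 0 by rewrite -a1' expr1n in ab; lra.
    by move/eqP; rewrite expf_eq0 /= => /eqP ->.
  have : 0 < acos a by rewrite lt_neqAle eq_sym acos_neq0.
  by lra.
rewrite /cis mulr_natl cosB sinB cos2pi sin2pi mul1r mul0r addr0 acosK // sin_acos // b2.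
by rewrite mul0r mul1r sub0r ltr0_norm // opprK.
Qed.

(** [x] is the smaller root of [x (1 - x) = |tau|^2] and [w] is the phase of [tau], taken to be 1
    when [tau] vanishes. *)
Lemma weight_param (tau : R[i]) : 0 <= 1 - 4 * (tau * tau^*) ->
  exists x w, [/\ 0 <= x <= 1 / 2, `|w| = 1, tau = w * csqrt x * csqrt (1 - x)
    & 1 - 4 * (tau * tau^*) = (1 - 2 * x)%:C%C ^+ 2].
Proof.
rewrite -normCK; set r := complex.Re `|tau|.
have r0 : 0 <= r by exact: Re_norm_ge0.
have rE : `|tau| = r%:C%C by exact: norm_complexE.
have lE : 1 - 4 * `|tau| ^+ 2 = (1 - 4 * r ^+ 2)%:C%C.
  by rewrite rE rCB rCM rCX rCn.
rewrite lE ler0c => l0.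
pose d := Num.sqrt (1 - 4 * r ^+ 2); pose x := (1 - d) / 2.
have dd : d ^+ 2 = 1 - 4 * r ^+ 2 by rewrite sqr_sqrtr.
have d0 : 0 <= d by rewrite sqrtr_ge0.
have d1 : d <= 1 by nra.
have x0 : 0 <= x by rewrite /x; lra.
have x1 : x <= 1 / 2 by rewrite /x; lra.
have xr : csqrt x * csqrt (1 - x) = r%:C%C.
  rewrite -rCM -sqrtrM // (_ : x * (1 - x) = r ^+ 2) ?sqrtr_sqr ?ger0_norm //.
  by rewrite /x; nra.
have [t0|t0] := eqVneq tau 0.
  exists x, 1; split; rewrite ?x0 ?x1 ?normr1 //.
    by rewrite mul1r xr -rE t0 normr0.
  by rewrite -rCX; congr (_%:C%C); rewrite /x -dd; field.
exists x, (tau / `|tau|); split; rewrite ?x0 ?x1 //.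
- by rewrite normrM normfV normr_id mulfV // normr_eq0.
- by rewrite -mulrA xr -rE divfK // normr_eq0.
- by rewrite -rCX; congr (_%:C%C); rewrite /x -dd; field.
Qed.
End PolarForm.

(** * Matrix models *)

Section MatrixOperators.
Variables (R : realType) (n : nat).
Implicit Types M N : 'M[R[i]]_n.

Definition dagmx M : 'M[R[i]]_n := (map_mx Num.conj M)^T.

Lemma dagmxE M i j : dagmx M i j = (M j i)^*.
Proof. by rewrite !mxE. Qed.
Lemma dagmxK M : dagmx (dagmx M) = M.
Proof. by apply/matrixP => i j; rewrite !mxE conjCK. Qed.
Lemma dagmxD M N : dagmx (M + N) = dagmx M + dagmx N.
Proof. by apply/matrixP => i j; rewrite !mxE rmorphD. Qed.
Lemma dagmxZ k M : dagmx (k *: M) = k^* *: dagmx M.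
Proof. by apply/matrixP => i j; rewrite !mxE rmorphM. Qed.

Lemma mxop_adjP M (c d : Cn R n) :
  hdot (M *m c : Cn R n) d = hdot c (dagmx M *m d : Cn R n).
Proof.
rewrite -[LHS]/(Cn_dot _ _) -[RHS]/(Cn_dot _ _) /Cn_dot.
under eq_bigr => i _ do rewrite mxE mulr_suml.
rewrite exchange_big; apply: eq_bigr => j _ /=.
rewrite mxE rmorph_sum mulr_sumr; apply: eq_bigr => i _ /=.
by rewrite !mxE rmorphM /= conjCK mulrCA mulrA.
Qed.

Lemma mxop_bounded M : exists K : R, forall c : Cn R n,
  `|M *m c : Cn R n| <= K%:C%C * `|c|.
Proof.
pose e j : Cn R n := delta_mx j 0.
exists (\sum_j complex.Re `|e j| * complex.Re `|col j M : Cn R n|) => c.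
have -> : M *m c = \sum_j c j 0 *: (col j M : Cn R n).
  apply/matrixP => i k; rewrite ord1 mxE summxE; apply: eq_bigr => j _.
  by rewrite !mxE mulrC.
rewrite (le_trans (ler_norm_sum _ _ _)) // rC_sum mulr_suml ler_sum // => j _.
rewrite normrZ rCM -!norm_complexE mulrAC ler_wpM2r // mulrC.
suff -> : c j 0 = hdot c (e j) by exact: norm_hdot.
rewrite -[RHS]/(Cn_dot _ _) /Cn_dot (bigD1 j) //= mxE !eqxx rmorph1 mulr1.
rewrite big1 ?addr0 // => i ij; rewrite mxE (negPf ij) /= rmorph0 mulr0 //.
Qed.

Definition mxop M : bop (Cn R n) := Bop (mxop_adjP M) (mxop_bounded M).

Variables (y : R[i]) (E : cstarAlgType R) (a1 a2 : E).
Hypothesis hE : universal_E y a1 a2.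

(** The matrices are a pair satisfying the relations in the C*-algebra [bop (Cn R n)], to which
    universality applies. *)
Lemma given_by_matrices_exists M1 M2 :
  dagmx M1 *m M1 + M1 *m dagmx M1 = 1%:M ->
  dagmx M2 *m M2 + M2 *m dagmx M2 = 1%:M ->
  dagmx M1 *m M2 = - (M2 *m dagmx M1) ->
  M1 *m M2 + M2 *m M1 = y%:M ->
  exists rho, given_by_matrices a1 a2 M1 M2 rho.
Proof.
move=> r1 r2 r3 r4; have [_ univ] := hE.
have mxop_rel : E_relations y (mxop M1) (mxop M2).
  split; apply: bop_ext => c.
  - by rewrite bop_addE !bop_mulE /= !mulmxA -mulmxDl r1 mul1mx.
  - by rewrite bop_addE !bop_mulE /= !mulmxA -mulmxDl r2 mul1mx.
  - by rewrite bop_oppE !bop_mulE /= !mulmxA r3 mulNmx.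
  - by rewrite bop_addE bop_scaleE !bop_mulE /= !mulmxA -mulmxDl r4 mul_scalar_mx.
have [f [[fH f1 f2] _]] := univ _ _ _ mxop_rel.
exists (fun a c => f a c); split; first exact: representation_of_hom.
- by move=> v; rewrite f1.
- by move=> v; rewrite f2.
Qed.
End MatrixOperators.

Section TwoByTwo.
Variable R : realType.
Implicit Types a b c d k : R[i].

Lemma matrix2P (M N : 'M[R[i]]_2) :
  M 0 0 = N 0 0 -> M 0 1 = N 0 1 -> M 1 0 = N 1 0 -> M 1 1 = N 1 1 -> M = N.
Proof.
move=> h00 h01 h10 h11; apply/matrixP => i j.
have ord2 (l : 'I_2) : l = 0 \/ l = 1.
  by case: l => -[|[|//]] ?; [left|right]; apply/val_inj.
by case: (ord2 i) => ->; case: (ord2 j) => ->.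
Qed.

Lemma mx2_mul a b c d a' b' c' d' : mx2 a b c d *m mx2 a' b' c' d' =
  mx2 (a * a' + b * c') (a * b' + b * d') (c * a' + d * c') (c * b' + d * d').
Proof. by apply: matrix2P; rewrite !mxE !big_ord_recl big_ord0 !mxE /= addr0. Qed.
Lemma mx2_add a b c d a' b' c' d' :
  mx2 a b c d + mx2 a' b' c' d' = mx2 (a + a') (b + b') (c + c') (d + d').
Proof. by apply: matrix2P; rewrite !mxE. Qed.
Lemma mx2_opp a b c d : - mx2 a b c d = mx2 (- a) (- b) (- c) (- d).
Proof. by apply: matrix2P; rewrite !mxE. Qed.
Lemma mx2_scale k a b c d : k *: mx2 a b c d = mx2 (k * a) (k * b) (k * c) (k * d).
Proof. by apply: matrix2P; rewrite !mxE. Qed.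
Lemma mx2_scalar k : k%:M = mx2 k 0 0 k.
Proof. by apply: matrix2P; rewrite !mxE ?mulr1n ?mulr0n. Qed.
Lemma mx2_dag a b c d : dagmx (mx2 a b c d) = mx2 a^* c^* b^* d^*.
Proof. by apply: matrix2P; rewrite !mxE. Qed.
Lemma mx2_eq a b c d a' b' c' d' : a = a' -> b = b' -> c = c' -> d = d' ->
  mx2 a b c d = mx2 a' b' c' d'.
Proof. by move=> -> -> -> ->. Qed.

Definition mx2E := (mx2_dag, mx2_mul, mx2_scale, mx2_opp, mx2_add, mx2_scalar).
End TwoByTwo.

Section Tensor.
Variables (R : realType) (m n : nat).
Implicit Types (A : 'M[R[i]]_m) (B : 'M[R[i]]_n).

Lemma tensmxDl A A' B : (A + A') *t B = A *t B + A' *t B.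
Proof. by apply/matrixP => i j; rewrite !mxE mulrDl. Qed.
Lemma tensmxDr A B B' : A *t (B + B') = A *t B + A *t B'.
Proof. by apply/matrixP => i j; rewrite !mxE mulrDr. Qed.
Lemma tensmxNl A B : (- A) *t B = - (A *t B).
Proof. by apply/matrixP => i j; rewrite !mxE mulNr. Qed.
Lemma tensmxZl k A B : (k *: A) *t B = k *: (A *t B).
Proof. by apply/matrixP => i j; rewrite !mxE mulrA. Qed.
Lemma tensmxZr k A B : A *t (k *: B) = k *: (A *t B).
Proof. by apply/matrixP => i j; rewrite !mxE mulrCA. Qed.
Lemma tensmx11 : (1%:M : 'M[R[i]]_m) *t (1%:M : 'M[R[i]]_n) = 1%:M.
Proof.
apply/matrixP => i j; case: (mxtens_indexP i) => i1 i2; case: (mxtens_indexP j) => j1 j2.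
rewrite tensmxE !mxE (can_eq (@mxtens_indexK _ _)) xpair_eqE.
by case: (i1 == j1); case: (i2 == j2); rewrite ?mulr0 ?mul0r ?mulr1.
Qed.
Lemma dagmx_tens A B : dagmx (A *t B) = dagmx A *t dagmx B.
Proof. by apply/matrixP => i j; rewrite !mxE rmorphM. Qed.
Lemma dagmx1 : dagmx (1%:M : 'M[R[i]]_n) = 1%:M.
Proof. by apply/matrixP => i j; rewrite !mxE rmorph_nat eq_sym. Qed.
End Tensor.

Section Bilinear.
Variables (R : realType) (n : nat).
Implicit Types (X Y : 'M[R[i]]_n) (k u : R[i]).

Lemma mul_lin_comb X Y X' Y' k u k' u' :
  (k *: X + u *: Y) *m (k' *: X' + u' *: Y') =
  (k * k') *: (X *m X') + (k * u') *: (X *m Y') + (u * k') *: (Y *m X')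
  + (u * u') *: (Y *m Y').
Proof. by rewrite mulmxDl !mulmxDr -!scalemxAl -!scalemxAr; modring. Qed.

Lemma anticommutator_lin_comb X Y X' Y' k u k' u' :
  (k *: X + u *: Y) *m (k' *: X' + u' *: Y')
  + (k' *: X' + u' *: Y') *m (k *: X + u *: Y) =
  (k * k') *: (X *m X' + X' *m X) + (k * u') *: (X *m Y' + Y' *m X)
  + (u * k') *: (Y *m X' + X' *m Y) + (u * u') *: (Y *m Y' + Y' *m Y).
Proof. by rewrite !mul_lin_comb; modring. Qed.
End Bilinear.

Section ModelRelations.
Variables (R : realType) (y : R[i]) (E : cstarAlgType R) (a1 a2 : E).
Hypothesis hE : universal_E y a1 a2.
Variables (rho sigma w u : R[i]).
Hypotheses (rhoC : rho^* = rho) (sigmaC : sigma^* = sigma) (ww : w * w^* = 1)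
  (rs : rho ^+ 2 + sigma ^+ 2 = 1) (yu : y = u * (sigma ^+ 2 - rho ^+ 2)).

(** One family for all two-dimensional models: [s = 0] gives (a) and (b1), and [s] proportional to
    [w2] gives (b2.2). *)
Lemma two_dim_exists s : 2 * (s * s^*) + u * u^* = 1 ->
  exists r, given_by_matrices a1 a2 (mx2 0 (w * rho) sigma 0)
    (mx2 s (u * sigma) (- (u * w^* * rho)) (- s)) r.
Proof.
move=> su.
have rs' : rho ^+ 2 = 1 - sigma ^+ 2 by apply/eqP; rewrite eq_sym subr_eq rs.
have su' : u * u^* = 1 - 2 * (s * s^*) by apply/eqP; rewrite eq_sym subr_eq addrC su.
apply: (given_by_matrices_exists hE).
- rewrite !mx2E !rmorphM /= rmorph0 rhoC sigmaC.
  by apply: mx2_eq; ring: ww rs'.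
- rewrite !mx2E !rmorphN !rmorphM /= conjCK rhoC sigmaC.
  by apply: mx2_eq; ring: ww rs' su'.
- rewrite !mx2E !rmorphM /= rmorph0 rhoC sigmaC.
  by apply: mx2_eq; ring: ww rs'.
- by rewrite !mx2E yu; apply: mx2_eq; ring: ww rs'.
Qed.

(** Everything reduces to 2x2 identities. [S] anticommutes with [N], [P] and their adjoints, so the
    summand built on [S] has no cross terms with the other one, and the relation for [a2] becomes
    [kap ^ 2 + |u|^2 = 1]. *)
Lemma four_dim_exists (kap w' rho' sigma' : R[i]) : kap^* = kap ->
  kap ^+ 2 + u * u^* = 1 -> w' * w'^* = 1 -> rho'^* = rho' -> sigma'^* = sigma' ->
  rho' ^+ 2 + sigma' ^+ 2 = 1 ->
  exists r, given_by_matrices a1 a2 (mx2 0 (w * rho) sigma 0 *t 1%:M)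
    (kap *: (mx2 1 0 0 (-1) *t mx2 0 (w' * rho') sigma' 0)
     + u *: (mx2 0 sigma (- (w^* * rho)) 0 *t (1%:M : 'M[R[i]]_2))) r.
Proof.
move=> kapC ku ww' rhoC' sigmaC' rs'.
have rsE : rho ^+ 2 = 1 - sigma ^+ 2.
  by apply/eqP; rewrite eq_sym subr_eq rs.
have rsE' : rho' ^+ 2 = 1 - sigma' ^+ 2.
  by apply/eqP; rewrite eq_sym subr_eq rs'.
set N := mx2 0 (w * rho) sigma 0; set P := mx2 0 sigma _ 0.
set W := mx2 0 (w' * rho') sigma' 0; set S := mx2 1 0 0 (-1).
have SS : S *m S = 1%:M by rewrite !mx2E; apply: mx2_eq; ring.
have S' : dagmx S = S.
  by rewrite !mx2E rmorphN1 rmorph1 rmorph0.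
have NN : dagmx N *m N = 1%:M - N *m dagmx N.
  by rewrite !mx2E !rmorphM /= rmorph0 rhoC sigmaC; apply: mx2_eq; ring: ww rsE.
have PP : dagmx P *m P = 1%:M - P *m dagmx P.
  rewrite !mx2E !rmorphN !rmorphM /= conjCK rmorph0 rhoC sigmaC.
  by apply: mx2_eq; ring: ww rsE.
have WW : dagmx W *m W = 1%:M - W *m dagmx W.
  by rewrite !mx2E !rmorphM /= rmorph0 rhoC' sigmaC'; apply: mx2_eq; ring: ww' rsE'.
have NP : dagmx N *m P = - (P *m dagmx N).
  rewrite !mx2E !rmorphM /= rmorph0 rhoC sigmaC.
  by apply: mx2_eq; ring: ww rsE.
have PN : P *m N = (sigma ^+ 2 - rho ^+ 2)%:M - N *m P.
  by rewrite !mx2E; apply: mx2_eq; ring: ww.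
have NS : dagmx N *m S = - (S *m dagmx N).
  by rewrite !mx2E; apply: mx2_eq; rewrite ?rmorph0; ring.
have SN : S *m N = - (N *m S) by rewrite !mx2E; apply: mx2_eq; ring.
have PS : P *m S = - (S *m P) by rewrite !mx2E; apply: mx2_eq; ring.
have P'S : dagmx P *m S = - (S *m dagmx P).
  by rewrite !mx2E; apply: mx2_eq; rewrite ?rmorph0; ring.
clearbody N P W S.
have dag2 : dagmx (kap *: (S *t W) + u *: (P *t (1%:M : 'M[R[i]]_2)))
    = kap *: (S *t dagmx W) + u^* *: (dagmx P *t 1%:M).
  by rewrite dagmxD !dagmxZ !dagmx_tens dagmx1 kapC S'.
have dag1 : dagmx (N *t (1%:M : 'M[R[i]]_2)) = dagmx N *t 1%:M.
  by rewrite dagmx_tens dagmx1.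
apply: (given_by_matrices_exists hE).
- by rewrite dag1 !tensmx_mul !mulmx1 NN tensmxDl tensmxNl subrK tensmx11.
- rewrite dag2 anticommutator_lin_comb !tensmx_mul !mulmx1 !mul1mx.
  rewrite SS WW PP PS P'S -tensmxDr -!tensmxDl !subrK !tensmx11 !addNr !subrr.
  by rewrite !tens0mx !scaler0 !addr0 -scalerDl -expr2 [u^* * u]mulrC ku scale1r.
- rewrite dag1 mulmxDl mulmxDr -!scalemxAl -!scalemxAr !tensmx_mul !mulmx1 !mul1mx.
  by rewrite NS NP !tensmxNl; modring.
- rewrite mulmxDl mulmxDr -!scalemxAl -!scalemxAr !tensmx_mul !mulmx1 !mul1mx.
  rewrite SN PN !tensmxNl !tensmxDl !tensmxNl yu.
  rewrite -[(sigma ^+ 2 - rho ^+ 2)%:M]scalemx1 tensmxZl tensmx11 -[RHS]scalemx1.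
  by modring.
Qed.
End ModelRelations.

(** * Existence of the models and nontriviality of the algebra *)

Section ModelExistence.
Variables (R : realType) (y : R[i]).

Lemma cmodE : `|y| = (cmod y)%:C%C. Proof. exact: norm_complexE. Qed.
Lemma cmod_ge0 : 0 <= cmod y. Proof. exact: Re_norm_ge0. Qed.

(** The hypothesis means [|y| < 1 - 2 x1], so the radicand is nonnegative. The value is the scalar
    [C^* C + C C^*] of the reduced part, and [b_coef] is its normalisation. *)
Lemma b_coef_sqr (x1 : R) : 0 <= x1 < (1 - cmod y) / 2 ->
  b_coef y x1 ^+ 2 = 1 - y / (1 - 2 * x1)%:C%C * (y / (1 - 2 * x1)%:C%C)^*.
Proof.
move=> /andP[x0 x1lt]; have y0 := cmod_ge0.
have d0 : 0 < 1 - 2 * x1 by lra.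
have le1 : cmod y ^+ 2 / (1 - 2 * x1) ^+ 2 <= 1.
  by rewrite ler_pdivrMr ?exprn_gt0 // mul1r ler_pXn2r ?nnegrE //; lra.
have nd : `|(1 - 2 * x1)%:C%C| = (1 - 2 * x1)%:C%C :> R[i].
  by rewrite ger0_norm // ler0c ltW.
rewrite csqrt_sqr ?subr_ge0 // -normCK normrM normfV nd cmodE.
by rewrite rCB rCM rCV !rCX exprMn exprVn.
Qed.

Lemma b_coef_gt0 (x1 : R) : 0 <= x1 < (1 - cmod y) / 2 -> b_coef y x1 != 0.
Proof.
move=> /andP[x0 x1lt]; have y0 := cmod_ge0.
have d0 : 0 < 1 - 2 * x1 by lra.
have lt1 : cmod y ^+ 2 / (1 - 2 * x1) ^+ 2 < 1.
  by rewrite ltr_pdivrMr ?exprn_gt0 // mul1r ltr_pXn2r ?nnegrE //; lra.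
by rewrite csqrt_eq0 ?subr_ge0 ?ltW // subr_eq0 eq_sym lt_eqF.
Qed.

Variables (E : cstarAlgType R) (a1 a2 : E).
Hypothesis hE : universal_E y a1 a2.

Lemma csqrt_sqrD (x : R) : 0 <= x <= 1 -> csqrt x ^+ 2 + csqrt (1 - x) ^+ 2 = 1.
Proof.
by move=> /andP[x0 x1]; rewrite !csqrt_sqr ?subr_ge0 // -rCD addrC subrK.
Qed.

Lemma csqrt_sqrB (x : R) : 0 <= x <= 1 ->
  csqrt (1 - x) ^+ 2 - csqrt x ^+ 2 = (1 - 2 * x)%:C%C.
Proof.
move=> /andP[x0 x1]; rewrite !csqrt_sqr ?subr_ge0 // -rCB; congr (_%:C%C); ring.
Qed.

Lemma model_exists p : y != 0 -> `|y| < 1 -> in_DyT2 y p ->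
  exists n (M1 M2 : 'M[R[i]]_n) rho,
    b_model y p M1 M2 /\ given_by_matrices a1 a2 M1 M2 rho.
Proof.
case: p => x1 x2 w1 w2 y0; rewrite cmodE [X in _ < X](_ : 1 = 1%:C%C) // ltcR => y1.
case=> /= /andP[x10 x1m] /andP[x20 x2m] w1n w2n.
have yge := cmod_ge0.
have x1I : 0 <= x1 <= 1 by rewrite x10 /=; lra.
have x2I : 0 <= x2 <= 1 by rewrite x20 /=; lra.
have ww1 : w1 * w1^* = 1 by rewrite -normCK w1n expr1n.
have ww2 : w2 * w2^* = 1 by rewrite -normCK w2n expr1n.
(* Here [1 - 2 x1 = |y|], so [u = y / |y|] already has modulus 1 and [s] must vanish. *)
have [x1E|x1N] := eqVneq x1 ((1 - cmod y) / 2).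
  have e1 : 1 - x1 = (1 + cmod y) / 2 by rewrite x1E; field.
  have e2 : 1 - 2 * x1 = cmod y by rewrite x1E; field.
  have yy : y = y / `|y| * (csqrt (1 - x1) ^+ 2 - csqrt x1 ^+ 2).
    by rewrite csqrt_sqrB // e2 -cmodE divfK // normr_eq0.
  have [|r Hr] := two_dim_exists hE (csqrtC x1) (csqrtC (1 - x1)) ww1
    (csqrt_sqrD x1I) yy (s := 0).
    rewrite mul0r mulr0 add0r -normCK normrM normfV normr_id mulfV ?normr_eq0 //.
    by rewrite expr1n.
  exists 2%N, (b1_mx1 y w1), (b1_mx2 y w1), r; split.
    exact: (@B_model1 _ y (Params x1 x2 w1 w2)).
  have -> : b1_mx1 y w1 = mx2 0 (w1 * csqrt x1) (csqrt (1 - x1)) 0.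
    by rewrite /b1_mx1 -e1 -x1E.
  suff -> : b1_mx2 y w1 = mx2 0 (y / `|y| * csqrt (1 - x1))
    (- (y / `|y| * w1^* * csqrt x1)) (- 0) by [].
  rewrite /b1_mx2 -e1 -x1E; apply: mx2_eq => //; last by rewrite oppr0.
  by ring.
have x1lt : 0 <= x1 < (1 - cmod y) / 2 by rewrite x10 lt_neqAle x1N x1m.
have d0 : (1 - 2 * x1)%:C%C != 0 :> R[i].
  by rewrite (inj_eq (@complexI R) _ 0); move: x1lt => /andP[_ ?]; apply/eqP; lra.
have yy : y = y / (1 - 2 * x1)%:C%C * (csqrt (1 - x1) ^+ 2 - csqrt x1 ^+ 2).
  by rewrite csqrt_sqrB // divfK.
have [x2E|x2N] := eqVneq x2 (1 / 2).
  have s2 : csqrt (2 : R) ^+ 2 = 2 by rewrite csqrt_sqr ?rCn // ler0n.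
  have s20 : csqrt (2 : R) != 0 by rewrite csqrt_eq0 ?ler0n // pnatr_eq0.
  have sC : (w2 / csqrt 2 * b_coef y x1)^* = w2^* / csqrt 2 * b_coef y x1.
    by rewrite !rmorphM fmorphV /= !csqrtC.
  have [|r Hr] := two_dim_exists hE (csqrtC x1) (csqrtC (1 - x1)) ww1
    (csqrt_sqrD x1I) yy (s := w2 / csqrt 2 * b_coef y x1).
    rewrite sC.
    have -> : 2 * (w2 / csqrt 2 * b_coef y x1 * (w2^* / csqrt 2 * b_coef y x1))
       = (w2 * w2^*) * (2 / csqrt 2 ^+ 2) * b_coef y x1 ^+ 2 by field.
    by rewrite ww2 s2 mulfV ?pnatr_eq0 // !mul1r b_coef_sqr // subrK.
  exists 2%N, (b22_mx1 x1 w1), (b22_mx2 y x1 w1 w2), r; split.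
    exact: (@B_model22 _ y (Params x1 x2 w1 w2)).
  have -> : b22_mx1 x1 w1 = mx2 0 (w1 * csqrt x1) (csqrt (1 - x1)) 0 by [].
  suff -> : b22_mx2 y x1 w1 w2 = mx2 (w2 / csqrt 2 * b_coef y x1)
    (y / (1 - 2 * x1)%:C%C * csqrt (1 - x1))
    (- (y / (1 - 2 * x1)%:C%C * w1^* * csqrt x1))
    (- (w2 / csqrt 2 * b_coef y x1)) by [].
  by apply: mx2_eq => //; ring.
have x2lt : 0 <= x2 < 1 / 2 by rewrite x20 lt_neqAle x2N x2m.
have [||r Hr] := four_dim_exists hE (csqrtC x1) (csqrtC (1 - x1)) ww1
    (csqrt_sqrD x1I) yy (kap := b_coef y x1) _ _ ww2 (csqrtC x2) (csqrtC (1 - x2))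
    (csqrt_sqrD x2I).
- exact: csqrtC.
- by rewrite b_coef_sqr // subrK.
exists (2 * 2)%N, (b21_mx1 x1 w1), (b21_mx2 y x1 x2 w1 w2), r; split => //.
exact: (@B_model21 _ y (Params x1 x2 w1 w2)).
Qed.

(** The two-dimensional model with [x1 = 0] is available for all these [y], including 0: then
    [u = y], and [s] is chosen with [2 s ^ 2 + |y|^2 = 1]. *)
Lemma universal_nontrivial : `|y| <= 1 -> exists x : E, x != 0.
Proof.
rewrite cmodE [X in _ <= X](_ : 1 = 1%:C%C) // lecR => y1; have yge := cmod_ge0.
have half0 : 0 <= (1 - cmod y ^+ 2) / 2 by nra.
have [|||||| r [rP _ _]] := @two_dim_exists _ _ _ _ _ hE 0 1 1 y _ _ _ _ _
  (csqrt ((1 - cmod y ^+ 2) / 2)).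
- exact: rmorph0.
- exact: rmorph1.
- by rewrite rmorph1 mulr1.
- by rewrite expr0n expr1n add0r.
- by rewrite expr0n expr1n subr0 mulr1.
- rewrite csqrtC -expr2 csqrt_sqr // -normCK cmodE -(rCn R 2) -rCX -rCM -rCD.
  rewrite (_ : 2 * _ + _ = 1) //; by field.
exists cone; apply/eqP => c0.
have := rep_oneE rP (const_mx 1 : Cn R 2); rewrite c0 (rep_zeroE rP).
by move=> /matrixP/(_ 0 0)/eqP; rewrite !mxE eq_sym oner_eq0.
Qed.
End ModelExistence.

(** * Classification of irreducible representations *)

Section Shift.
Variables (R : realType) (H : hilbertType R) (T : bop H).
Variables (tau w : R[i]) (x : R).
Hypotheses (rel : star T ** T + T ** star T = cone) (sq : T ** T = tau *: cone).
Hypotheses (x01 : 0 <= x <= 1 / 2) (w1 : `|w| = 1)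
  (tauE : tau = w * csqrt x * csqrt (1 - x)).

(* In an eigenvector [v] of [sgn_op T] for [1 - 2 x], the vectors [shift i v]
   span a copy of C^2 on which [T] acts as [weight_mx x w]. *)
Definition shift (i : 'I_2) (v : H) : H :=
  if i == 0 then v else (csqrt (1 - x))^-1 *: T v.

(** The matrix of [star T - 2 conj(tau) T] divided by [1 - 2 x], that is, of the direction removed
    from [a2] by [ortho_part]. *)
Definition ortho_mx : 'M[R[i]]_2 := mx2 0 (csqrt (1 - x)) (- (w^* * csqrt x)) 0.

Let eigen v := sgn_op T v = (1 - 2 * x)%:C%C *: v.
Let rho := csqrt x.
Let sigma := csqrt (1 - x).

Let x01' : 0 <= x <= 1.
Proof. by move/andP: x01 => [-> ?] /=; lra. Qed.
Let rs : rho ^+ 2 + sigma ^+ 2 = 1.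
Proof. exact: csqrt_sqrD. Qed.
Let dE : sigma ^+ 2 - rho ^+ 2 = (1 - 2 * x)%:C%C.
Proof. exact: csqrt_sqrB. Qed.
Let ww : w * w^* = 1. Proof. by rewrite -normCK w1 expr1n. Qed.
Let sigma0 : sigma != 0.
Proof.
by move/andP: x01 => [x0 x1]; rewrite /sigma csqrt_eq0; [apply/eqP|]; lra.
Qed.

Let block v : eigen v -> let f := sigma^-1 *: T v in
  [/\ T v = sigma *: f, T f = (w * rho) *: v, star T v = (w^* * rho) *: f,
      star T f = sigma *: v & hdot f f = hdot v v].
Proof.
move=> ev; apply: (sgn_op_block rel sq) => //; try exact: csqrtC.
by rewrite dE.
Qed.

Lemma shift_op v j : eigen v ->
  T (shift j v) = \sum_k weight_mx x w k j *: shift k v.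
Proof.
move=> /block/=[e1 e2 _ _ _]; rewrite !big_ord_recl big_ord0 /shift !mxE /= addr0.
by case: (j == 0); rewrite scale0r ?add0r ?addr0.
Qed.

Lemma shift_star v j : eigen v ->
  star T (shift j v) = \sum_k (weight_mx x w j k)^* *: shift k v.
Proof.
move=> /block/=[_ _ e1 e2 _]; rewrite !big_ord_recl big_ord0 /shift !mxE /= addr0.
case: (j == 0); rewrite rmorph0 scale0r ?add0r ?addr0 ?rmorphM /= ?csqrtC //.
Qed.

Lemma shift_ortho v j : eigen v ->
  (star T - (2 * tau^*) *: T) (shift j v)
  = \sum_k ((1 - 2 * x)%:C%C * ortho_mx k j) *: shift k v.
Proof.
move=> ev; have [e1 e2 e3 e4 _] := block ev.
rewrite bop_addE bop_oppE bop_scaleE.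
have e3' : bop_adj T v = _ := e3; have e4' : bop_adj T _ = _ := e4.
rewrite !big_ord_recl big_ord0 /shift !mxE /= addr0 -dE tauE !rmorphM /= !csqrtC -/rho -/sigma.
have rsE : rho ^+ 2 = 1 - sigma ^+ 2.
  by apply/eqP; rewrite eq_sym subr_eq rs.
case: (j == 0).
  rewrite e3'; set f := sigma^-1 *: T v in e1 *; rewrite e1; clearbody f.
  rewrite mulr0 scale0r add0r scalerA -scaleNr -scalerDl; congr (_ *: _).
  by ring: rsE.
rewrite e4' e2 mulr0 scale0r addr0 scalerA -scaleNr -scalerDl; congr (_ *: _).
by ring: rsE ww.
Qed.

Lemma shift_ortho_star v j : eigen v ->
  (T - (2 * tau) *: star T) (shift j v)
  = \sum_k ((1 - 2 * x)%:C%C * (ortho_mx j k)^*) *: shift k v.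
Proof.
move=> ev; have [e1 e2 e3 e4 _] := block ev.
rewrite bop_addE bop_oppE bop_scaleE.
have e3' : bop_adj T v = _ := e3; have e4' : bop_adj T _ = _ := e4.
rewrite !big_ord_recl big_ord0 /shift !mxE /= addr0 -dE tauE -/rho -/sigma.
have rsE : rho ^+ 2 = 1 - sigma ^+ 2.
  by apply/eqP; rewrite eq_sym subr_eq rs.
case: (j == 0).
  rewrite e3'; set f := sigma^-1 *: T v in e1 *; rewrite e1; clearbody f.
  rewrite rmorph0 mulr0 scale0r add0r scalerA -scaleNr -scalerDl csqrtC -/sigma.
  by congr (_ *: _); ring: rsE ww.
rewrite e4' e2 rmorph0 mulr0 scale0r addr0 scalerA -scaleNr -scalerDl.
rewrite rmorphN rmorphM /= conjCK csqrtC -/rho; congr (_ *: _).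
by ring: rsE ww.
Qed.

(** [T] maps the eigenspace of [1 - 2 x] to that of [- (1 - 2 x)]; the two are orthogonal because
    [sgn_op T] is self-adjoint and the eigenvalues differ. *)
Lemma shift_hdot u v i j : 1 - 2 * x != 0 -> eigen u -> eigen v ->
  hdot (shift i u) (shift j v) = (i == j)%:R * hdot u v.
Proof.
move=> d0 eu ev.
have dC : ((1 - 2 * x)%:C%C)^* = (1 - 2 * x)%:C%C :> R[i] by exact: conjc_real.
have sVC : (sigma^-1)^* = sigma^-1 by rewrite fmorphV /= csqrtC.
have perp u' v' : eigen u' -> eigen v' -> hdot u' (T v') = 0.
  move=> eu' ev'.
  have dX : (1 - 2 * x)%:C%C * hdot u' (T v') = - ((1 - 2 * x)%:C%C * hdot u' (T v')).
    rewrite -[LHS]hdotZl -[_ *: u']eu' -{1}(sgn_op_sa T) bop_starP -bop_mulE.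
    have /(congr1 (-%R)) := sgn_op_anti rel sq; rewrite opprK => <-.
    by rewrite bop_oppE bop_mulE ev' bopZ hdotNr hdotZr dC.
  have d20 : (1 - 2 * x)%:C%C * 2 != 0 :> R[i].
    by rewrite mulf_neq0 ?pnatr_eq0 // (inj_eq (@complexI R) _ 0).
  by apply: (mulfI d20); rewrite mulr0 mulrAC mulr_natr mulr2n {1}dX addNr.
have ord2 (l : 'I_2) : l = 0 \/ l = 1.
  by case: l => -[|[|//]] ?; [left|right]; apply/val_inj.
have [_ _ _ e4 _] := block eu.
case: (ord2 i) => ->; case: (ord2 j) => ->; rewrite /shift /= ?mul1r ?mul0r //.
- by rewrite hdotZr perp ?mulr0.
- by rewrite hdotC hdotZr perp // mulr0 rmorph0.
- by rewrite hdotZr sVC -bop_starP e4 hdotZl mulKf.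
Qed.

(** The origin of the factor diag(1, -1) in the four-dimensional model. *)
Lemma shift_anti (C : bop H) v j : T ** C = - (C ** T) ->
  C (shift j v) = (if j == 0 then 1 else -1) *: shift j (C v).
Proof.
move=> TC; rewrite /shift; case: (j == 0); first by rewrite scale1r.
have -> : T (C v) = - C (T v) by rewrite -!bop_mulE TC bop_oppE.
by rewrite bopZ; modring.
Qed.
End Shift.

Lemma sum_mxtens (V : nmodType) m n (F : 'I_(m * n) -> V) :
  \sum_k F k = \sum_(i < m) \sum_(j < n) F (mxtens_index (i, j)).
Proof.
rewrite pair_bigA (reindex (@mxtens_index m n)) /=.
  by apply: eq_bigr => -[].
by exists (@mxtens_unindex m n) => k _; rewrite (mxtens_indexK, mxtens_unindexK).
Qed.

Lemma ord2_cases (i : 'I_2) : i = ord0 \/ i = lift ord0 ord0.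
Proof. by case: i => -[|[|//]] ?; [left|right]; apply/val_inj. Qed.

Lemma sum_tens_col (R : realType) (V : lmodType R[i]) m n (M : 'M[R[i]]_m)
    (N : 'M[R[i]]_n) (F : 'I_m -> 'I_n -> V) i j :
  \sum_k (M *t N) k (mxtens_index (i, j))
      *: F (mxtens_unindex k).1 (mxtens_unindex k).2
  = \sum_k \sum_l (M k i * N l j) *: F k l.
Proof.
rewrite sum_mxtens; apply: eq_bigr => k _; apply: eq_bigr => l _.
by rewrite tensmxE mxtens_indexK.
Qed.

Lemma sum_tens1_col (R : realType) (V : lmodType R[i]) m n (M : 'M[R[i]]_m)
    (F : 'I_m -> 'I_n -> V) i j :
  \sum_k (M *t (1%:M : 'M[R[i]]_n)) k (mxtens_index (i, j))
      *: F (mxtens_unindex k).1 (mxtens_unindex k).2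
  = \sum_k M k i *: F k j.
Proof.
rewrite sum_tens_col; apply: eq_bigr => k _; rewrite (bigD1 j) //= mxE eqxx mulr1.
by rewrite big1 ?addr0 // => l /negPf lj; rewrite mxE lj mulr0 scale0r.
Qed.

Lemma E_relations_sym (R : realType) (y : R[i]) (A : cstarAlgType R) (a b : A) :
  E_relations y a b -> E_relations y b a.
Proof.
move=> rel; have := star_mulE21 rel; case: rel => r1 r2 _ r4 r3.
by split => //; rewrite addrC.
Qed.

(** Passing a factor through a square takes two exchanges; the sign returns to plus and the two
    scalar terms cancel. *)
Lemma sqr_central (R : realType) (y : R[i]) (A : cstarAlgType R) (a b : A) :
  E_relations y a b ->
  [/\ a ** a ** a = a ** (a ** a), a ** a ** b = b ** (a ** a),
      star a ** star a ** a = a ** (star a ** star a)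
    & star a ** star a ** b = b ** (star a ** star a)].
Proof.
move=> rel; split; rewrite ?cmulA //.
- rewrite (mulE21 rel) !cmul_lin -[a ** b ** a]cmulA (mulE21 rel) !cmul_lin.
  by modring.
- rewrite -cmulA (star_mulE1 rel) !cmul_lin (star_mulE1 rel) !cmul_lin; by modring.
- rewrite -cmulA (star_mulE12 rel) !cmul_lin (star_mulE12 rel) !cmul_lin.
  by modring.
Qed.

Section Classification.
Variables (R : realType) (y : R[i]) (E : cstarAlgType R) (a1 a2 : E).
Hypothesis hE : universal_E y a1 a2.
Variables (H : hilbertType R) (pi : E -> H -> H).
Hypotheses (piP : representation pi) (pi_irr : irreducible pi).

Let A : bop H := rep_bop piP a1.
Let B : bop H := rep_bop piP a2.
Let ABrel : E_relations y A B.
Proof. by case: hE => hE1 _; apply: (star_hom_relations (rep_bop_hom piP) hE1). Qed.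

Definition equivalent_to_model n (M1 M2 : 'M[R[i]]_n) : Prop :=
  exists rho, given_by_matrices a1 a2 M1 M2 rho /\ unitarily_equivalent pi rho.

(** [commutant_generators] handles self-adjoint elements; it is used with the identity homomorphism
    on the real and imaginary parts of [z]. *)
Lemma central_of_generators (z : E) : z ** a1 = a1 ** z -> z ** a2 = a2 ** z ->
  star z ** a1 = a1 ** star z -> star z ** a2 = a2 ** star z ->
  (forall x, z ** x = x ** z) /\ (forall x, star z ** x = x ** star z).
Proof.
move=> z1 z2 z1' z2'.
have id_hom : star_hom (@id E) by split.
have c1 x : (z + star z) ** x = x ** (z + star z).
  apply: (commutant_generators hE id_hom); rewrite ?cmul_lin ?z1 ?z2 ?z1' ?z2' //.
  by rewrite !star_lin addrC.
have c2 x : ('i *: (star z - z)) ** x = x ** ('i *: (star z - z)).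
  apply: (commutant_generators hE id_hom); rewrite ?cmul_lin ?z1 ?z2 ?z1' ?z2' //.
  by rewrite !star_lin conjCi; modring.
have zE : z = 2^-1 *: ((z + star z) + 'i *: ('i *: (star z - z))).
  rewrite scalerA -expr2 sqrCi (_ : _ + _ = 2 *: z); last by modring.
  by rewrite scalerA mulVf ?scale1r ?pnatr_eq0.
have zC x : z ** x = x ** z.
  by rewrite zE cmulZl cmulZr cmulDl cmulDr [in LHS]cmulZl [in RHS]cmulZr c1 c2.
by split=> // x; apply: (can_inj (@starK R E)); rewrite !starM starK zC.
Qed.

Lemma generator_squares_scalar :
  exists alpha beta, A ** A = alpha *: cone /\ B ** B = beta *: cone.
Proof.
have scal a b : E_relations y a b -> (forall z : E, z ** a = a ** z -> z ** b = b ** z ->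
    star z ** a = a ** star z -> star z ** b = b ** star z ->
    (forall x, z ** x = x ** z) /\ (forall x, star z ** x = x ** star z)) ->
    exists k, rep_bop piP a ** rep_bop piP a = k *: cone.
  move=> rel cent; have [s1 s2 s3 s4] := sqr_central rel.
  have [||||c1 c2] := cent (a ** a); rewrite ?starM //.
  have [k kE] := schur_normal piP pi_irr c1 c2.
  exists k; apply: bop_ext => v; rewrite bop_mulE bop_scaleE bop_oneE /= -kE.
  by rewrite (rep_mulE piP).
have [rel _] := hE; have [alpha aE] := scal a1 a2 rel central_of_generators.
have [|beta bE] := scal a2 a1 (E_relations_sym rel).
  by move=> z z1 z2 z1' z2'; apply: central_of_generators.
by exists alpha, beta.
Qed.

Section Reduced.
Variables (alpha beta w1 : R[i]) (x1 : R).
Hypotheses (Asq : A ** A = alpha *: cone) (Bsq : B ** B = beta *: cone).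
Hypotheses (x1I : 0 <= x1 < 1 / 2) (w1n : `|w1| = 1)
  (alphaE : alpha = w1 * csqrt x1 * csqrt (1 - x1)).

Let d : R[i] := (1 - 2 * x1)%:C%C.
Let u : R[i] := y / d.
Definition reduced_part : bop H := ortho_part A B (u / d) alpha.
Let C := reduced_part.
Let eigen (v : H) := sgn_op A v = d *: v.

Let Arel : star A ** A + A ** star A = cone. Proof. by case: ABrel. Qed.
Let x1I' : 0 <= x1 <= 1 / 2.
Proof. by move/andP: x1I => [-> /ltW]. Qed.
Let dR0 : 1 - 2 * x1 != 0.
Proof. by move/andP: x1I => [_ ?]; apply/eqP; lra. Qed.
Let d0 : d != 0.
Proof. by rewrite (inj_eq (@complexI R) _ 0). Qed.
Let dC : d^* = d. Proof. exact: conjc_real. Qed.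

Lemma sgn_op_valE : 1 - 4 * (alpha * alpha^*) = d ^+ 2.
Proof.
have ww : w1 * w1^* = 1 by rewrite -normCK w1n expr1n.
have x1I1 : 0 <= x1 <= 1 by move/andP: x1I => [-> ?] /=; lra.
rewrite /d -csqrt_sqrB // alphaE !rmorphM /= !csqrtC.
have rsE : csqrt x1 ^+ 2 = 1 - csqrt (1 - x1) ^+ 2.
  by apply/eqP; rewrite eq_sym subr_eq csqrt_sqrD.
by ring: rsE ww.
Qed.

Let yk : y = u / d * (1 - 4 * (alpha * alpha^*)).
Proof. by rewrite sgn_op_valE expr2 mulrA !divfK. Qed.

Lemma reduced_anti1 : A ** C = - (C ** A).
Proof. exact: ortho_part_anti1 ABrel Asq yk. Qed.
Lemma reduced_anti2 : star A ** C = - (C ** star A).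
Proof. exact: ortho_part_anti2 ABrel Asq. Qed.
Lemma reduced_anti3 : A ** star C = - (star C ** A).
Proof.
have /(congr1 star) := reduced_anti2; rewrite starN !starM starK => ->.
by rewrite opprK.
Qed.
Lemma reduced_sqr : C ** C = (beta + u ^+ 2 * alpha^*) *: cone.
Proof.
rewrite /C /reduced_part (ortho_part_sqr ABrel Asq Bsq yk) sgn_op_valE.
by rewrite exprMn exprVn divfK ?expf_neq0.
Qed.
Lemma reduced_rel : star C ** C + C ** star C = (1 - u * u^*) *: cone.
Proof.
rewrite /C /reduced_part (ortho_part_rel ABrel Asq yk) sgn_op_valE.
have -> : (u / d)^* = u^* / d by rewrite rmorphM fmorphV /= dC.
have aux (p q r : R[i]) : r != 0 -> p / r * (q / r) * r ^+ 2 = p * q.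
  by move=> r0; field.
by rewrite aux.
Qed.

Let sgn (j : 'I_2) : R[i] := if j == 0 then 1 else -1.

Let B_shift v j : eigen v -> B (shift A x1 j v) =
  sgn j *: shift A x1 j (C v) + \sum_k (u * ortho_mx w1 x1 k j) *: shift A x1 k v.
Proof.
move=> ev; have -> : B = C + (u / d) *: (star A - (2 * alpha^*) *: A).
  by rewrite /C /reduced_part /ortho_part subrK.
rewrite bop_addE (shift_anti _ _ _ reduced_anti1) bop_scaleE.
rewrite (shift_ortho Arel Asq x1I' w1n alphaE _ ev) scaler_sumr.
congr (_ + _); apply: eq_bigr => k _; rewrite scalerA mulrA -/d.
by rewrite divfK.
Qed.

Let B'_shift v j : eigen v -> star B (shift A x1 j v) =
  sgn j *: shift A x1 j (star C v)
  + \sum_k (u * ortho_mx w1 x1 j k)^* *: shift A x1 k v.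
Proof.
move=> ev; have -> : star B = star C + (u / d)^* *: (A - (2 * alpha) *: star A).
  have BE : B = C + (u / d) *: (star A - (2 * alpha^*) *: A).
    by rewrite /C /reduced_part /ortho_part subrK.
  have gen (S T : bop H) k m :
      star (S + k *: (star T - m *: T)) = star S + k^* *: (T - m^* *: star T).
    by rewrite !star_lin.
  have mE : (2 * alpha^*)^* = 2 * alpha by rewrite rmorphM /= conjCK conjC_nat.
  by rewrite {1}BE gen mE.
rewrite bop_addE (shift_anti _ _ _ reduced_anti3) bop_scaleE.
rewrite (shift_ortho_star Arel Asq x1I' w1n alphaE _ ev) scaler_sumr.
congr (_ + _); apply: eq_bigr => k _; rewrite scalerA mulrA -/d.
have ud : (u / d)^* * d = u^* by rewrite rmorphM fmorphV /= dC divfK.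
by rewrite ud [in RHS]rmorphM.
Qed.

Let normalize (v : H) : v != 0 ->
  exists2 l : R[i], l != 0 & hdot (l *: v) (l *: v) = 1.
Proof.
move=> v0; exists (`|v|^-1); first by rewrite invr_neq0 // normr_eq0.
rewrite hdotZl hdotZr hdot_norm fmorphV /= geC0_conj //.
by rewrite mulrA -expr2 -exprMn mulVf ?normr_eq0 // expr1n.
Qed.

(** Since [C] and [star C] act on [e] by scalars, the span of [e] and [A e] is already stable under
    both generators and their adjoints. *)
Lemma two_dim_equivalent (e : H) (s : R[i]) : e != 0 -> eigen e ->
  C e = s *: e -> star C e = s^* *: e ->
  equivalent_to_model (mx2 0 (w1 * csqrt x1) (csqrt (1 - x1)) 0)
    (mx2 s (u * csqrt (1 - x1)) (- (u * (w1^* * csqrt x1))) (- s)).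
Proof.
move=> e_neq0 ee Ce C'e; have [l l0 ll] := normalize e_neq0.
have ev : eigen (l *: e) by rewrite /eigen bopZ ee; modring.
have Cv : C (l *: e) = s *: (l *: e) by rewrite bopZ Ce; modring.
have C'v : star C (l *: e) = s^* *: (l *: e) by rewrite bopZ C'e; modring.
move: (l *: e) ll ev Cv C'v => v vv ev Cv C'v.
have shiftZ k j : shift A x1 j (k *: v) = k *: shift A x1 j v.
  by rewrite /shift; case: (j == 0); rewrite // bopZ; modring.
apply: (equivalent_to_matrices piP pi_irr hE (w := fun j => shift A x1 j v)) => //.
- by move=> i j; rewrite (shift_hdot Arel Asq x1I' w1n alphaE) // vv mulr1.
- by move=> j; rewrite -[LHS]/(A _) (shift_op Arel Asq x1I' w1n alphaE).
- by move=> j; rewrite -[LHS]/(star A _) (shift_star Arel Asq x1I' w1n alphaE).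
- move=> j; rewrite -[LHS]/(B _) B_shift // Cv shiftZ !big_ord_recl !big_ord0 !mxE /=.
  by rewrite /sgn; case: j => -[|[|//]] ? /=; modring.
- move=> j; rewrite -[LHS]/(star B _) B'_shift // C'v shiftZ !big_ord_recl !big_ord0 !mxE /=.
  rewrite /sgn; case: j => -[|[|//]] ? /=;
    rewrite ?mulr0 ?rmorphN ?rmorph0 ?mulrN ?rmorphN; by modring.
Qed.

(** The basis is a double shift of a joint eigenvector: [shift Q] supplies the second tensor factor
    and [shift A] the first. *)
Lemma four_dim_equivalent (Q : bop H) (q w2 kap : R[i]) (x2 : R) (e : H) :
  C = kap *: Q -> kap^* = kap -> star Q ** Q + Q ** star Q = cone ->
  Q ** Q = q *: cone -> 0 <= x2 < 1 / 2 -> `|w2| = 1 ->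
  q = w2 * csqrt x2 * csqrt (1 - x2) ->
  A ** Q = - (Q ** A) -> star A ** Q = - (Q ** star A) ->
  e != 0 -> eigen e -> sgn_op Q e = (1 - 2 * x2)%:C%C *: e ->
  equivalent_to_model (weight_mx x1 w1 *t (1%:M : 'M[R[i]]_2))
    (kap *: (mx2 1 0 0 (-1) *t weight_mx x2 w2)
     + u *: (ortho_mx w1 x1 *t (1%:M : 'M[R[i]]_2))).
Proof.
move=> CQ kapC Qrel Qsq x2I w2n qE AQ A'Q e_neq0 ee eQ.
have [l l0 ll] := normalize e_neq0.
have ev : eigen (l *: e) by rewrite /eigen bopZ ee; modring.
have eQv : sgn_op Q (l *: e) = (1 - 2 * x2)%:C%C *: (l *: e).
  by rewrite bopZ eQ; modring.
move: (l *: e) ll ev eQv => v vv ev eQv.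
have x2I' : 0 <= x2 <= 1 / 2 by move/andP: x2I => [-> /ltW].
have dQ0 : 1 - 2 * x2 != 0.
  by move/andP: x2I => [_ ?]; apply/eqP; lra.
pose g j := shift Q x2 j v.
(* [Q] commutes with [sgn_op A], so the block of [Q] stays inside one eigenspace. *)
have eg j : eigen (g j).
  rewrite /g /shift; case: (j == 0) => //.
  by rewrite /eigen bopZ -bop_mulE (sgn_op_comm AQ A'Q) bop_mulE ev bopZ; modring.
have Qg j : Q (g j) = \sum_k weight_mx x2 w2 k j *: g k.
  exact: (shift_op Qrel Qsq x2I' w2n qE).
have Q'g j : star Q (g j) = \sum_k (weight_mx x2 w2 j k)^* *: g k.
  exact: (shift_star Qrel Qsq x2I' w2n qE).
have gg j j' : hdot (g j) (g j') = (j == j')%:R.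
  by rewrite (shift_hdot Qrel Qsq x2I' w2n qE) // vv mulr1.
clearbody g.
pose F i j := shift A x1 i (g j).
have shiftZ i k z : shift A x1 i (k *: z) = k *: shift A x1 i z.
  by rewrite /shift; case: (i == 0); rewrite // bopZ; modring.
have shiftD i z z' : shift A x1 i (z + z') = shift A x1 i z + shift A x1 i z'.
  by rewrite /shift; case: (i == 0); rewrite // bopD scalerDr.
have CF i j : shift A x1 i (C (g j)) = kap *: \sum_k weight_mx x2 w2 k j *: F i k.
  rewrite CQ bop_scaleE shiftZ Qg.
  by rewrite !big_ord_recl !big_ord0 !addr0 shiftD !shiftZ.
have C'F i j : shift A x1 i (star C (g j))
    = kap *: \sum_k (weight_mx x2 w2 j k)^* *: F i k.
  rewrite CQ starZ bop_scaleE kapC shiftZ Q'g.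
  by rewrite !big_ord_recl !big_ord0 !addr0 shiftD !shiftZ.
have opF i j : A (F i j) = \sum_k weight_mx x1 w1 k i *: F k j.
  exact: (shift_op Arel Asq x1I' w1n alphaE i (eg j)).
have op'F i j : star A (F i j) = \sum_k (weight_mx x1 w1 i k)^* *: F k j.
  exact: (shift_star Arel Asq x1I' w1n alphaE i (eg j)).
have BF i j : B (F i j) = sgn i *: shift A x1 i (C (g j))
    + \sum_k (u * ortho_mx w1 x1 k i) *: F k j by exact: B_shift (eg j).
have B'F i j : star B (F i j) = sgn i *: shift A x1 i (star C (g j))
    + \sum_k (u * ortho_mx w1 x1 i k)^* *: F k j by exact: B'_shift (eg j).
have FF i j i' j' : hdot (F i j) (F i' j') = (i == i')%:R * (j == j')%:R.
  by rewrite (shift_hdot Arel Asq x1I' w1n alphaE _ _ dR0 (eg j) (eg j')) gg.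
clearbody F.
apply: (equivalent_to_matrices piP pi_irr hE
  (w := fun k => F (mxtens_unindex k).1 (mxtens_unindex k).2)) => //.
- move=> k k'; case: (mxtens_indexP k) => i j; case: (mxtens_indexP k') => i' j'.
  rewrite !mxtens_indexK /= FF (can_eq (@mxtens_indexK _ _)) xpair_eqE.
  by case: (i == i'); case: (j == j'); rewrite ?mulr0 ?mul0r ?mulr1.
- move=> k; case: (mxtens_indexP k) => i j; rewrite mxtens_indexK /= -[LHS]/((A) (F i j)).
  by rewrite opF sum_tens1_col.
- move=> k; case: (mxtens_indexP k) => i j; rewrite mxtens_indexK /= -[LHS]/((star A) (F i j)).
  under [RHS]eq_bigr => k' _.
    rewrite (_ : (_)^* = (dagmx (weight_mx x1 w1) *t 1%:M) k' (mxtens_index (i, j))); last first.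
      by rewrite -dagmxE dagmx_tens dagmx1.
    over.
  by rewrite sum_tens1_col op'F; apply: eq_bigr => k' _; rewrite !mxE.
- move=> k; case: (mxtens_indexP k) => i j; rewrite mxtens_indexK /= -[LHS]/((B) (F i j)).
  rewrite BF CF.
  under [RHS]eq_bigr => k' _.
    rewrite mxE scalerDl [X in X *: _ + _]mxE [X in _ + X *: _]mxE.
    rewrite -(scalerA kap) -(scalerA u).
    over.
  rewrite big_split /= -!scaler_sumr sum_tens1_col sum_tens_col.
  congr (_ + _); last first.
    rewrite scaler_sumr.
    by apply: eq_bigr => k' _; rewrite scalerA.
  rewrite !big_ord_recl !big_ord0 !mxE /sgn.
  by case: (ord2_cases i) => -> /=; modring.
- move=> k; case: (mxtens_indexP k) => i j; rewrite mxtens_indexK /= -[LHS]/((star B) (F i j)).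
  rewrite B'F C'F.
  under [RHS]eq_bigr => k' _.
    rewrite (_ : (_)^* = (kap *: (dagmx (mx2 1 0 0 (-1)) *t dagmx (weight_mx x2 w2))
      + u^* *: (dagmx (ortho_mx w1 x1) *t (1%:M : 'M[R[i]]_2))) k' (mxtens_index (i, j))); last first.
      by rewrite -dagmxE dagmxD !dagmxZ !dagmx_tens dagmx1 kapC.
    rewrite mxE scalerDl [X in X *: _ + _]mxE [X in _ + X *: _]mxE.
    rewrite -(scalerA kap) -(scalerA u^*).
    over.
  rewrite big_split /= -!scaler_sumr sum_tens1_col sum_tens_col.
  congr (_ + _); last first.
    rewrite scaler_sumr.
    by apply: eq_bigr => k' _; rewrite scalerA dagmxE -[in RHS]rmorphM.
  rewrite !big_ord_recl !big_ord0 !mxE /sgn.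
  by case: (ord2_cases i) => -> /=; rewrite ?rmorph0 ?rmorph1 ?rmorphN1; modring.
Qed.
End Reduced.

(** The boundary case is left in terms of [weight_mx] and [ortho_mx], so that both (a), where
    [|y| = 1] forces [x1 = 0], and (b1) can be read off from it. *)
Lemma irreducible_classification : y != 0 ->
  exists x1 w1, [/\ 0 <= x1 <= (1 - cmod y) / 2, `|w1| = 1
  & (x1 = (1 - cmod y) / 2 /\ equivalent_to_model (weight_mx x1 w1)
       (y / (1 - 2 * x1)%:C%C *: ortho_mx w1 x1)) \/
    exists x2 w2, [/\ x1 < (1 - cmod y) / 2, `|w2| = 1
    & (0 <= x2 < 1 / 2 /\
         equivalent_to_model (b21_mx1 x1 w1) (b21_mx2 y x1 x2 w1 w2)) \/
      (x2 = 1 / 2 /\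
         equivalent_to_model (b22_mx1 x1 w1) (b22_mx2 y x1 w1 w2))]].
Proof.
move=> y0; have [[v0 v0N] _] := pi_irr; have yge := cmod_ge0 y.
have [alpha [beta [Asq Bsq]]] := generator_squares_scalar.
have Arel : star A ** A + A ** star A = cone by case: ABrel.
have [x1 [w1 [/andP[x10 x1h] w1n alphaE dE]]] :=
  weight_param (sgn_op_ge0 v0N Arel Asq).
have x1N : x1 != 1 / 2.
  apply: contraNneq y0 => x1E.
  have d0 : 1 - 4 * (alpha * alpha^*) = 0.
    by rewrite dE x1E mulrC divfK ?pnatr_eq0 // subrr expr0n.
  have := degenerate_rel ABrel Asq; rewrite d0 scale0r => /bop_rel_eq0 D0.
  have := degenerate_anti alpha ABrel; cbv zeta; rewrite D0 star0 cmul0l cmul0r addr0.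
  move=> /(congr1 (fun S : bop H => S v0)); rewrite bop_scaleE bop_oneE bop_zeroE.
  by move=> /esym/eqP; rewrite scaler_eq0 (negPf v0N) orbF.
have x1I : 0 <= x1 < 1 / 2 by rewrite x10 lt_neqAle x1N x1h.
have dR0 : 0 < 1 - 2 * x1 by move/andP: x1I => [_ ?]; lra.
set d : R[i] := (1 - 2 * x1)%:C%C; set u := y / d.
have d0 : d != 0 by rewrite (inj_eq (@complexI R) _ 0) gt_eqF.
set C := reduced_part alpha x1.
have Crel : star C ** C + C ** star C = (1 - u * u^*) *: cone.
  exact: reduced_rel Asq x1I w1n alphaE.
have uuE : u * u^* = (cmod y ^+ 2 / (1 - 2 * x1) ^+ 2)%:C%C.
  rewrite -normCK normrM normfV cmodE [`|d|]ger0_norm; last by rewrite ler0c ltW.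
  by rewrite rCM rCV !rCX exprMn exprVn.
have x1m : x1 <= (1 - cmod y) / 2.
  have := bop_rel_ge0 v0N Crel; rewrite uuE [X in X - _](_ : 1 = 1%:C%C) // -rCB ler0c.
  rewrite subr_ge0 ler_pdivrMr ?exprn_gt0 // mul1r ler_pXn2r ?nnegrE ?(ltW dR0) //.
  by move=> ?; lra.
have [e1 [e1N e1A _]] := sgn_op_eigenvector Arel Asq dE v0N.
exists x1, w1; split; rewrite ?x10 ?x1m //.
have [x1E|x1Nm] := eqVneq x1 ((1 - cmod y) / 2); [left|right].
  split=> //; have C0 : C = 0.
    apply: bop_rel_eq0; rewrite Crel uuE (_ : 1 - 2 * x1 = cmod y); last first.
      by rewrite x1E; field.
    rewrite mulfV ?subrr ?scale0r // expf_neq0 //.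
    by rewrite -(inj_eq (@complexI R)) -cmodE normr_eq0.
  have [||r Hr] := two_dim_equivalent Asq x1I w1n alphaE e1N e1A (s := 0).
  - by rewrite -/C C0 scale0r.
  - by rewrite -/C C0 star0 rmorph0 scale0r.
  exists r; rewrite (_ : _ *: ortho_mx w1 x1 =
    mx2 0 (u * csqrt (1 - x1)) (- (u * (w1^* * csqrt x1))) (- 0)) //.
  by rewrite mx2_scale; apply: mx2_eq; rewrite -/d -/u; ring.
have x1lt : 0 <= x1 < (1 - cmod y) / 2 by rewrite x10 lt_neqAle x1Nm x1m.
set kap := b_coef y x1.
have kapC : kap^* = kap by exact: csqrtC.
have kap0 : kap != 0 by exact: b_coef_gt0.
have kapE : kap ^+ 2 = 1 - u * u^* by exact: b_coef_sqr.
pose Q := kap^-1 *: C.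
have CQ : C = kap *: Q by rewrite /Q scalerA mulfV // scale1r.
have kapVC : (kap^-1)^* = kap^-1 by rewrite fmorphV /= kapC.
have Qrel : star Q ** Q + Q ** star Q = cone.
  rewrite /Q starZ kapVC !(cmulZl, cmulZr) !scalerA -scalerDr Crel scalerA -kapE.
  by rewrite expr2 mulrA mulfVK // mulVf // scale1r.
pose q := kap^-1 ^+ 2 * (beta + u ^+ 2 * alpha^*).
have Qsq : Q ** Q = q *: cone.
  rewrite /Q !(cmulZl, cmulZr) scalerA (reduced_sqr Asq Bsq x1I w1n alphaE).
  by rewrite scalerA -expr2.
have Canti1 := reduced_anti1 Asq x1I w1n alphaE.
have Canti2 := reduced_anti2 x1 Asq.
have AQ : A ** Q = - (Q ** A) by rewrite /Q cmulZl cmulZr Canti1 scalerN.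
have A'Q : star A ** Q = - (Q ** star A).
  by rewrite /Q cmulZl cmulZr Canti2 scalerN.
have AQ' : A ** star Q = - (star Q ** A).
  by have /(congr1 star) := A'Q; rewrite starN !starM starK => ->; rewrite opprK.
have A'Q' : star A ** star Q = - (star Q ** star A).
  by have /(congr1 star) := AQ; rewrite starN !starM => ->; rewrite opprK.
clearbody Q.
have [x2 [w2 [/andP[x20 x2h] w2n qE d2E]]] := weight_param (sgn_op_ge0 v0N Qrel Qsq).
(* Starting from the eigenvector [e1] of [sgn_op A] makes [e] a joint eigenvector, since [sgn_op A]
   commutes with [Q] and [star Q]. *)
have [e [eN eQ eP]] := sgn_op_eigenvector Qrel Qsq d2E e1N.
have eA : sgn_op A e = d *: e.
  by apply: eP => //; apply: sgn_op_comm.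
have [x2E|x2N] := eqVneq x2 (1 / 2); last first.
  exists x2, w2; split; [by case/andP: x1lt | by [] | left].
  have x2I : 0 <= x2 < 1 / 2 by rewrite x20 lt_neqAle x2N x2h.
  split=> //; exact: (four_dim_equivalent Asq x1I w1n alphaE CQ kapC Qrel Qsq
    x2I w2n qE AQ A'Q eN eA eQ).
have {}eQ : sgn_op Q e = 0.
  by rewrite eQ x2E mulrC divfK ?pnatr_eq0 // subrr scale0r.
have q_norm : 2 * `|q| = 1.
  have -> : q = w2 * csqrt (1 / 2) ^+ 2.
    by rewrite qE x2E -mulrA expr2 (_ : 1 - 1 / 2 = 1 / 2) //; lra.
  rewrite csqrt_sqr ?divr_ge0 ?ler0n // normrM w2n mul1r ger0_norm ?ler0c ?divr_ge0 //.
  by rewrite mul1r rCV rCn mulfV ?pnatr_eq0.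
(* With [sgn_op Q] zero on [e], an eigenvector of [Q] itself is available: [Q e + r e] for
   [r ^ 2 = q], or [e] with eigenvalue [- r] if that sum vanishes. *)
have [f [s [fN fA fQ Qf sq]]] : exists f s, [/\ f != 0, sgn_op A f = d *: f,
    sgn_op Q f = 0, Q f = s *: f & s ^+ 2 = q].
  pose r := sqrtC q; have rr : r ^+ 2 = q by rewrite sqrtCK.
  have QQ : Q (Q e) = r ^+ 2 *: e.
    by rewrite -bop_mulE Qsq bop_scaleE bop_oneE rr.
  have [Qe|Qe] := eqVneq (Q e + r *: e) 0.
    exists e, (- r); split; rewrite ?sqrrN //.
    by rewrite scaleNr; apply/eqP; rewrite -addr_eq0 Qe.
  exists (Q e + r *: e), r; split => //.
  - rewrite bopD bopZ -bop_mulE (sgn_op_comm AQ A'Q) bop_mulE eA bopZ; modring.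
  - rewrite bopD bopZ eQ scaler0 addr0 -bop_mulE -[sgn_op Q ** Q]opprK.
    by rewrite -(sgn_op_anti Qrel Qsq) bop_oppE bop_mulE eQ bop0 oppr0.
  - by rewrite bopD bopZ QQ; modring.
have ss : 2 * (s * s^*) = 1 by rewrite -normCK -normrX sq.
have s0 : s != 0.
  by apply: contra_eq_neq ss => ->; rewrite mul0r mulr0 eq_sym oner_neq0.
(* As [sgn_op Q] kills [f], twice [star Q (Q f)] is [f]; so [2 s] times [star Q f] is [f], and
   [2 |s|^2 = 1]. *)
have Q'f : star Q f = s^* *: f.
  have t1 : star Q (Q f) + Q (star Q f) = f by rewrite -!bop_mulE -bop_addE Qrel.
  have t2 : star Q (Q f) - Q (star Q f) = 0 by rewrite -fQ /sgn_op bop_addE bop_oppE.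
  have s20 : 2 * s != 0 by rewrite mulf_neq0 ?pnatr_eq0.
  apply: (scalerI s20); rewrite [RHS]scalerA -mulrA ss scale1r -[RHS]t1 -[RHS]addr0 -t2.
  by rewrite Qf bopZ; modring.
have s2 : csqrt (2 : R) ^+ 2 = 2 by rewrite csqrt_sqr ?rCn // ler0n.
have s20 : csqrt (2 : R) != 0 by rewrite csqrt_eq0 ?ler0n // pnatr_eq0.
exists (1 / 2), (s * csqrt 2); split; first by case/andP: x1lt.
  apply/eqP; rewrite -(@eqrXn2 _ 2) // expr1n normCK rmorphM /= csqrtC.
  by rewrite mulrACA -expr2 s2 mulrC ss.
right; split=> //.
have [||r Hr] := two_dim_equivalent Asq x1I w1n alphaE fN fA (s := s * kap).
- by rewrite -/C CQ bop_scaleE Qf scalerA mulrC.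
- by rewrite -/C CQ starZ kapC bop_scaleE Q'f scalerA rmorphM /= kapC mulrC.
exists r; rewrite (_ : b22_mx2 _ _ _ _ = mx2 (s * kap) (u * csqrt (1 - x1))
  (- (u * (w1^* * csqrt x1))) (- (s * kap))) //.
by rewrite /b22_mx2 mulfK // -/kap -/d /u; apply: mx2_eq => //; ring.
Qed.
End Classification.

(** * Invariants of the models *)

Section Invariants.
Variables (R : realType) (y : R[i]).

(** The modulus gives [x (1 - x)], which is injective on [[0, 1/2]]; the phase is then visible
    unless [x = 0]. *)
Lemma weight_param_inj (x x' : R) (w w' : R[i]) :
  0 <= x <= 1 / 2 -> 0 <= x' <= 1 / 2 -> `|w| = 1 -> `|w'| = 1 ->
  w * csqrt x * csqrt (1 - x) = w' * csqrt x' * csqrt (1 - x') ->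
  x = x' /\ (x = 0 \/ w = w').
Proof.
move=> xI xI' w1 w1' e.
have n_sqr (z : R) (v : R[i]) : 0 <= z <= 1 / 2 -> `|v| = 1 ->
    `|v * csqrt z * csqrt (1 - z)| ^+ 2 = (z * (1 - z))%:C%C.
  move=> /andP[z0 z1] v1; rewrite !normrM v1 mul1r exprMn.
  by rewrite ![`|csqrt _|]ger0_norm ?ler0c ?sqrtr_ge0 // !csqrt_sqr ?rCM //; lra.
have xE : x = x'.
  have := n_sqr _ _ xI w1; rewrite e n_sqr // => -[].
  move/andP: xI => [? ?]; move/andP: xI' => [? ?] ee.
  have /eqP : (x - x') * (1 - x - x') = 0 by lra.
  rewrite mulf_eq0 => /orP[/eqP ?|/eqP ?]; lra.
split=> //; have [x0|x0] := eqVneq x 0; [by left|right].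
move: e; rewrite -xE -!mulrA; apply: mulIf.
move/andP: xI => [? ?].
rewrite mulf_neq0 // csqrt_eq0 //; last by lra.
by apply/eqP; lra.
Qed.

Definition inv1 (p : params R) : R[i] := pw1 p * csqrt (px1 p) * csqrt (1 - px1 p).

(* At [x2 = 1/2] the square of [a2] involves [w2 ^+ 2], which is why [w2] and
   [- w2] need the finer invariant of [b22_decomposition]. *)
Definition inv2_phase (p : params R) : R[i] :=
  if px2 p == 1 / 2 then pw2 p ^+ 2 else pw2 p.
Definition inv2 (p : params R) : R[i] :=
  b_coef y (px1 p) ^+ 2 * (inv2_phase p * csqrt (px2 p) * csqrt (1 - px2 p))
  - (y / (1 - 2 * px1 p)%:C%C) ^+ 2 * (inv1 p)^*.

Let half_sqr : csqrt (1 / 2 : R) * csqrt (1 - 1 / 2) = 2^-1.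
Proof.
rewrite (_ : 1 - 1 / 2 = 1 / 2); last by lra.
by rewrite -expr2 csqrt_sqr ?divr_ge0 ?ler0n // mul1r rCV rCn.
Qed.

Let sqr2 : csqrt (2 : R) ^+ 2 = 2.
Proof. by rewrite csqrt_sqr ?rCn // ler0n. Qed.
Let csqrt2_neq0 : csqrt (2 : R) != 0.
Proof. by rewrite csqrt_eq0 ?ler0n // pnatr_eq0. Qed.

Lemma model_pos p n (M1 M2 : 'M[R[i]]_n) : b_model y p M1 M2 -> (0 < n)%N.
Proof. by case. Qed.

Lemma model_inv1 p n (M1 M2 : 'M[R[i]]_n) : b_model y p M1 M2 ->
  M1 *m M1 = (inv1 p)%:M.
Proof.
have wsq x w : weight_mx x w *m weight_mx x w = (w * csqrt x * csqrt (1 - x))%:M.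
  by rewrite /weight_mx !mx2E; apply: mx2_eq; ring.
case => [x1E|_ _|_ _]; last 1 first.
- exact: wsq.
- rewrite /b1_mx1 /inv1 (_ : (1 + cmod y) / 2 = 1 - px1 p) -?x1E; last by rewrite x1E; field.
  exact: wsq.
- rewrite /b21_mx1 tensmx_mul wsq mulmx1 -[(_ * csqrt (1 - _))%:M]scalemx1.
  by rewrite tensmxZl tensmx11 scalemx1.
Qed.

Lemma model_inv2 p n (M1 M2 : 'M[R[i]]_n) : in_DyT2 y p ->
  px1 p < (1 - cmod y) / 2 -> b_model y p M1 M2 -> M2 *m M2 = (inv2 p)%:M.
Proof.
move=> [_ _ w1 w2] x1lt; have ww : pw1 p * (pw1 p)^* = 1 by rewrite -normCK w1 expr1n.
have invC : (inv1 p)^* = (pw1 p)^* * csqrt (px1 p) * csqrt (1 - px1 p).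
  by rewrite /inv1 !rmorphM /= !csqrtC.
case => [x1E|_ /andP[x20 x2h]|_ x2E].
- by move: x1lt; rewrite x1E ltxx.
- rewrite /inv2 invC /inv2_phase (lt_eqF x2h) /b21_mx2.
  set W := weight_mx (px2 p) _; set S := mx2 1 0 0 (-1); set P := mx2 0 _ _ 0.
  have SS : S *m S = 1%:M by rewrite !mx2E; apply: mx2_eq; ring.
  have PS : P *m S = - (S *m P) by rewrite !mx2E; apply: mx2_eq; ring.
  have WW : W *m W = (pw2 p * csqrt (px2 p) * csqrt (1 - px2 p)) *: 1%:M.
    by rewrite scalemx1 /W /weight_mx !mx2E; apply: mx2_eq; ring.
  have PP : P *m P = (- ((pw1 p)^* * csqrt (px1 p) * csqrt (1 - px1 p))) *: 1%:M.
    by rewrite scalemx1 !mx2E; apply: mx2_eq; ring.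
  clearbody W S P.
  rewrite mul_lin_comb !tensmx_mul !mulmx1 !mul1mx SS WW PS PP.
  rewrite tensmxZl tensmxNl tensmxZr tensmx11 -[RHS]scalemx1.
  move: (S *m P *t W) (1%:M : 'M[R[i]]_(2 * 2)) => Z I.
  by modring.
- rewrite /inv2 invC /inv2_phase x2E eqxx -mulrA half_sqr /b22_mx2 -sqr2.
  have : (1 - 2 * px1 p)%:C%C != 0 :> R[i].
    rewrite (inj_eq (@complexI R) _ 0) gt_eqF //; have := cmod_ge0 y.
    by move=> ?; lra.
  move: (1 - 2 * px1 p)%:C%C => d d0.
  by rewrite !mx2E; apply: mx2_eq; field; rewrite ?csqrt2_neq0 ?d0.
Qed.

(** The reduced part of [a2] is here a multiple of [K], which is built from [a1] alone. Its
    coefficient is linear in [w2], so it separates [w2] from [- w2]. *)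
Lemma b22_decomposition x1 w1 w2 (d := (1 - 2 * x1)%:C%C) :
  0 <= x1 < (1 - cmod y) / 2 -> `|w1| = 1 ->
  let M1 := b22_mx1 x1 w1 in
  let K := dagmx M1 *m M1 - M1 *m dagmx M1 in
  K = d *: mx2 1 0 0 (-1) /\
  b22_mx2 y x1 w1 w2 = (y / d ^+ 2) *: (dagmx M1
      - (2 * (w1 * csqrt x1 * csqrt (1 - x1))^*) *: M1)
    + (w2 * (b_coef y x1 / csqrt 2 / d)) *: K.
Proof.
move=> x1I w1n M1 K; have ww : w1 * w1^* = 1 by rewrite -normCK w1n expr1n.
have yge := cmod_ge0 y.
have x1I' : 0 <= x1 <= 1 by move/andP: x1I => [-> ?] /=; lra.
have rsE : csqrt x1 ^+ 2 = 1 - csqrt (1 - x1) ^+ 2.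
  by apply/eqP; rewrite eq_sym subr_eq csqrt_sqrD.
have dE : d = csqrt (1 - x1) ^+ 2 - csqrt x1 ^+ 2 by rewrite csqrt_sqrB.
have d0 : d != 0.
  rewrite (inj_eq (@complexI R) _ 0) gt_eqF //; move/andP: x1I => [_ ?]; lra.
have KE : K = d *: mx2 1 0 0 (-1).
  rewrite /K /M1 /b22_mx1 /weight_mx dE !mx2E !rmorphM /= rmorph0 !csqrtC.
  by apply: mx2_eq; ring: ww.
split => //; rewrite KE /M1 /b22_mx1 /b22_mx2 /weight_mx !mx2E !rmorphM /= rmorph0 !csqrtC.
rewrite -/d; clear KE; clearbody d.
have aux (a b c : R[i]) : c = d * b -> a * b / d = a / d ^+ 2 * c.
  by move=> ->; field.
have aux' (a b c e : R[i]) : c = - (d * (e * b)) ->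
    - (e * (a * b / d)) = a / d ^+ 2 * c.
  by move=> ->; field.
apply: mx2_eq.
- by field; rewrite csqrt2_neq0 d0.
- by rewrite !mulr0 addr0; apply: aux; rewrite dE; ring: ww rsE.
- by rewrite !mulr0 addr0; apply: aux'; rewrite dE; ring: ww rsE.
- by field; rewrite csqrt2_neq0 d0.
Qed.
End Invariants.

(** * Recovery of the parameters from a unitary equivalence *)

Section Nonequivalence.
Variables (R : realType) (y : R[i]).
Hypothesis y_lt1 : `|y| < 1.

Lemma inv2_phase_norm (p : params R) : `|pw2 p| = 1 -> `|inv2_phase p| = 1.
Proof. by move=> w2; rewrite /inv2_phase; case: ifP => // _; rewrite normrX w2 expr1n. Qed.

Lemma params_equiv_of (p q : params R) : in_DyT2 y p -> in_DyT2 y q ->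
  px1 p = px1 q -> px1 p = 0 \/ pw1 p = pw1 q ->
  px2 p = px2 q -> px2 p = 0 \/ pw2 p = pw2 q -> params_equiv y p q.
Proof.
case: p q => [x1 x2 w1 w2] [x1' x2' w1' w2'] Dp Dq /= e1 h1 e2 h2.
(* Each of the first two generating relations lets one phase vary and fixes the other; [mid] changes
   them one at a time. *)
subst x1' x2'; set mid := Params x1 x2 w1' w2.
have [_ _ _ w2n] := Dp; have [x1I x2I w1n' w2n'] := Dq.
have Dmid : in_DyT2 y mid by split.
apply: (rst_trans _ _ _ mid).
  case: h1 => [x10|w1E]; last by rewrite /mid -w1E; apply: rst_refl.
  by apply: rst_step; split=> //; constructor 1.
case: h2 => [x20|w2E]; last by rewrite /mid w2E; apply: rst_refl.
by apply: rst_step; split=> //; constructor 2.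
Qed.

Lemma equivalent_models_params (E : cstarAlgType R) (a1 a2 : E) (p q : params R)
    n m (M1 M2 : 'M[R[i]]_n) (N1 N2 : 'M[R[i]]_m) rho sigma :
  in_DyT2 y p -> in_DyT2 y q ->
  b_model y p M1 M2 -> given_by_matrices a1 a2 M1 M2 rho ->
  b_model y q N1 N2 -> given_by_matrices a1 a2 N1 N2 sigma ->
  unitarily_equivalent rho sigma -> params_equiv y p q.
Proof.
move=> Dp Dq bp [rP rM1 rM2] bq [sP sN1 sN2] [U [Ulin _ Udot Uint]].
have UZD k u v : U (k *: u + v) = k *: U u + U v by exact: Ulin.
have U0 : U 0 = 0.
  have := UZD 1 0 0; rewrite !scale1r addr0 => /eqP.
  by rewrite addrC -subr_eq subrr eq_sym => /eqP.
have UZ k u : U (k *: u) = k *: U u by rewrite -[k *: u]addr0 UZD U0 addr0.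
have UD u v : U (u + v) = U u + U v by rewrite -[u]scale1r UZD !scale1r.
have U_eq0 v : v != 0 -> U v != 0.
  apply: contraNneq => Uv0; apply/eqP/hdot_eq0; rewrite -Udot Uv0.
  exact: hdot0l.
have n0 := model_pos bp.
pose c1 : Cn R n := const_mx 1.
have c1_neq0 : c1 != 0.
  apply/eqP => /matrixP/(_ (Ordinal n0) 0)/eqP.
  by rewrite !mxE oner_eq0.
have UM1 v : U (M1 *m v) = N1 *m U v by rewrite -rM1 Uint sN1.
have UM2 v : U (M2 *m v) = N2 *m U v by rewrite -rM2 Uint sN2.
(* A scalar square is a unitary invariant, even before the two dimensions are known to agree. *)
have scal_eq (M : 'M[R[i]]_n) (N : 'M[R[i]]_m) k l :
    (forall v, U (M *m v) = N *m U v) -> M *m M = k%:M -> N *m N = l%:M -> k = l.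
  move=> UM Mk Nl; apply/eqP; rewrite -subr_eq0; apply/eqP.
  have := UM (M *m c1); rewrite [in RHS]UM !mulmxA Mk Nl !mul_scalar_mx UZ => /eqP.
  rewrite -subr_eq0 -scalerBl scaler_eq0 (negPf (U_eq0 _ c1_neq0)) orbF.
  by move=> /eqP.
have e1 := scal_eq _ _ _ _ UM1 (model_inv1 bp) (model_inv1 bq).
have yge := cmod_ge0 y.
have yR : cmod y < 1.
  by move: y_lt1; rewrite cmodE [X in _ < X](_ : 1 = 1%:C%C) // ltcR.
have [/andP[x10 x1m] x2I w1n w2n] := Dp; have [/andP[x10' x1m'] x2I' w1n' w2n'] := Dq.
have [||x1E h1] := weight_param_inj _ _ w1n w1n' e1.
- by rewrite x10 /=; lra.
- by rewrite x10' /=; lra.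
have [x1max|x1N] := eqVneq (px1 p) ((1 - cmod y) / 2).
  apply: rst_step; split=> //; constructor 3; split; rewrite -?x1E //.
  (* On the boundary [x1] is nonzero because [|y| < 1], so the phase [w1] is determined. *)
  have : (1 - cmod y) / 2 != 0 by rewrite gt_eqF // divr_gt0 ?subr_gt0 ?ltr0n.
  by case: h1 => // x1_0; rewrite -x1max x1_0 eqxx.
have x1lt : 0 <= px1 p < (1 - cmod y) / 2 by rewrite x10 lt_neqAle x1N x1m.
have x1lt' : 0 <= px1 q < (1 - cmod y) / 2 by rewrite -x1E.
have e2 := scal_eq _ _ _ _ UM2
  (model_inv2 Dp (andP x1lt).2 bp) (model_inv2 Dq (andP x1lt').2 bq).
move: e2; rewrite /inv2 -x1E e1 => /addIr.
have b0 : b_coef y (px1 p) ^+ 2 != 0 by rewrite expf_neq0 // b_coef_gt0.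
move=> /(mulfI b0) e2.
have [//|//|x2E h2] := weight_param_inj _ _
  (inv2_phase_norm w2n) (inv2_phase_norm w2n') e2.
apply: params_equiv_of => //.
have [x2half|x2N] := eqVneq (px2 p) (1 / 2); last first.
  by move: h2; rewrite /inv2_phase -x2E (negPf x2N).
right.
have UM1' v : U (dagmx M1 *m v) = dagmx N1 *m U v.
  have r' k (P : 'M[R[i]]_k) (pi : E -> Cn R k -> Cn R k) : representation pi ->
      (forall v, pi a1 v = P *m v) -> forall v, pi (star a1) v = dagmx P *m v.
    move=> piP piE u; apply: hdot_inj => w.
    by rewrite (rep_starP piP) piE mxop_adjP dagmxK.
  by rewrite -(r' _ _ _ rP rM1) Uint (r' _ _ _ sP sN1).
have decomp (r : params R) k (P1 P2 : 'M[R[i]]_k) : in_DyT2 y r -> px1 r = px1 p ->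
    px2 r = 1 / 2 -> b_model y r P1 P2 ->
  let d : R[i] := (1 - 2 * px1 p)%:C%C in
  let K := dagmx P1 *m P1 - P1 *m dagmx P1 in
  [/\ K *m K = (d ^+ 2)%:M &
    P2 = (y / d ^+ 2) *: (dagmx P1 - (2 * (inv1 r)^*) *: P1)
     + (pw2 r * (b_coef y (px1 p) / csqrt 2 / d)) *: K].
  move=> [_ _ w1r _] r1 r2 br; case: k P1 P2 / br => [r1'|_ /andP[_]|_ _].
  - by move: x1N; rewrite -r1 r1' eqxx.
  - by rewrite r2 ltxx.
  - have x1r : 0 <= px1 r < (1 - cmod y) / 2 by rewrite r1.
    have [K1 K2] := b22_decomposition (pw2 r) x1r w1r; rewrite -r1 /=.
    split; last exact: K2.
    by rewrite K1 -scalemxAl -scalemxAr !mx2E; apply: mx2_eq; ring.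
have [KK Mdec] := decomp _ _ _ _ Dp erefl x2half bp.
have [_ Ndec] := decomp _ _ _ _ Dq (esym x1E) (etrans (esym x2E) x2half) bq.
set d : R[i] := (1 - 2 * px1 p)%:C%C in KK Mdec Ndec.
set K := dagmx M1 *m M1 - M1 *m dagmx M1 in KK Mdec.
set L := dagmx N1 *m N1 - N1 *m dagmx N1 in Ndec.
have d0 : d != 0.
  rewrite (inj_eq (@complexI R) _ 0) gt_eqF //; move/andP: x1lt => [_ ?]; lra.
have UN v : U (- v) = - U v by rewrite -scaleN1r UZ scaleN1r.
have UK v : U (K *m v) = L *m U v.
  by rewrite /K /L !mulmxBl -!mulmxA UD UN !(UM1, UM1').
(* [K] is injective because its square is the nonzero scalar [d ^ 2]. The coefficients of [K] in the
   two decompositions can thus be compared on [c1]. *)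
have Kc1 : K *m c1 != 0.
  apply: contraNneq c1_neq0 => Kc0; have : K *m (K *m c1) = 0 by rewrite Kc0 mulmx0.
  rewrite mulmxA KK mul_scalar_mx => /eqP; rewrite scaler_eq0 expf_eq0 /= (negPf d0).
  by [].
clearbody K L.
have := UM2 c1; rewrite Mdec Ndec !mulmxDl UD -!scalemxAl !mulmxBl -!scalemxAl !UZ.
rewrite UD UN UZ UM1 UM1' UK e1 => /addrI /eqP.
rewrite -subr_eq0 -scalerBl -mulrBl scaler_eq0 -UK (negPf (U_eq0 _ Kc1)) orbF.
rewrite mulf_eq0 subr_eq0 => /orP[/eqP //|].
have s20 : csqrt (2 : R) != 0 by rewrite csqrt_eq0 ?ler0n // pnatr_eq0.
by rewrite !mulf_eq0 !invr_eq0 (negPf d0) (negPf s20) (negPf (b_coef_gt0 x1lt)).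
Qed.
End Nonequivalence.

Lemma cis0 (R : realType) : cis (0 : R) = 1.
Proof. by rewrite /cis cos0 sin0. Qed.

Theorem theorem3p1 (R : realType) (y : R[i])
    (E : cstarAlgType R) (a1 a2 : E) (hE : universal_E y a1 a2) :
  ((exists x : E, x != 0) <-> `|y| <= 1)
  /\
  (y != 0 -> `|y| <= 1 ->
     (`|y| = 1 ->
        (exists rho, given_by_matrices a1 a2 (a_mx1 R) (a_mx2 y) rho)
        /\
        (forall (H : hilbertType R) (pi : E -> H -> H),
           representation pi -> irreducible pi ->
           exists rho, given_by_matrices a1 a2 (a_mx1 R) (a_mx2 y) rho
                       /\ unitarily_equivalent pi rho))
     /\
     (`|y| < 1 ->
        (forall p : params R, in_DyT2 y p ->
           exists n (M1 M2 : 'M[R[i]]_n) rho,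
             b_model y p M1 M2 /\ given_by_matrices a1 a2 M1 M2 rho)
        /\
        (forall (H : hilbertType R) (pi : E -> H -> H),
           representation pi -> irreducible pi ->
           exists x1 x2 phi1 phi2 : R,
             let p := Params x1 x2 (cis phi1) (cis phi2) in
             [/\ 0 <= phi1 < 2 * trigo.pi, 0 <= phi2 < 2 * trigo.pi, in_DyT2 y p
               & exists n (M1 M2 : 'M[R[i]]_n) rho,
                   [/\ b_model y p M1 M2, given_by_matrices a1 a2 M1 M2 rho
                     & unitarily_equivalent pi rho]])
        /\
        (forall p q : params R, in_DyT2 y p -> in_DyT2 y q ->
           ~ params_equiv y p q ->
           forall (n m : nat) (M1 M2 : 'M[R[i]]_n) (N1 N2 : 'M[R[i]]_m) rho sigma,
             b_model y p M1 M2 -> given_by_matrices a1 a2 M1 M2 rho ->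
             b_model y q N1 N2 -> given_by_matrices a1 a2 N1 N2 sigma ->
             ~ unitarily_equivalent rho sigma))).
Proof.
have [rel _] := hE; have yge := cmod_ge0 y.
split.
  split; [exact: norm_le1_of_relations rel | exact: universal_nontrivial hE].
move=> y0 y1; split=> [yE|ylt]; [split|split; [|split]].
(* The model (a) is the two-dimensional one with [x1 = 0], phase 1, [u = y] and [s = 0]. *)
- have [||||||r Hr] := @two_dim_exists _ _ _ _ _ hE 0 1 1 y _ _ _ _ _ 0.
  + exact: rmorph0.
  + exact: rmorph1.
  + by rewrite rmorph1 mulr1.
  + by rewrite expr0n expr1n add0r.
  + by rewrite expr0n expr1n subr0 mulr1.
  + by rewrite mul0r mulr0 add0r -normCK yE expr1n.
  exists r; move: Hr; rewrite !mulr0 !mulr1 oppr0.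
  by rewrite -/(a_mx1 R) -/(a_mx2 y).
- move=> H pi piP pi_irr.
  have cy : cmod y = 1 by rewrite /cmod yE.
  have [x1 [w1 [/andP[x10 x1m] _ cases]]] :=
    irreducible_classification hE piP pi_irr y0.
  have x1E : x1 = 0 by apply/le_anti; rewrite x10 andbT (le_trans x1m) // cy subrr mul0r.
  case: cases => [[_ [r [Hr Ur]]]|[x2 [w2 [x1lt _ _]]]]; last first.
    by move: x1lt; rewrite x1E cy subrr mul0r ltxx.
  exists r; split => //; move: Hr.
  have -> : weight_mx x1 w1 = a_mx1 R.
    rewrite x1E /weight_mx /a_mx1 /csqrt sqrtr0 subr0 sqrtr1.
    by apply: mx2_eq; rewrite ?mulr0.
  suff -> : y / (1 - 2 * x1)%:C%C *: ortho_mx w1 x1 = a_mx2 y by [].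
  rewrite x1E mulr0 subr0 /ortho_mx /a_mx2 /csqrt sqrtr0 subr0 sqrtr1 mx2_scale.
  by rewrite divr1; apply: mx2_eq; rewrite ?mulr0 ?mulr1 ?oppr0 ?mulr0.
- by move=> p; apply: (model_exists hE).
- move=> H pi piP pi_irr.
  have [x1 [w1 [/andP[x10 x1m] w1n cases]]] :=
    irreducible_classification hE piP pi_irr y0.
  have [phi1 phi1I w1E] := cis_surj w1n.
  have pi0 := pi_gt0 R.
  case: cases => [[x1E [r [Hr Ur]]]|[x2 [w2 [x1lt w2n cases]]]].
    (* In (b1) the second weight and phase may be arbitrary; 0 is taken for both. *)
    exists x1, 0, phi1, 0; split.
    + exact: phi1I.
    + by rewrite lexx mulr_gt0 ?ltr0n.
    + by split; rewrite /= -?w1E ?cis0 ?normr1 ?x10 ?x1m ?lexx ?divr_ge0 ?ler0n.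
    exists 2%N, (b1_mx1 y w1), (b1_mx2 y w1), r; split => //.
      by rewrite w1E; exact: (@B_model1 _ y (Params x1 0 (cis phi1) (cis 0))).
    have e1 : (1 + cmod y) / 2 = 1 - x1 by rewrite x1E; field.
    have e2 : 1 - 2 * x1 = cmod y by rewrite x1E; field.
    have -> : b1_mx1 y w1 = weight_mx x1 w1 by rewrite /b1_mx1 e1 -x1E.
    suff -> : b1_mx2 y w1 = y / (1 - 2 * x1)%:C%C *: ortho_mx w1 x1 by [].
    rewrite /b1_mx2 e1 -x1E e2 -cmodE /ortho_mx mx2_scale.
    by apply: mx2_eq; ring.
  have [phi2 phi2I w2E] := cis_surj w2n.
  exists x1, x2, phi1, phi2; split.
  + exact: phi1I.
  + exact: phi2I.
  + split; rewrite /= -?w1E -?w2E ?x10 ?x1m //.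
    by case: cases => [[/andP[-> /ltW ->]]|[-> _]]; rewrite ?lexx ?divr_ge0 ?ler0n.
  have x1lt' : 0 <= x1 < (1 - cmod y) / 2 by rewrite x10.
  case: cases => [[x2I [r [Hr Ur]]]|[x2E [r [Hr Ur]]]].
    exists (2 * 2)%N, (b21_mx1 x1 w1), (b21_mx2 y x1 x2 w1 w2), r; split => //.
    by rewrite w1E w2E; exact: (@B_model21 _ y (Params x1 x2 (cis phi1) (cis phi2))).
  exists 2%N, (b22_mx1 x1 w1), (b22_mx2 y x1 w1 w2), r; split => //.
  by rewrite w1E w2E; exact: (@B_model22 _ y (Params x1 x2 (cis phi1) (cis phi2))).
- move=> p q Dp Dq npq n m M1 M2 N1 N2 rho sigma bp rP bq sP equiv.
  apply: npq; exact: (equivalent_models_params ylt Dp Dq bp rP bq sP equiv).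
Qed.
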